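(* Let $\alpha\in(1,2)$. Suppose $u_0(x)=c+m((-\infty,x])$ with $c\in\mathbb{R}$ and $m$ a finite signed Borel measure on $\mathbb{R}$, and let $u$ be the solution of $u_t+\Lambda^\alpha u+uu_x=0$, $u(\cdot,0)=u_0$. Then $u_x\in C((0,T];L^p(\mathbb{R}))$ for every $1\le p\le\infty$ and every $T>0$. Moreover, let $u$ and $\widetilde u$ be two such solutions with initial data $u_0$ and $\widetilde u_0$ of this form (with constants $c,\widetilde c$ and finite signed measures $m,\widetilde m$), suppose that $\widetilde u_x(x,t)\ge0$ for a.e. $x$ and all $t>0$, and that $u_0-\widetilde u_0\in L^1(\mathbb{R})$. Then $$\|u(t)-\widetilde u(t)\|_1\le\|u_0-\widetilde u_0\|_1\qquad\text{for all }t>0.$$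
   Context: $\Lambda^\alpha=(-\partial_x^2)^{\alpha/2}$ is defined by $\widehat{\Lambda^\alpha v}(\xi)=|\xi|^\alpha\widehat v(\xi)$; for bounded smooth functions and $\alpha\in(1,2)$ it is given by $\Lambda^\alpha w(x)=-C(\alpha)\int_{\mathbb{R}}\frac{w(x+z)-w(x)-w_x(x)z}{|z|^{1+\alpha}}dz$. For $u_0\in L^\infty(\mathbb{R})$, ''the solution'' means the unique function $u$ such that for all $T>0$: $u\in C_b((0,T)\times\mathbb{R})$, $u\in C_b^\infty((a,T)\times\mathbb{R})$ for every $a\in(0,T)$, $u$ satisfies the equation on $(0,T)\times\mathbb{R}$, and $u(\cdot,t)\to u_0$ weak-$*$ in $L^\infty(\mathbb{R})$ as $t\to0$. *)

(* Defs.v *)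
From HB Require Import structures.
From mathcomp Require Import all_boot all_order all_algebra.
From mathcomp Require Import all_classical all_reals all_analysis.
Set Implicit Arguments. Unset Strict Implicit. Unset Printing Implicit Defensive.
Import Order.TTheory GRing.Theory Num.Theory.
Import numFieldNormedType.Exports.
Local Open Scope classical_set_scope.
Local Open Scope ring_scope.

Section Defs.
Context {R : realType}.
Notation leb := (@lebesgue_measure R).

Definition dx (f : R -> R -> R) : R -> R -> R := fun x t => derive1 (fun y => f y t) x.
Definition dt (f : R -> R -> R) : R -> R -> R := fun x t => derive1 (fun s => f x s) t.
Definition pd (b : bool) f := if b then dx f else dt f.
Definition derivable_dir (b : bool) (f : R -> R -> R) (x t : R) : Prop :=
  if b then derivable (fun y => f y t) x 1 else derivable (fun s => f x s) t 1.
Fixpoint iterpd (s : seq bool) (f : R -> R -> R) : R -> R -> R :=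
  match s with [::] => f | b :: s' => pd b (iterpd s' f) end.

Definition Cb_strip (a T : R) (f : R -> R -> R) : Prop :=
  (forall x t, a < t < T -> {for (x, t), continuous (fun p : R * R => f p.1 p.2)}) /\
  exists M : R, forall x t, a < t < T -> `|f x t| <= M.

Definition Cinfb_strip (a T : R) (f : R -> R -> R) : Prop :=
  forall s : seq bool, Cb_strip a T (iterpd s f) /\
    (forall b x t, a < t < T -> derivable_dir b (iterpd s f) x t).

(* C(alpha): normalising constant so that the symbol of Lambda^alpha is |xi|^alpha *)
Definition Calpha (alpha : R) : R :=
  (Rintegral leb setT (fun z : R => (1 - cos z) / `|z| `^ (1 + alpha)))^-1.

(* Lambda^alpha w (x) for bounded smooth w, alpha in (1,2) *)
Definition frac_lap (alpha : R) (w : R -> R) (x : R) : R :=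
  - Calpha alpha *
    Rintegral leb setT (fun z : R => (w (x + z) - w x - derive1 w x * z) / `|z| `^ (1 + alpha)).

Definition is_solution (alpha : R) (u0 : R -> R) (u : R -> R -> R) : Prop :=
  forall T : R, 0 < T ->
    [/\ Cb_strip 0 T u,
        (forall a, 0 < a < T -> Cinfb_strip a T u),
        (forall x t, 0 < t < T ->
           dt u x t + frac_lap alpha (fun y => u y t) x + u x t * dx u x t = 0) &
        (forall phi : R -> R, leb.-integrable setT (EFin \o phi) ->
           (fun t => Rintegral leb setT (fun x => u x t * phi x)) @ 0^'+ -->
             Rintegral leb setT (fun x => u0 x * phi x))].

Definition init_data (c : R) (m : {charge set R -> \bar R}) : R -> R :=
  fun x => c + fine (m [set` `]-oo, x]]).

End Defs.

(* Main.v *)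
(** Write w for the difference of two solutions.  Kato's inequality tested against the weight
    phi_r(x) = 1/(1 + (x/r)^2) controls the growth of the integral of |w| phi_r; the nonlocal error is
    bounded by the L^1 norm of Lambda^alpha phi_r, which tends to 0 as r tends to infinity because
    alpha > 1.  Hence the L^1 norm of w does not increase on t > 0.

    To start at t = 0, where u is only weak-* continuous, one uses |u_x| <= C t^(-1/alpha): at a near-maximum of
    D = u(. + k) - u the nonlocal term dominates, and sup D / |k| obeys a Riccati inequality whose solutions
    forget their past.  As t^(-1/alpha) is integrable at 0, space averages of w, for which weak-*
    convergence becomes pointwise, satisfy a linear equation with integrable forcing.

    Comparing u with its translates then bounds the L^1 norm of u_x by the total variation of m, and Kato's
    inequality with the weights phi_r' - phi_r makes the tails of u_x uniformly small in time, whence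
    continuity in L^1; the other exponents follow from |f|^p <= M^(p-1) |f|.

    No integral is ever differentiated: all evolution estimates come from one-step Taylor
    expansions in time, whose quadratic errors vanish when the steps are refined. *)

Require Import Defs.
From HB Require Import structures.
From mathcomp Require Import all_boot all_order all_algebra.
From mathcomp Require Import all_classical all_reals all_analysis.
From mathcomp Require Import measurable_realfun ess_sup_inf ring lra.
Set Implicit Arguments. Unset Strict Implicit. Unset Printing Implicit Defensive.
Import Order.TTheory GRing.Theory Num.Theory.
Import numFieldNormedType.Exports.
Local Open Scope classical_set_scope.
Local Open Scope ring_scope.

(** Three obstacles shape the proof. The difference of two solutions is only known to be bounded at
    positive times, so its integrability must come out of the estimate; hence integrable weights,
    with algebraic decay so that their increments are controlled by the weight itself. Weak-*
    convergence gives no upper bound on the norm at small times, since norms can only drop in a weak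
    limit. Averaging in space repairs this and commutes with the nonlocal operator, but not with
    [u u_x]; the price is a time-integrable bound on that product. Such a bound must not depend on
    the initial slope, so a superlinear gain is needed. It comes from the boundedness of [u]: if the
    increment [D = u(. + k) - u] has supremum [G |k|], its integral over an annulus of radius [r] is
    at most [4 M |k|], whatever the slope, while [r sup D] is twice that for [r = 8 M / G]. The
    kernel at this radius is of order [G^(1+alpha)], which beats the convective [G^2] because alpha
    > 1. Suprema on the line need not be attained; near-maxima replace them, with errors removed by
    a last limit. *)

(* [integrable] is a boolean; a [Prop] wrapper keeps [done] from comparing it with order hypotheses. *)
Variant L1f {R : realType} (f : R -> R) : Prop :=
  L1_of_integrable of (@lebesgue_measure R).-integrable setT (EFin \o f).

Definition RI {R : realType} (f : R -> R) : R := Rintegral (@lebesgue_measure R) setT f.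

Section Burgers.
Context {R : realType}.
Local Notation mR := (measurableTypeR R).
Local Notation mR2 := [the measurableType _ of (mR * mR)%type].
Local Notation mu := (@lebesgue_measure R).
Local Notation L1 f := (L1f (f : R -> R)).
Local Notation I f := (RI (f : R -> R)).
Local Notation meas f := (measurable_fun (setT : set (measurableTypeR R)) (f : R -> R)).
Local Notation meas2 F := (measurable_fun [set: mR2] (fun p => (F p : R))).

(** * Integrable real functions *)

Section RealIntegral.
Implicit Types f g : R -> R.

Lemma L1_integrable f : L1 f -> mu.-integrable setT (EFin \o f).
Proof. by case. Qed.

Lemma L1_meas f : L1 f -> meas f.
Proof. by move=> /L1_integrable/measurable_int/measurable_EFinP. Qed.

Lemma L1_dom f g : meas f -> L1 g -> (forall x, `|f x| <= g x) -> L1 f.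
Proof.
move=> mf [ig] fg; split; apply: (le_integrable _ _ _ ig) => //.
  exact/measurable_EFinP.
by move=> x _ /=; rewrite lee_fin (le_trans (fg x))// ler_norm.
Qed.

Lemma L1D f g : L1 f -> L1 g -> L1 (fun x => f x + g x).
Proof. by move=> [iF] [iG]; split; apply: eq_integrable (integrableD _ iF iG). Qed.

Lemma L1B f g : L1 f -> L1 g -> L1 (fun x => f x - g x).
Proof. by move=> [iF] [iG]; split; apply: eq_integrable (integrableB _ iF iG). Qed.

Lemma L1Z k f : L1 f -> L1 (fun x => k * f x).
Proof. by move=> [iF]; split; apply: eq_integrable (integrableZl _ k iF). Qed.

Lemma L1Zr k f : L1 f -> L1 (fun x => f x * k).
Proof. by move=> iF; have := L1Z k iF; under eq_fun do rewrite mulrC. Qed.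

Lemma L1_abs f : L1 f -> L1 (fun x => `|f x|).
Proof. by move=> [iF]; split; apply: integrable_norm. Qed.

Lemma L1_mulb f g K : meas f -> (forall x, `|f x| <= K) -> L1 g -> L1 (fun x => f x * g x).
Proof.
move=> mf fK ig; apply: (@L1_dom _ (fun x => K * `|g x|)).
- exact: measurable_funM mf (L1_meas ig).
- exact: L1Z (L1_abs ig).
- by move=> x; rewrite normrM ler_wpM2r.
Qed.

Lemma Rint_le f g : L1 f -> L1 g -> (forall x, f x <= g x) -> I f <= I g.
Proof. by move=> [iF] [iG] fg; apply: le_Rintegral. Qed.

Lemma Rint_ge0 f : (forall x, 0 <= f x) -> 0 <= I f.
Proof. by move=> f0; apply: Rintegral_ge0. Qed.

Lemma Rint_eq f g : f =1 g -> I f = I g.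
Proof. by move=> /funext ->. Qed.

Lemma Rint_norm f : L1 f -> `|I f| <= I (fun x => `|f x|).
Proof. by move=> [iF]; apply: le_normr_Rintegral. Qed.

Lemma Rint_normle f g : L1 f -> L1 g -> (forall x, `|f x| <= g x) -> `|I f| <= I g.
Proof.
move=> iF iG fg; apply: le_trans (Rint_norm iF) _; apply: Rint_le => //.
exact: L1_abs.
Qed.

Lemma RintE f : L1 f -> (\int[mu]_x (f x)%:E = (I f)%:E)%E.
Proof. by move=> [iF]; rewrite /RI /Rintegral fineK//; apply: integrable_fin_num. Qed.

Lemma RintD f g : L1 f -> L1 g -> I (fun x => f x + g x) = I f + I g.
Proof. by move=> [iF] [iG]; rewrite /RI RintegralD. Qed.

Lemma RintB f g : L1 f -> L1 g -> I (fun x => f x - g x) = I f - I g.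
Proof. by move=> [iF] [iG]; rewrite /RI RintegralB. Qed.

Lemma RintZ k f : L1 f -> I (fun x => k * f x) = k * I f.
Proof. by move=> [iF]; rewrite /RI RintegralZl. Qed.

Lemma meas_shift (a : R) : measurable_fun (setT : set (measurableTypeR R)) (fun x : measurableTypeR R => (x + a : measurableTypeR R)).
Proof. exact: measurable_funD. Qed.

(** By uniqueness of Lebesgue measure it is enough to compare lengths of half-open intervals.
    Packing the translation as [sh] gives its pushforward the structure of a measure. *)
Lemma lebesgue_measure_shift (a : R) (A : set (measurableTypeR R)) : measurable A ->
  pushforward mu (fun x : measurableTypeR R => (x + a : measurableTypeR R)) A = mu A.
Proof.
move=> mA; apply/esym.
pose sh : {mfun _ >-> _} := HB.pack (fun x : measurableTypeR R => (x + a : measurableTypeR R))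
  (isMeasurableFun.Build _ _ _ _ _ (meas_shift a)).
apply: (@lebesgue_measure_unique _ (pushforward mu sh)) => //= _ [[b c]] _ <-.
rewrite /pushforward/=.
have -> : (fun x => x + a) @^-1` `]b, c] = `]b - a, c - a]%classic.
  by apply/seteqP; split => x /=; rewrite !in_itv/= ltrBlDr lerBrDr.
rewrite !lebesgue_measure_itv/= !lte_fin ltrD2r.
case: ifP => // _; rewrite -!EFinB; congr EFin; ring.
Qed.

Lemma ge0_integral_shift (f : R -> \bar R) (a : R) : measurable_fun (setT : set (measurableTypeR R)) f -> (forall x, 0 <= f x)%E ->
  (\int[mu]_x f (x + a)%R = \int[mu]_x f x)%E.
Proof.
move=> mf f0.
have := @ge0_integral_pushforward _ _ _ _ R _ (meas_shift a) mu setT f measurableT mf (fun y _ => f0 y).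
rewrite preimage_setT => <-.
apply: eq_measure_integral; first exact: meas_shift.
by move=> ? A mA _; exact: lebesgue_measure_shift.
Qed.

Lemma meas_comp_shift f a : meas f -> meas (fun x => f (x + a)).
Proof. by move=> mf; exact: (measurableT_comp mf (meas_shift a)). Qed.

Lemma L1_shift f a : L1 f -> L1 (fun x => f (x + a)).
Proof.
move=> iF; have mf := L1_meas iF; split; apply/integrableP; split.
  by apply/measurable_EFinP; exact: meas_comp_shift.
rewrite (@ge0_integral_shift (fun x => `|(f x)%:E|)%E)//.
  by case: iF => /integrableP[].
by apply: measurableT_comp => //; exact/measurable_EFinP.
Qed.

Lemma Rint_shift f a : L1 f -> I (fun x => f (x + a)) = I f.
Proof.
move=> iF; have mf := L1_meas iF; congr fine.
have := @integral_pushforward _ _ _ _ R _ (meas_shift a) mu setT (EFin \o f) _ _ measurableT.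
rewrite preimage_setT => <-//.
- apply: eq_measure_integral; first exact: meas_shift.
  by move=> ? A mA _; exact: lebesgue_measure_shift.
- exact/measurable_EFinP.
- by case: (L1_shift a iF).
Qed.

End RealIntegral.

(** * Fubini, dominated convergence and Fatou for real-valued integrals *)

Section Tools.
Implicit Types f g : R -> R.

(** Tonelli's criterion in one order: an integrable [g] dominates the slice integrals over [x].
    Integrability of every slice, not of almost every one, makes the iterated integrals equal to
    real numbers at each point. *)
Lemma Rfubini (F : R -> R -> R) g :
  measurable_fun [set: mR2] (fun p => F p.1 p.2) ->
  (forall x, L1 (F x)) -> (forall z, L1 (F^~ z)) -> L1 g ->
  (forall z, I (fun x => `|F x z|) <= g z) ->
  [/\ L1 (fun x => I (F x)), L1 (fun z => I (F ^~ z)) &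
      I (fun x => I (F x)) = I (fun z => I (F ^~ z))].
Proof.
move=> mF iF1 iF2 ig Fg.
pose f (p : mR2) := (F p.1 p.2)%:E.
have mf : measurable_fun [set: mR2] f by exact/measurable_EFinP.
have If : (mu \x mu)%E.-integrable setT f.
  apply: (proj2 (@integrable21ltyP _ _ _ _ R mu mu f mf)).
  apply: (@le_lt_trans _ _ (\int[mu]_z (g z)%:E)%E); last first.
    by rewrite RintE// ltry.
  apply: ge0_le_integral => //=.
  - by move=> z _; apply: integral_ge0.
  - have := @measurable_fun_fubini_tonelli_G _ _ _ _ R mu (abse \o f).
    apply => //.
      by apply: measurableT_comp.
    by move=> z; exact: abse_ge0.
  - by apply/measurable_EFinP; exact: L1_meas ig.
  - move=> z _; rewrite RintE ?lee_fin//.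
    exact: L1_abs.
have EF x : fubini_F mu f x = (I (F x))%:E by rewrite /fubini_F/= (RintE (iF1 x)).
have EG z : fubini_G mu f z = (I (F^~ z))%:E by rewrite /fubini_G/= (RintE (iF2 z)).
split.
- split; have := integrable_fubini_F If; by apply: eq_integrable => // x _; exact: EF.
- apply: (@L1_dom _ g) => //.
    have := measurable_fubini_G If.
    rewrite (_ : fubini_G mu f = EFin \o (fun z => I (F ^~ z))); last first.
      by apply/funext => z; rewrite EG.
    by move/measurable_EFinP.
  by move=> z; rewrite (le_trans (Rint_norm (iF2 z))).
- have H := Fubini If; congr fine.
  transitivity (\int[mu]_x \int[mu]_z f (x, z))%E.
    by apply: eq_integral => x _; rewrite -EF.
  by rewrite H; apply: eq_integral => z _; rewrite -EG.
Qed.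

Lemma Rint_cvg (f_ : nat -> R -> R) f g : (forall n, meas (f_ n)) -> L1 g ->
  (forall n x, `|f_ n x| <= g x) -> (forall x, f_ ^~ x @ \oo --> f x) ->
  I (f_ n) @[n --> \oo] --> I f.
Proof.
move=> mf ig fg ff.
have mf' : meas f by apply: measurable_fun_cvg mf _ => x _; exact: ff.
have iF n : L1 (f_ n) by exact: L1_dom ig _.
have [|||||if' _] := @dominated_convergence _ _ R mu setT measurableT
  (fun n => EFin \o f_ n) (EFin \o f) (EFin \o g) => //.
- by move=> n; exact/measurable_EFinP.
- exact/measurable_EFinP.
- by apply: nearW => x _; apply: cvg_EFin => //; [exact: nearW | exact: ff].
- exact: L1_integrable.
- by apply: nearW => x n _ /=; rewrite lee_fin.
move=> H; have {}if' : L1 f by [].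
suff : (EFin (I (f_ n)) @[n --> \oo] --> EFin (I f))%E by move/fine_cvg.
rewrite -RintE//; under eq_fun do rewrite -(RintE (iF _)).
exact: H.
Qed.

(** The slack [e] lets the integrals of [f_ n] approach [V] from above, as happens when the weight
    [phi] is sent to 1. *)
Lemma fatou_le (D : set mR) (f_ : nat -> R -> R) f (V : \bar R) : measurable D ->
  (forall n, measurable_fun D (f_ n)) ->
  (forall n x, D x -> 0 <= f_ n x) -> (forall x, D x -> f_ ^~ x @ \oo --> f x) ->
  (forall e : R, 0 < e -> \forall n \near \oo, (\int[mu]_(x in D) (f_ n x)%:E <= V + e%:E)%E) ->
  (\int[mu]_(x in D) (f x)%:E <= V)%E.
Proof.
move=> mD mf f0 ff fV; apply/lee_addgt0Pr => e e0.
have /(fatou mu mD) H n : measurable_fun D (EFin \o f_ n).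
  exact/measurable_EFinP.
have {}H := H (fun n x Dx => f0 n x Dx : (0 <= (f_ n x)%:E)%E).
have -> : (\int[mu]_(x in D) (f x)%:E =
           \int[mu]_(x in D) limn_einf (fun n => (EFin \o f_ n) x))%E.
  apply: eq_integral => x /[!inE] Dx; apply/esym.
  have -> // := @cvg_limn_einf_sup _ (fun n => (EFin \o f_ n) x) (f x)%:E.
  by apply: cvg_EFin; [exact: nearW|exact: ff].
apply: le_trans H _; rewrite limn_einf_lim.
apply: lime_le; first exact: is_cvg_einfs.
have [N _ HN] := fV e e0.
near=> n; apply: (@le_trans _ _ (\int[mu]_(x in D) (f_ n x)%:E)%E).
  by apply: ereal_inf_lbound; exists n => /=.
by apply: HN => /=; near: n; exact: nbhs_infty_ge.
Unshelve. all: by end_near. Qed.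

Lemma even_integral_le (f : R -> \bar R) (V : \bar R) : measurable_fun (setT : set mR) f ->
  (forall x, 0 <= f x)%E -> (forall x, f (- x) = f x) ->
  (\int[mu]_(x in `[0%R, +oo[) f x <= V)%E -> (\int[mu]_x f x <= V + V)%E.
Proof.
move=> mf f0 ef fV.
have -> : (setT : set mR) = `]-oo, 0%R] `|` `]0%R, +oo[ :> set R.
  by rewrite -setCitvr setvU.
rewrite ge0_integral_setU//=; last 2 first.
- exact: measurable_funTS.
- apply/disj_setPS => x [/=]; rewrite !in_itv/= andbT => x0.
  by rewrite ltNge x0.
apply: leeD.
- apply: le_trans fV; rewrite ge0_integration_by_substitution0//.
  by under [leRHS]eq_integral do rewrite ef.
- apply: le_trans fV; apply: ge0_subset_integral => //.
  + exact: measurable_funTS.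
  + by move=> x /=; rewrite !in_itv/= !andbT => /ltW.
Qed.

End Tools.

(** * The kernel of the fractional Laplacian *)

Section Kernel.

Lemma powR_cont (a x : R) : 0 < x -> {for x, continuous (fun z => z `^ a)}.
Proof.
move=> x0; apply: differentiable_continuous; apply/derivable1_diffP.
by case: (is_derive1_powR a x0).
Qed.

Lemma is_derive_powRdiv (b x : R) : b != 0 -> 0 < x ->
  is_derive x 1 (fun z => z `^ b / b) (x `^ (b - 1)).
Proof.
move=> b0 x0; have H := is_derive1_powR b x0.
have -> : (fun z => z `^ b / b) = b^-1 \*: (fun z => z `^ b).
  by apply/funext => z /=; rewrite mulrC.
apply: is_derive_eq.
by rewrite /GRing.scale/= mulrA mulVf ?mul1r.
Qed.

(** The integrand may be unbounded at 0, so the fundamental theorem is applied on [[1/(n+1), 1]] and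
    the intervals exhaust []0, 1]] monotonically. For [n = 0] the interval is a point and is treated
    apart. *)
Lemma integral_powR01 (b : R) : 0 < b ->
  (\int[mu]_(x in `]0%R, 1%R]) (x `^ (b - 1))%:E <= (b^-1)%:E)%E.
Proof.
move=> b0; pose F (n : nat) := `[n.+1%:R^-1, 1%R : R]%classic.
have UF : `]0%R, 1%R]%classic = \bigcup_i F i.
  apply/seteqP; split => x /=; rewrite in_itv/=.
    move=> /andP[x0 x1]; exists (Num.truncn x^-1) => //.
    rewrite /F/= in_itv/= x1 andbT invf_ple ?posrE//.
    by rewrite ltW// truncnS_gt.
  move=> [n _]; rewrite /F/= !in_itv/= => /andP[nx ->]; rewrite andbT.
  by rewrite (lt_le_trans _ nx).
have : (\int[mu]_(x in F i) (x `^ (b - 1))%:E @[i --> \oo] -->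
        \int[mu]_(x in \bigcup_i F i) (x `^ (b - 1))%:E)%E.
  apply: ge0_nondecreasing_set_cvg_integral.
  - move=> m n mn; rewrite subsetEset => x; rewrite /F/= !in_itv/= => /andP[mx ->].
    rewrite andbT (le_trans _ mx)// lef_pV2 ?posrE// ler_nat ltnS//.
  - by move=> i; exact: measurable_itv.
  - by move=> i; apply/measurable_EFinP/measurable_funTS; exact: measurable_powR.
  - by move=> i x _; rewrite lee_fin powR_ge0.
rewrite UF => /cvge_to_le; apply; apply: nearW => n.
rewrite /F; case: n => [|n] /=.
  by rewrite invr1 set_itv1 integral_set1 lee_fin invr_ge0 ltW.
have b0' : b != 0 by rewrite gt_eqF.
have xp (x : R) : n.+2%:R^-1 <= x -> 0 < x by apply: lt_le_trans.
rewrite (@continuous_FTC2 _ _ (fun z => z `^ b / b)).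
- rewrite -EFinB lee_fin powR1 mul1r lerBlDr lerDl.
  by rewrite mulr_ge0 ?powR_ge0// invr_ge0 ltW.
- by rewrite invf_lt1// ltr1n.
- apply: continuous_in_subspaceT => x; rewrite inE/= in_itv/= => /andP[/xp x0 _].
  exact: powR_cont.
- have C (x : R) : 0 < x -> {for x, continuous (fun z => z `^ b / b)}.
    move=> x0; apply: differentiable_continuous; apply/derivable1_diffP.
    by case: (is_derive_powRdiv b0' x0).
  split.
  + by move=> x; rewrite in_itv/= => /andP[/ltW/xp x0 _]; case: (is_derive_powRdiv b0' x0).
  + by apply: cvg_at_right_filter; apply: C.
  + by apply: cvg_at_left_filter; apply: C.
- move=> x; rewrite in_itv/= => /andP[/ltW/xp x0 _].
  by rewrite derive1E; have H := is_derive_powRdiv b0' x0; rewrite derive_val.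
Qed.

Lemma powR_cvgy0 (b : R) : 0 < b -> x `^ (- b) @[x --> +oo] --> (0 : R).
Proof.
move=> b0; apply/cvgr0Pnorm_le => e e0.
near=> x; have x0 : 0 < x by near: x; exact: nbhs_pinfty_gt.
rewrite ger0_norm ?powR_ge0// powRN -[leRHS]invrK lef_pV2 ?posrE ?powR_gt0 ?invr_gt0//.
have -> : e^-1 = (e^-1 `^ b^-1) `^ b.
  by rewrite -powRrM mulVf ?gt_eqF// powRr1// invr_ge0 ltW.
apply: ge0_ler_powR; rewrite ?nnegrE ?powR_ge0 ?(ltW b0) ?(ltW x0)//.
Unshelve. all: by end_near. Qed.

Lemma integral_powR1y (b : R) : 0 < b ->
  (\int[mu]_(x in `[1%R, +oo[) (x `^ (- b - 1))%:E = (b^-1)%:E)%E.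
Proof.
move=> b0; have nb0 : - b != 0 by rewrite oppr_eq0 gt_eqF.
have xp (x : R) : 1 <= x -> 0 < x by apply: lt_le_trans.
have C (x : R) : 0 < x -> {for x, continuous (fun z => z `^ (- b) / (- b))}.
  move=> x0; apply: differentiable_continuous; apply/derivable1_diffP.
  by case: (is_derive_powRdiv nb0 x0).
rewrite (@ge0_continuous_FTC2y _ _ (fun z => z `^ (- b) / (- b)) _ 0).
- by rewrite -EFinB powR1 mul1r sub0r invrN opprK.
- by move=> x _; exact: powR_ge0.
- apply: continuous_in_subspaceT => x; rewrite inE/= in_itv/= andbT => /xp x0.
  exact: powR_cont.
- by rewrite -(mul0r (- b)^-1); apply: cvgMr_tmp; exact: powR_cvgy0.
- by move=> x /ltW/xp x0; case: (is_derive_powRdiv nb0 x0).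
- by apply: cvg_at_right_filter; apply: C.
- move=> x; rewrite in_itv/= andbT => /ltW/xp x0.
  by rewrite derive1E; have H := is_derive_powRdiv nb0 x0; rewrite derive_val.
Qed.

Variable al : R.
Hypothesis hal : 1 < al < 2.

(* 0^-1 = 0, so the kernel has the junk value 0 at z = 0. *)
Definition qk (z : R) := (`|z| `^ (1 + al))^-1.
(** The size of a first-order remainder of a bounded function with bounded slope and curvature:
    quadratic near 0, linear at infinity. It is the common majorant of the nonlocal estimates. *)
Definition m2 (z : R) := Num.min (z ^+ 2) `|z|.

Lemma qk_ge0 z : 0 <= qk z. Proof. by rewrite invr_ge0 powR_ge0. Qed.
Lemma m2_ge0 z : 0 <= m2 z. Proof. by rewrite /m2 le_min sqr_ge0 normr_ge0. Qed.
Lemma m2_le_sqr z : m2 z <= z ^+ 2. Proof. by rewrite /m2 ge_min lexx. Qed.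
Lemma m2_le_norm z : m2 z <= `|z|. Proof. by rewrite /m2 ge_min lexx orbT. Qed.
Lemma le_m2 x z : x <= z ^+ 2 -> x <= `|z| -> x <= m2 z.
Proof. by move=> h1 h2; rewrite /m2 le_min h1 h2. Qed.

Lemma meas_norm (f : R -> R) : meas f -> meas (fun x => `|f x|).
Proof. by move=> mf; apply: measurableT_comp mf. Qed.

Lemma meas_qk : meas qk.
Proof.
have H : meas (fun z : R => `|z| `^ (1 + al)).
  apply: (@measurableT_comp _ _ _ _ _ _ (fun x : mR => (x : R) `^ (1 + al) : mR) _ (fun z : mR => (`|z : R| : mR))).
    exact: measurable_powR.
  by apply: meas_norm.
have -> : qk = (fun z => (`|z| `^ (1 + al)) `^ (-1)).
  by apply/funext => z; rewrite powR_inv1// powR_ge0.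
apply: (@measurableT_comp _ _ _ _ _ _ (fun x : mR => (x : R) `^ (-1) : mR)) => //.
Qed.

Lemma meas_m2 : meas m2.
Proof.
apply: measurable_minr; last exact: (@meas_norm id).
exact: measurable_funX.
Qed.

(** Near 0 the product is [z^(1 - al)], integrable because [al < 2]; at infinity it is [|z|^(- al)],
    integrable because [al > 1]. The origin is split off as a null set. *)
Lemma L1_rho : L1 (fun z => m2 z * qk z).
Proof.
have [a1 a2] := andP hal.
have m : meas (fun z => m2 z * qk z) by apply: measurable_funM meas_m2 meas_qk.
split; apply/integrableP; split; first by apply/measurable_EFinP.
apply: (@le_lt_trans _ _ ((((2 - al)^-1 + (al - 1)^-1)%:E) + (((2 - al)^-1 + (al - 1)^-1)%:E))%E); last by rewrite ltry.
have r0 z : 0 <= m2 z * qk z by rewrite mulr_ge0 ?m2_ge0 ?qk_ge0.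
apply: even_integral_le.
- by apply: measurableT_comp => //; apply/measurable_EFinP; exact: m.
- by [].
- by move=> x; rewrite /m2 /qk /= sqrrN normrN.
have -> : `[0%R, +oo[%classic = `[0%R, 0%R : R] `|` (`]0%R, 1%R] `|` `]1%R, +oo[).
  apply/seteqP; split => x /=; rewrite !in_itv/= !andbT.
    rewrite le_eqVlt => /predU1P[<-|x0]; first by left; rewrite eqxx lexx.
    right; case: (leP x 1) => x1; last by right.
    by left; rewrite x0.
  by move=> [/andP[]|[/andP[]|]]; lra.
rewrite ge0_integral_setU//=; last 3 first.
- exact: measurableU.
- by apply/measurable_EFinP; apply: measurable_funTS; exact: meas_norm m.
- apply/disj_setPS => x [/=]; rewrite !in_itv/= andbT => /andP[_ x0].
  by move=> [/andP[]|]; lra.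
rewrite set_itv1 integral_set1 add0e.
rewrite ge0_integral_setU//=; last 2 first.
- by apply/measurable_EFinP; apply: measurable_funTS; exact: meas_norm m.
- apply/disj_setPS => x [/=]; rewrite !in_itv/= andbT => /andP[_ x0]; lra.
rewrite EFinD; apply: leeD.
- apply: (le_trans _ (@integral_powR01 (2 - al) _)); last by rewrite subr_gt0.
  apply: ge0_le_integral => //=.
  + by apply/measurable_EFinP; apply: measurable_funTS; exact: meas_norm m.
  + by apply/measurable_EFinP/measurable_funTS; exact: measurable_powR.
  move=> x; rewrite in_itv/= => /andP[x0 x1]; rewrite lee_fin ger0_norm//.
  rewrite (le_trans (ler_wpM2r (qk_ge0 _) (m2_le_sqr _)))// /qk gtr0_norm//.
  rewrite -powR_mulrn ?(ltW x0)// -powRN -powRD ?(gt_eqF x0) ?implybT//.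
  by rewrite le_eqVlt; apply/orP; left; apply/eqP; congr (_ `^ _); ring.
- rewrite -(@integral_powR1y (al - 1)) ?subr_gt0//.
  rewrite integral_itv_obnd_cbnd; last by apply/measurable_EFinP; apply: measurable_funTS; exact: meas_norm m.
  apply: ge0_le_integral => //=.
  + by apply/measurable_EFinP; apply: measurable_funTS; exact: meas_norm m.
  + by apply/measurable_EFinP/measurable_funTS; exact: measurable_powR.
  move=> x; rewrite in_itv/= andbT => x1; rewrite lee_fin ger0_norm//.
  have x0 : 0 < x by lra.
  rewrite (le_trans (ler_wpM2r (qk_ge0 _) (m2_le_norm _)))// /qk gtr0_norm//.
  rewrite -[X in X * _](powRr1 (ltW x0)) -powRN -powRD ?(gt_eqF x0) ?implybT//.
  by rewrite le_eqVlt; apply/orP; left; apply/eqP; congr (_ `^ _); ring.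
Qed.

End Kernel.

(** * Taylor bounds and the positivity of the normalising constant *)

(** The order of [x] and [z] is left open, and [|c - x| <= |z - x|] is recorded for a second mean
    value step. Two such steps give [taylor2_le] with [K] in place of [K / 2]. *)
Lemma mvt_between (a b : R) (f f' : R -> R) : (forall x, a < x < b -> is_derive x 1 f (f' x)) ->
  forall x z, a < x < b -> a < z < b ->
  exists c, [/\ a < c < b, `|c - x| <= `|z - x| & f z - f x = f' c * (z - x)].
Proof.
move=> df; have cf x : a < x < b -> {for x, continuous f}.
  by move=> /df[dx _]; apply: differentiable_continuous; apply/derivable1_diffP.
have key x z : x <= z -> a < x < b -> a < z < b ->
  exists c, [/\ a < c < b, x <= c <= z & f z - f x = f' c * (z - x)].
  move=> xz /andP[ax xb] /andP[az zb].
  have [||c] := @MVT_segment _ f f' x z xz.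
  - move=> y; rewrite in_itv/= => /andP[xy yz]; apply: df.
    by rewrite (lt_trans ax)//= (lt_trans yz).
  - apply: continuous_in_subspaceT => y; rewrite inE/= in_itv/= => /andP[xy yz].
    by apply: cf; rewrite (lt_le_trans ax)//= (le_lt_trans yz).
  rewrite in_itv/= => /andP[xc cz] E; exists c; split => //.
    by rewrite (lt_le_trans ax)//= (le_lt_trans cz).
  by rewrite xc.
move=> x z hx hz; case: (leP x z) => xz.
  have [c [hc /andP[xc cz] E]] := key _ _ xz hx hz; exists c; split => //.
  by rewrite !ger0_norm ?subr_ge0//; lra.
have [c [hc /andP[xc cz] E]] := key _ _ (ltW xz) hz hx; exists c; split => //.
  by rewrite !ler0_norm ?subr_le0 ?(ltW xz)//; lra.
by rewrite -opprB E; ring.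
Qed.

Lemma mvt_le (a b K : R) (f f' : R -> R) : (forall x, a < x < b -> is_derive x 1 f (f' x)) ->
  (forall x, a < x < b -> `|f' x| <= K) ->
  forall x z, a < x < b -> a < z < b -> `|f z - f x| <= K * `|z - x|.
Proof.
move=> df f'K x z hx hz; have [c [hc _ ->]] := mvt_between df hx hz.
by rewrite normrM ler_wpM2r// f'K.
Qed.

Lemma taylor2_le (a b K : R) (f f' f'' : R -> R) : (forall x, a < x < b -> is_derive x 1 f (f' x)) ->
  (forall x, a < x < b -> is_derive x 1 f' (f'' x)) ->
  (forall x, a < x < b -> `|f'' x| <= K) ->
  forall x z, a < x < b -> a < z < b -> `|f z - f x - f' x * (z - x)| <= K * (z - x) ^+ 2.
Proof.
move=> df df' f''K x z hx hz; have [c [hc cx ->]] := mvt_between df hx hz.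
rewrite -mulrBl normrM -real_normK ?num_real// expr2 mulrA ler_wpM2r//.
rewrite (le_trans (mvt_le df' f''K hx hc))// ler_wpM2l//.
by rewrite (le_trans _ (f''K _ hx)).
Qed.

Lemma L1_indic (a b : R) : L1 \1_`]a, b].
Proof. by split; exact: integrable_indic_itv. Qed.

Lemma Rint_indic (a b : R) : a <= b -> I \1_`]a, b] = b - a.
Proof.
rewrite /RI /Rintegral integral_indic//= setIT lebesgue_measure_itv/= lte_fin.
by rewrite le_eqVlt => /predU1P[->|->]; rewrite ?ltxx ?subrr.
Qed.

Lemma L1_1Bcos (al : R) : 1 < al < 2 -> L1 (fun z => (1 - cos z) / `|z| `^ (1 + al)).
Proof.
move=> hal; apply: (@L1_dom _ (fun z => 2 * (m2 z * qk al z))).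
- apply: measurable_funM; last exact: meas_qk.
  by apply: measurable_funB => //; apply: continuous_measurable_fun; exact: continuous_cos.
- exact/L1Z/L1_rho.
move=> z; rewrite normrM [`|_^-1|]ger0_norm ?invr_ge0 ?powR_ge0// mulrA.
rewrite ler_wpM2r ?qk_ge0//.
have c2 : `|1 - cos z| <= z ^+ 2.
  have H := @taylor2_le (- `|z| - 1) (`|z| + 1) 1 cos (fun x => - sin x) (fun x => - cos x).
  have {}H : `|cos z - cos 0 - (- sin 0) * (z - 0)| <= 1 * (z - 0) ^+ 2.
    apply: H.
    - by move=> x _; rewrite normrN cos_max.
    - by apply/andP; split; have := normr_ge0 z; lra.
    - by apply/andP; split; have := ler_norm z; have := ler_norm (- z); rewrite normrN; lra.
  by rewrite distrC; move: H; rewrite cos0 sin0 !(oppr0, mul0r, addr0, mul1r).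
have cle : `|1 - cos z| <= 2.
  by rewrite (le_trans (ler_normB _ _))// normr1; have := cos_max z; lra.
rewrite -ler_pdivrMl// mulrC; apply: le_m2; first by have := sqr_ge0 z; lra.
have [z1|z1] := leP 1 `|z|; first by lra.
rewrite ler_pdivrMr//; apply: (le_trans c2).
rewrite -real_normK ?num_real//; have := normr_ge0 z; nra.
Qed.

(** On []pi/2, pi]] the numerator is at least 1 and the kernel at least [pi^(-(1 + al))].
    Integrability matters here: a divergent integral would be turned into 0 by [fine]. *)
Lemma Calpha_gt0 (al : R) : 1 < al < 2 -> 0 < Calpha al.
Proof.
move=> hal; rewrite /Calpha invr_gt0.
have pi0 := @pi_gt0 R.
pose c := (pi : R) `^ (- (1 + al)) : R.
have c0 : 0 < c by rewrite powR_gt0.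
apply: (@lt_le_trans _ _ (I (fun z => c * \1_`]pi / 2, pi] z))).
  rewrite RintZ; last exact: L1_indic.
  by rewrite Rint_indic; nra.
apply: Rint_le; first exact/L1Z/L1_indic.
  exact: L1_1Bcos.
move=> z; rewrite indicE.
case: (boolP (z \in _)) => zI; last first.
  by rewrite mulr0 mulr_ge0 ?invr_ge0 ?powR_ge0// subr_ge0 cos_le1.
move: zI; rewrite mulr1 inE/= in_itv/= => /andP[z1 z2].
have z0 : 0 < z by lra.
rewrite -[leLHS]mul1r; apply: ler_pM => //; first exact: ltW.
  have : cos z < cos (pi / 2).
    by rewrite ltr_cos// in_itv/=; lra.
  by rewrite cos_pihalf; lra.
rewrite /c powRN lef_pV2 ?posrE ?powR_gt0 ?normr_gt0 ?gt_eqF//.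
rewrite gtr0_norm//; apply: ge0_ler_powR; rewrite ?nnegrE ?(ltW z0) ?(ltW pi0)//.
by case/andP: hal => *; lra.
Qed.

(** First-order Taylor remainder at [x], with [f'] in the role of the derivative. *)
Definition rem (f f' : R -> R) (x z : R) := f (x + z) - f x - f' x * z.

(** * The weights *)

Definition phi (r x : R) : R := (1 + (x / r) ^+ 2)^-1.
Definition dphi (r x : R) : R := - (2 * (x / r) / r) * phi r x ^+ 2.

Lemma phi_den (r x : R) : 0 < 1 + (x / r) ^+ 2.
Proof. by rewrite ltr_pwDl ?sqr_ge0. Qed.

Lemma phi_gt0 r x : 0 < phi r x. Proof. by rewrite invr_gt0 phi_den. Qed.

Lemma phi_le1 r x : phi r x <= 1.
Proof. by rewrite /phi invf_le1 ?phi_den// lerDl sqr_ge0. Qed.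

Lemma phi_cont r : continuous (phi r).
Proof.
move=> x; apply: cvgV; first by rewrite gt_eqF ?phi_den.
by apply: cvgD; [exact: cvg_cst|apply: cvgM; apply: cvgM; by [exact: cvg_id|exact: cvg_cst]].
Qed.

Lemma phi_meas r : meas (phi r).
Proof. by apply: continuous_measurable_fun; exact: phi_cont. Qed.

Lemma dphi_meas r : meas (dphi r).
Proof.
rewrite (_ : dphi r = fun x => (- 2 / r / r * x) * phi r x ^+ 2); last first.
  by apply/funext => x; rewrite /dphi; ring.
apply: measurable_funM; last by apply: measurable_funX; exact: phi_meas.
exact: measurable_funM.
Qed.

(** The antiderivative is [r * atan (x / r)]; each half line contributes [r * pi / 2], and
    [pi / 2 < 2]. *)
Lemma integral_phi_le r : 0 < r -> (\int[mu]_x (phi r x)%:E <= (4 * r)%:E)%E.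
Proof.
move=> r0; have -> : ((4 * r)%:E = (2 * r)%:E + (2 * r)%:E)%E.
  by rewrite -EFinD; congr EFin; ring.
apply: even_integral_le.
- by apply/measurable_EFinP; exact: phi_meas.
- by move=> x; rewrite lee_fin ltW ?phi_gt0.
- by move=> x; rewrite /phi mulNr sqrrN.
have dF (x : R) : is_derive x 1 (fun z => r * atan (z / r)) (phi r x).
  have -> : (fun z => r * atan (z / r)) = r \*: (atan \o (fun z => z * r^-1)) by [].
  have H : is_derive x 1 (fun z => z * r^-1) (r^-1).
    have -> : (fun z : R => z * r^-1) = r^-1 \*: id by apply/funext => z /=; rewrite mulrC.
    by apply: is_derive_eq; rewrite /GRing.scale/= mulr1.
  have H2 := @is_derive1_comp _ atan (fun z => z * r^-1) x _ _ (is_derive1_atan _) H.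
  apply: is_derive_eq.
  by rewrite /GRing.scale/= /phi; field; rewrite gt_eqF//=; have := phi_den r x; nra.
have cF (x : R) : {for x, continuous (fun z : R => r * atan (z / r))}.
  by apply: differentiable_continuous; apply/derivable1_diffP; case: (dF x).
rewrite (@ge0_continuous_FTC2y _ _ (fun z => r * atan (z / r)) _ (r * (pi / 2))).
- rewrite mul0r atan0 mulr0 sube0 lee_fin mulrC ler_wpM2r ?(ltW r0)//.
  by have := @pihalf_lt2 R; lra.
- by move=> x _; rewrite ltW ?phi_gt0.
- by apply: continuous_in_subspaceT => x _; exact: phi_cont.
- apply: cvgMl_tmp; apply: cvg_comp; last exact: cvgy_atan.
  apply/cvgryPge => A; near=> x.
  by rewrite ler_pdivlMr//; near: x; exact: nbhs_pinfty_ge.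
- by move=> x _; case: (dF x).
- by apply: cvg_at_right_filter; exact: cF.
- by move=> x _; rewrite derive1E; have H := dF x; rewrite derive_val.
Unshelve. all: by end_near. Qed.

Lemma L1_phi r : 0 < r -> L1 (phi r).
Proof.
move=> r0; split; apply/integrableP; split; first by apply/measurable_EFinP; exact: phi_meas.
apply: le_lt_trans (ltry (4 * r)); apply: le_trans (integral_phi_le r0).
by apply: ge0_le_integral => //= [||x _];
  [apply/measurable_EFinP/measurableT_comp => //; exact: phi_meas
  |apply/measurable_EFinP; exact: phi_meas| rewrite lee_fin gtr0_norm ?phi_gt0].
Qed.

Lemma Rint_phi_le r : 0 < r -> I (phi r) <= 4 * r.
Proof. by move=> r0; rewrite -lee_fin -(RintE (L1_phi r0)) integral_phi_le. Qed.

(** This is [2 |X| <= 1 + X^2] with [X = x / r]. A velocity bounded by [M] therefore changes the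
    weighted norm at rate at most [M / r]. *)
Lemma dphi_le r x : 0 < r -> `|dphi r x| <= phi r x / r.
Proof.
move=> r0; rewrite /dphi normrM normrN normrM [`|r^-1|]gtr0_norm ?invr_gt0//.
rewrite [`|phi r x ^+ 2|]ger0_norm ?sqr_ge0// mulrAC ler_wpM2r ?invr_ge0 ?(ltW r0)//.
rewrite expr2 [X in X <= _]mulrA -[leRHS]mul1r ler_wpM2r ?(ltW (phi_gt0 _ _))//.
rewrite /phi ler_pdivrMr ?phi_den// mul1r normrM ger0_norm//.
by rewrite -[in leRHS]real_normK ?num_real//; have := sqr_ge0 (`|x / r| - 1); nra.
Qed.

(** As [phi] is rational, the remainder has a closed form that displays the factor
    [(y / r)^2 * phi r x]; what is left is at most 6 when [|y| <= r]. *)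
Lemma rem_phiE r x y : 0 < r -> rem (phi r) (dphi r) x y =
  (y / r) ^+ 2 * phi r x * (phi r (x + y) * (-1 + (4 * (x / r) ^+ 2 + 2 * (x / r) * (y / r)) * phi r x)).
Proof.
move=> r0; have r1 : r != 0 by rewrite gt_eqF.
have [Y ->] : exists Y, y = Y * r by exists (y / r); rewrite divfK.
rewrite /rem /dphi /phi mulrDl mulfK//.
have [X ->] : exists X, x = X * r by exists (x / r); rewrite divfK.
rewrite mulfK//.
have : 1 + X ^+ 2 != 0 by rewrite gt_eqF// ltr_pwDl ?sqr_ge0.
have : 1 + (X + Y) ^+ 2 != 0 by rewrite gt_eqF// ltr_pwDl ?sqr_ge0.
by move=> h1 h2; field; rewrite r1 h1 h2.
Qed.

Lemma rem_phi_small r x y : 0 < r -> `|y| <= r ->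
  `|rem (phi r) (dphi r) x y| <= 6 * (y / r) ^+ 2 * phi r x.
Proof.
move=> r0 yr; have P0 : 0 <= (y / r) ^+ 2 * phi r x.
  by apply: mulr_ge0; [exact: sqr_ge0|exact/ltW/phi_gt0].
rewrite rem_phiE// normrM (ger0_norm P0).
rewrite [leRHS](_ : _ = (y / r) ^+ 2 * phi r x * 6); last by ring.
apply: ler_wpM2l => //.
have Y1 : `|y / r| <= 1 by rewrite normrM [`|r^-1|]gtr0_norm ?invr_gt0// ler_pdivrMr// mul1r.
rewrite normrM gtr0_norm ?phi_gt0//.
rewrite (@le_trans _ _ (1 * `|-1 + (4 * (x / r) ^+ 2 + 2 * (x / r) * (y / r)) * phi r x|))//.
  by rewrite ler_wpM2r ?phi_le1.
rewrite mul1r (le_trans (ler_normD _ _))// normrN1.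
rewrite normrM [`|phi r x|]gtr0_norm ?phi_gt0//.
have : `|4 * (x / r) ^+ 2 + 2 * (x / r) * (y / r)| * phi r x <= 5.
  rewrite /phi ler_pdivrMr ?phi_den//.
  move: Y1; set X := x / r; set Y := y / r => Y1.
  have XY : `|X * Y| <= `|X| by rewrite normrM ler_piMr.
  have X2 : 2 * `|X| <= 1 + X ^+ 2.
    rewrite -[X ^+ 2]real_normK ?num_real//.
    by have := sqr_ge0 (`|X| - 1); nra.
  move: XY; rewrite !ler_norml => /andP[h1 h2].
  by apply/andP; split; have := sqr_ge0 X; lra.
by lra.
Qed.

Lemma rem_phi_large r x y : 0 < r -> r <= `|y| ->
  `|rem (phi r) (dphi r) x y| <= (`|y| / r) * (phi r (x + y) + 2 * phi r x).
Proof.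
move=> r0 yr; rewrite /rem.
have Y1 : 1 <= `|y| / r by rewrite ler_pdivlMr// mul1r.
have p1 := phi_gt0 r x; have p2 := phi_gt0 r (x + y).
have H : `|dphi r x * y| <= `|y| / r * phi r x.
  rewrite normrM (le_trans (ler_wpM2r (normr_ge0 _) (dphi_le x r0)))//.
  by rewrite le_eqVlt; apply/orP; left; apply/eqP; ring.
rewrite [leRHS](_ : _ = `|y| / r * phi r (x + y) + `|y| / r * phi r x + `|y| / r * phi r x); last by ring.
apply: le_trans (ler_normB _ _) _; apply: lerD => //.
apply: le_trans (ler_normB _ _) _; rewrite (gtr0_norm p1) (gtr0_norm p2).
by apply: lerD; rewrite -[leLHS]mul1r; apply: ler_wpM2r => //; exact: ltW.
Qed.

Lemma phi_homo (r s x : R) : 0 < r -> r <= s -> phi r x <= phi s x.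
Proof.
move=> r0 rs; have s0 : 0 < s by exact: lt_le_trans rs.
rewrite /phi lef_pV2 ?posrE ?phi_den// lerD2l !expr_div_n ler_wpM2l ?sqr_ge0//.
rewrite lef_pV2 ?posrE ?exprn_gt0//.
by rewrite lerXn2r ?nnegrE ?(ltW r0) ?(ltW s0).
Qed.

(** * Bounded functions with a quadratic Taylor remainder *)

(* v' stands for the derivative of v: carrying it separately makes the class stable under
   averaging and translation without differentiating anything. *)
Definition C11 (K : R) (v v' : R -> R) : Prop :=
  [/\ meas v, meas v', forall x, `|v x| <= K, forall x, `|v' x| <= K &
      forall x y, `|rem v v' x y| <= K * y ^+ 2].

Lemma C11_ge0 K v v' : C11 K v v' -> 0 <= K.
Proof. by case=> _ _ /(_ 0) h _ _; apply: le_trans h. Qed.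

Lemma C11_lip K v v' : C11 K v v' -> forall x y, `|v (x + y) - v x| <= 2 * K * `|y|.
Proof.
move=> hv x y; have K0 := C11_ge0 hv; case: hv => _ _ vK v'K rK.
have [y1|y1] := leP 1 `|y|.
  rewrite (le_trans (ler_normB _ _))//.
  rewrite (@le_trans _ _ (2 * K))//; first by have := vK (x + y); have := vK x; lra.
  by rewrite ler_peMr ?mulr_ge0.
have -> : v (x + y) - v x = rem v v' x y + v' x * y by rewrite /rem; ring.
rewrite (le_trans (ler_normD _ _))// normrM.
have h1 : `|v' x| * `|y| <= K * `|y| by rewrite ler_wpM2r.
have h2 : K * `|y| ^+ 2 <= K * `|y|.
  by rewrite ler_wpM2l// expr2 ler_piMl// ltW.
by have := rK x y; rewrite -[y ^+ 2]real_normK ?num_real//; lra.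
Qed.

(** The Taylor bound serves near 0; far away the increment costs [2 K |y|] and the linear term
    [K |y|]. The kernel can integrate the result. *)
Lemma C11_m2 K v v' : C11 K v v' -> forall x y, `|rem v v' x y| <= 3 * K * m2 y.
Proof.
move=> hv x y; have K0 := C11_ge0 hv; have hl := C11_lip hv x y.
case: hv => _ _ vK v'K rK.
rewrite /m2; have [h|h] := leP (y ^+ 2) `|y|.
  by apply: le_trans (rK _ _) _; rewrite ler_wpM2r ?sqr_ge0//; lra.
rewrite /rem (le_trans (ler_normB _ _))// normrM.
have h1 : `|v' x| * `|y| <= K * `|y| by rewrite ler_wpM2r.
by lra.
Qed.

Lemma C11W K1 K2 v v' : K1 <= K2 -> C11 K1 v v' -> C11 K2 v v'.
Proof.
move=> h [mv mv' vK v'K rK]; split=> // [x|x|x y].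
- exact: le_trans (vK x) h.
- exact: le_trans (v'K x) h.
- by apply: le_trans (rK x y) _; rewrite ler_wpM2r ?sqr_ge0.
Qed.

Lemma C11_cst c : C11 `|c| (fun=> c) (fun=> 0).
Proof.
split=> // [x|x y]; first by rewrite normr0.
by rewrite /rem subrr mul0r subrr normr0 mulr_ge0 ?sqr_ge0.
Qed.

Lemma C11D K1 K2 v v' w w' : C11 K1 v v' -> C11 K2 w w' ->
  C11 (K1 + K2) (fun x => v x + w x) (fun x => v' x + w' x).
Proof.
move=> [mv mv' vK v'K rK] [mw mw' wK w'K sK]; split.
- exact: measurable_funD.
- exact: measurable_funD.
- by move=> x; rewrite (le_trans (ler_normD _ _))// lerD.
- by move=> x; rewrite (le_trans (ler_normD _ _))// lerD.
- move=> x y; rewrite (_ : rem _ _ _ _ = rem v v' x y + rem w w' x y); last first.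
    by rewrite /rem; ring.
  by rewrite mulrDl (le_trans (ler_normD _ _))// lerD.
Qed.

Lemma C11Z K k v v' : C11 K v v' -> C11 (`|k| * K) (fun x => k * v x) (fun x => k * v' x).
Proof.
move=> [mv mv' vK v'K rK]; split.
- exact: measurable_funM.
- exact: measurable_funM.
- by move=> x; rewrite normrM ler_wpM2l.
- by move=> x; rewrite normrM ler_wpM2l.
- move=> x y; rewrite (_ : rem _ _ _ _ = k * rem v v' x y); last by rewrite /rem; ring.
  by rewrite normrM -mulrA ler_wpM2l.
Qed.

Lemma C11B K1 K2 v v' w w' : C11 K1 v v' -> C11 K2 w w' ->
  C11 (K1 + K2) (fun x => v x - w x) (fun x => v' x - w' x).
Proof.
move=> hv hw; have := C11D hv (C11Z (-1) hw).
rewrite normrN1 mul1r => H; under eq_fun do rewrite -mulN1r.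
by under [X in C11 _ _ X]eq_fun do rewrite -mulN1r.
Qed.

(** The last summand in the decomposition of the remainder is a product of two first-order
    quantities. The three summands cost [1 + 1 + 2] times [K1 * K2 * y^2]. *)
Lemma C11M K1 K2 v v' w w' : C11 K1 v v' -> C11 K2 w w' ->
  C11 (4 * K1 * K2) (fun x => v x * w x) (fun x => v' x * w x + v x * w' x).
Proof.
move=> hv hw; have K1p := C11_ge0 hv; have K2p := C11_ge0 hw.
have lw := C11_lip hw.
case: hv => [mv mv' vK v'K rK]; case: hw => [mw mw' wK w'K sK].
have K12 : 0 <= K1 * K2 by exact: mulr_ge0.
split.
- exact: measurable_funM.
- by apply: measurable_funD; exact: measurable_funM.
- move=> x; rewrite normrM (@le_trans _ _ (K1 * K2))//; last lra.
  exact: ler_pM.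
- move=> x; rewrite (le_trans (ler_normD _ _))// !normrM.
  rewrite (@le_trans _ _ (K1 * K2 + K1 * K2))//; last lra.
  by apply: lerD; exact: ler_pM.
- move=> x y; rewrite (_ : rem _ _ _ _ = rem v v' x y * w (x + y) + v x * rem w w' x y +
    (v' x * y) * (w (x + y) - w x)); last by rewrite /rem; ring.
  rewrite (@le_trans _ _ (K1 * y ^+ 2 * K2 + K1 * (K2 * y ^+ 2) + K1 * `|y| * (2 * K2 * `|y|)))//.
    rewrite (le_trans (ler_normD _ _))// lerD//.
      rewrite (le_trans (ler_normD _ _))// lerD// normrM; exact: ler_pM.
    rewrite !normrM; apply: ler_pM; [exact: mulr_ge0|by []|exact: ler_wpM2r|exact: lw].
  by rewrite -[y ^+ 2]real_normK ?num_real//; lra.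
Qed.

Lemma C11_shift K v v' a : C11 K v v' -> C11 K (fun x => v (x + a)) (fun x => v' (x + a)).
Proof.
move=> [mv mv' vK v'K rK]; split=> //; [exact: meas_comp_shift|exact: meas_comp_shift|].
by move=> x y; have := rK (x + a) y; rewrite /rem (addrAC x a y).
Qed.

(* Smooth convex substitute for the absolute value: |a| <= eta e a <= |a| + e. *)
Definition eta (e a : R) := Num.sqrt (a ^+ 2 + e ^+ 2).

Section Eta.
Variable e : R.
Hypothesis e0 : 0 < e.

Lemma eta_sqr a : eta e a ^+ 2 = a ^+ 2 + e ^+ 2.
Proof. by rewrite sqr_sqrtr// addr_ge0 ?sqr_ge0. Qed.

Lemma eta_ge0 a : 0 <= eta e a. Proof. exact: sqrtr_ge0. Qed.

Lemma eta_ge_e a : e <= eta e a.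
Proof.
have := eta_sqr a; have := eta_ge0 a; have := sqr_ge0 a; move: e0 => *; nra.
Qed.

Lemma eta_gt0 a : 0 < eta e a. Proof. exact: lt_le_trans (eta_ge_e a). Qed.

Lemma eta_ge_norm a : `|a| <= eta e a.
Proof.
have := eta_sqr a; have := eta_ge0 a; rewrite -[a ^+ 2]real_normK ?num_real//.
by have := normr_ge0 a; move: e0 => *; nra.
Qed.

Lemma eta_le a : eta e a <= `|a| + e.
Proof.
have := eta_sqr a; have := eta_ge0 a; rewrite -[a ^+ 2]real_normK ?num_real//.
by have := normr_ge0 a; move: e0 => *; nra.
Qed.

Lemma deta_le1 a : `|a / eta e a| <= 1.
Proof.
by rewrite normrM [`|_^-1|]gtr0_norm ?invr_gt0 ?eta_gt0// ler_pdivrMr ?eta_gt0// mul1r eta_ge_norm.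
Qed.

(** The failure of [eta] to be homogeneous of degree one is [e^2 / eta]. It is the error made when
    the chain rule for [eta] meets the term [b' v] of the convection. *)
Lemma eta_defect a : 0 <= eta e a - a * (a / eta e a) <= e.
Proof.
have p := eta_gt0 a; have s := eta_sqr a; have g := eta_ge_e a.
have -> : eta e a - a * (a / eta e a) = e ^+ 2 / eta e a.
  have -> : e ^+ 2 = eta e a ^+ 2 - a ^+ 2 by rewrite s; ring.
  by field; rewrite gt_eqF.
rewrite divr_ge0 ?sqr_ge0 ?(ltW p)//= ler_pdivrMr// expr2.
by rewrite ler_wpM2l ?(ltW e0).
Qed.

(** After clearing the denominator this is the Cauchy-Schwarz inequality for the vectors [(a, e)]
    and [(b, e)]. *)
Lemma eta_convex a b : a / eta e a * (b - a) <= eta e b - eta e a.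
Proof.
have p := eta_gt0 a; have s := eta_sqr a; have sb := eta_sqr b; have pb := eta_gt0 b.
rewrite mulrAC ler_pdivrMr//.
have : a * b + e ^+ 2 <= eta e b * eta e a.
  have h : 0 <= (a - b) ^+ 2 * e ^+ 2 by rewrite mulr_ge0 ?sqr_ge0.
  have E : (eta e b * eta e a) ^+ 2 = (a * b + e ^+ 2) ^+ 2 + (a - b) ^+ 2 * e ^+ 2.
    by rewrite exprMn s sb; ring.
  have q : 0 <= eta e b * eta e a by rewrite mulr_ge0 ?ltW.
  have [n|n] := ltP (a * b + e ^+ 2) 0; first lra.
  by rewrite -(ler_pXn2r (ltn0Sn 1)) ?nnegrE// E lerDl.
by move: s; rewrite !expr2; lra.
Qed.

(** By concavity of the square root [eta b - eta a] is at most [(eta b^2 - eta a^2) / (2 eta a)],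
    which is a quadratic polynomial in [b - a]; then [eta a >= e]. *)
Lemma eta_upper a b : eta e b - eta e a <= a / eta e a * (b - a) + (b - a) ^+ 2 / (2 * e).
Proof.
have p := eta_gt0 a; have s := eta_sqr a; have sb := eta_sqr b; have pb := eta_gt0 b.
have g := eta_ge_e a.
apply: (@le_trans _ _ (a / eta e a * (b - a) + (b - a) ^+ 2 / (2 * eta e a))).
  have -> : a / eta e a * (b - a) + (b - a) ^+ 2 / (2 * eta e a) =
            (eta e b ^+ 2 - eta e a ^+ 2) / (2 * eta e a).
    by rewrite s sb; field; rewrite gt_eqF.
  rewrite ler_pdivlMr; last by lra.
  by have := sqr_ge0 (eta e b - eta e a); rewrite !expr2; lra.
rewrite lerD2l ler_wpM2l ?sqr_ge0//.
by rewrite lef_pV2 ?posrE ?mulr_gt0// ler_pM2l.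
Qed.

Lemma eta_cont : continuous (eta e).
Proof.
move=> a; apply: (@continuous_comp _ _ _ (fun a : R => a ^+ 2 + e ^+ 2) Num.sqrt).
  by apply: cvgD; [exact: exprn_continuous|exact: cvg_cst].
exact: sqrt_continuous.
Qed.

Lemma meas_eta v : meas v -> meas (fun x => eta e (v x)).
Proof.
move=> mv; apply: (@measurableT_comp _ _ _ _ _ _ (eta e : mR -> mR) _ (v : mR -> mR)) => //.
by apply: continuous_measurable_fun; exact: eta_cont.
Qed.

Lemma meas_deta v : meas v -> meas (fun x => v x / eta e (v x)).
Proof.
move=> mv; have H : meas (fun a => a / eta e a).
  apply: continuous_measurable_fun => a; apply: cvgM; first exact: cvg_id.
  by apply: cvgV; [rewrite gt_eqF ?eta_gt0|exact: eta_cont].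
exact: (measurableT_comp H mv).
Qed.

(** The term [2 K^2 / e] is [eta_upper] for an increment of size [2 K |y|]. It blows up as [e] tends
    to 0, which is harmless: [e] stays fixed until the time steps have been refined. *)
Lemma C11_eta K v v' : C11 K v v' ->
  C11 (K + e + 2 * K ^+ 2 / e) (fun x => eta e (v x)) (fun x => v x / eta e (v x) * v' x).
Proof.
move=> hv; have K0 := C11_ge0 hv; have hl := C11_lip hv.
case: hv => [mv mv' vK v'K rK].
have p : 0 <= 2 * K ^+ 2 / e by rewrite mulr_ge0 ?invr_ge0 ?(ltW e0)// mulr_ge0 ?sqr_ge0.
split.
- exact: meas_eta.
- by apply: measurable_funM => //; exact: meas_deta.
- move=> x; rewrite ger0_norm ?eta_ge0//.
  by have := eta_le (v x); have := vK x; lra.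
- move=> x; rewrite normrM (@le_trans _ _ (1 * K))//; last by have := e0; lra.
  by apply: ler_pM => //; exact: deta_le1.
- move=> x y.
  pose a := v x; pose b := v (x + y).
  have -> : rem (fun x => eta e (v x)) (fun x => v x / eta e (v x) * v' x) x y =
    (eta e b - eta e a - a / eta e a * (b - a)) + a / eta e a * rem v v' x y.
    by rewrite /rem /a /b; ring.
  have h1 : `|eta e b - eta e a - a / eta e a * (b - a)| <= 2 * K ^+ 2 / e * y ^+ 2.
    have c1 := eta_convex a b; have c2 := eta_upper a b.
    rewrite ger0_norm; last by lra.
    apply: (@le_trans _ _ ((b - a) ^+ 2 / (2 * e))); first by lra.
    have : (b - a) ^+ 2 <= (2 * K * `|y|) ^+ 2.
      by rewrite -[leLHS]real_normK ?num_real// lerXn2r ?nnegrE ?mulr_ge0//; exact: hl.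
    rewrite exprMn real_normK ?num_real// => h.
    rewrite ler_pdivrMr; last by have := e0; lra.
    rewrite [leRHS](_ : _ = (2 * K) ^+ 2 * y ^+ 2)//.
    by field; rewrite gt_eqF.
  have h2 : `|a / eta e a * rem v v' x y| <= K * y ^+ 2.
    by rewrite normrM -[leRHS]mul1r; apply: ler_pM => //; exact: deta_le1.
  rewrite (le_trans (ler_normD _ _))//.
  by have := sqr_ge0 y; have := e0; nra.
Qed.

End Eta.

(** The standard device below for sending a small parameter to 0. *)
Lemma le0_of_linear (S C : R) : (forall h, 0 < h -> h <= 1 -> S <= C * h) -> S <= 0.
Proof.
move=> H; have [//|S0] := leP S 0.
have C0 : 0 < `|C| + 1 by rewrite ltr_wpDl.
have [|h1] := leP 1 (S / (2 * (`|C| + 1))).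
  rewrite ler_pdivlMr ?mulr_gt0// mul1r => h.
  have := H 1 ltr01 (lexx _); rewrite mulr1 => hC.
  by have := ler_norm C; lra.
have h0 : 0 < S / (2 * (`|C| + 1)) by rewrite divr_gt0// mulr_gt0.
have := H _ h0 (ltW h1).
rewrite mulrA ler_pdivlMr ?mulr_gt0//.
have : C * S <= `|C| * S by rewrite ler_wpM2r ?ler_norm// ltW.
by nra.
Qed.


Lemma meas2_fst f : meas f -> meas2 (fun p => f p.1).
Proof. by move=> mf; exact: (measurableT_comp mf measurable_fst). Qed.

Lemma meas2_snd f : meas f -> meas2 (fun p => f p.2).
Proof. by move=> mf; exact: (measurableT_comp mf measurable_snd). Qed.

Lemma meas2_add f : meas f -> meas2 (fun p => f (p.1 + p.2)).
Proof.
move=> mf; have H : meas2 (fun p => p.1 + p.2).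
  by apply: measurable_funD; [exact: measurable_fst|exact: measurable_snd].
exact: (measurableT_comp mf H).
Qed.

Lemma meas2_sub f : meas f -> meas2 (fun p => f (p.1 - p.2)).
Proof.
move=> mf; have H : meas2 (fun p => p.1 - p.2).
  by apply: measurable_funB; [exact: measurable_fst|exact: measurable_snd].
exact: (measurableT_comp mf H).
Qed.

Lemma meas2_rem f f' : meas f -> meas f' -> meas2 (fun p => rem f f' p.1 p.2).
Proof.
move=> mf mf'; apply: measurable_funB; first apply: measurable_funB.
- exact: meas2_add.
- exact: meas2_fst.
- by apply: measurable_funM; [exact: meas2_fst|exact: measurable_snd].
Qed.

Lemma meas2_remN f f' : meas f -> meas f' -> meas2 (fun p => rem f f' p.1 (- p.2)).
Proof.
move=> mf mf'; rewrite (_ : (fun p => _) = (fun p => f (p.1 - p.2) - f p.1 - (-1) * (f' p.1 * p.2))); last first.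
  by apply/funext => p; rewrite /rem; ring.
apply: measurable_funB; first apply: measurable_funB.
- exact: meas2_sub.
- exact: meas2_fst.
- apply: measurable_funM => //.
  by apply: measurable_funM; [exact: meas2_fst|exact: measurable_snd].
Qed.

Lemma meas_rem1 f f' x : meas f -> meas (fun z => rem f f' x z).
Proof.
move=> mf; apply: measurable_funB; first apply: measurable_funB => //.
  by under eq_fun do rewrite addrC; exact: meas_comp_shift.
exact: measurable_funM.
Qed.

Lemma meas_rem2 f f' z : meas f -> meas f' -> meas (fun x => rem f f' x z).
Proof.
move=> mf mf'; apply: measurable_funB; first apply: measurable_funB => //.
  exact: meas_comp_shift.
exact: measurable_funM.
Qed.

Lemma meas_opp f : meas f -> meas (fun z => f (- z)).
Proof.
move=> mf; have H : meas (fun z => - z).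
  by apply: continuous_measurable_fun => x; apply: cvgN; exact: cvg_id.
exact: (measurableT_comp mf H).
Qed.

Lemma m2N z : m2 (- z) = m2 z :> R.
Proof. by rewrite /m2 sqrrN normrN. Qed.

(* om is an integrable majorant of the weight ch, of its derivative ch', and of the second-order
   remainder of ch at unit distance. *)
Definition weight (K : R) (om ch ch' : R -> R) : Prop :=
  [/\ meas ch /\ meas ch', L1 om, forall x, 0 <= ch x <= om x /\ `|ch' x| <= om x,
      forall x, om x <= K &
      forall x y, `|y| <= 1 -> `|rem ch ch' x y| <= y ^+ 2 * om x].

(** * Admissible weights and integration by parts *)

Section Weight.
Variables (K : R) (om ch ch' : R -> R).
Hypothesis hw : weight K om ch ch'.

Lemma weight_om_ge0 x : 0 <= om x.
Proof. by case: hw => _ _ /(_ x)[/andP[h1 h2] _] _ _; exact: le_trans h2. Qed.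

Lemma weight_ge0 : 0 <= K.
Proof. by case: hw => _ _ _ /(_ 0) h _; exact: le_trans (weight_om_ge0 0) h. Qed.

Lemma weight_L1 : L1 ch.
Proof.
case: hw => [[m _] iom h _ _]; apply: L1_dom iom _ => // x.
by case: (h x) => /andP[h0 h1] _; rewrite ger0_norm.
Qed.

Lemma weight_L1' : L1 ch'.
Proof. by case: hw => [[_ m] iom h _ _]; apply: L1_dom iom _ => // x; case: (h x). Qed.

Lemma weight_rem_m2 x y : `|rem ch ch' x y| <= 3 * K * m2 y.
Proof.
have K0 := weight_ge0; case: hw => _ _ h hK hr.
have [y1|y1] := leP `|y| 1.
  have -> : m2 y = y ^+ 2.
    by rewrite /m2 min_l// -real_normK ?num_real// expr2 ler_piMl.
  apply: le_trans (hr x y y1) _; rewrite mulrC ler_wpM2r ?sqr_ge0//.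
  by have := hK x; lra.
have -> : m2 y = `|y|.
  by rewrite /m2 min_r// -real_normK ?num_real// expr2 ler_peMl// ltW.
have [/andP[a1 a2] a3] := h x; have [/andP[b1 b2] _] := h (x + y).
have k1 := hK x; have k2 := hK (x + y).
rewrite /rem (le_trans (ler_normB _ _))// normrM.
have : `|ch' x| * `|y| <= K * `|y| by rewrite ler_wpM2r// (le_trans a3).
have : `|ch (x + y) - ch x| <= K by rewrite ler_norml; lra.
have : K <= K * `|y| by rewrite ler_peMr// ltW.
by have : 0 <= K * `|y|; [rewrite mulr_ge0|lra].
Qed.

Lemma weight_rem_L1 y : L1 (fun x => rem ch ch' x y).
Proof.
apply: L1B; first apply: L1B.
- exact/L1_shift/weight_L1.
- exact: weight_L1.
- exact/L1Zr/weight_L1'.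
Qed.

(** For [|y| > 1] the terms of the remainder are integrated separately, the shifted one by
    translation invariance; [om] dominates each of them. *)
Lemma weight_rem_int y : I (fun x => `|rem ch ch' x y|) <= 3 * I om * m2 y.
Proof.
have iom : L1 om by case: hw.
have O0 : 0 <= I om by apply: Rint_ge0; exact: weight_om_ge0.
have il := L1_abs (weight_rem_L1 y).
have [y1|y1] := leP `|y| 1.
  have -> : m2 y = y ^+ 2.
    by rewrite /m2 min_l// -real_normK ?num_real// expr2 ler_piMl.
  apply: (@le_trans _ _ (y ^+ 2 * I om)).
    rewrite -RintZ//; apply: Rint_le => //; first exact: L1Z.
    by move=> x; case: hw => _ _ _ _; apply.
  by rewrite mulrC ler_wpM2r ?sqr_ge0//; lra.
have -> : m2 y = `|y|.
  by rewrite /m2 min_r// -real_normK ?num_real// expr2 ler_peMl// ltW.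
apply: (@le_trans _ _ (I (fun x => om (x + y) + (om x + `|y| * om x)))).
  apply: Rint_le => //.
    by apply: L1D; [exact: L1_shift|apply: L1D => //; exact: L1Z].
  case: hw => _ _ h _ _ x.
  have [/andP[a1 a2] a3] := h x; have [/andP[b1 b2] _] := h (x + y).
  rewrite /rem (le_trans (ler_normB _ _))// normrM addrA; apply: lerD.
    by rewrite (le_trans (ler_normB _ _))// !ger0_norm// lerD.
  by rewrite mulrC ler_wpM2l.
rewrite RintD; [|exact: L1_shift|apply: L1D => //; exact: L1Z].
rewrite RintD//; last exact: L1Z.
rewrite Rint_shift// RintZ//.
have : I om <= I om * `|y| by rewrite ler_peMr// ltW.
by lra.
Qed.

Lemma L1_C11_weight f f' Kf : C11 Kf f f' -> L1 (fun x => f x * ch x).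
Proof. by move=> [mf _ fK _ _]; exact: L1_mulb fK weight_L1. Qed.

Lemma L1_weight_d (f : R -> R) Kf : meas f -> (forall x, `|f x| <= Kf) -> L1 (fun x => f x * ch' x).
Proof. by move=> mf fK; exact: L1_mulb fK weight_L1'. Qed.

(** The integral of [(Y ch)(x + h) - (Y ch)(x)] vanishes by translation invariance. To first order
    this increment is [h (Y' ch + Y ch')], with an error at most [4 KY h^2 om]; dividing by [h]
    shows that the sum of both integrals is 0. *)
Lemma ibp (Y Y' : R -> R) KY : C11 KY Y Y' ->
  I (fun x => Y' x * ch x) = - I (fun x => Y x * ch' x).
Proof.
move=> hY; have KY0 := C11_ge0 hY; have lY := C11_lip hY.
have iom : L1 om by case: hw.
have O0 : 0 <= I om by apply: Rint_ge0; exact: weight_om_ge0.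
have [mY mY' YK Y'K rY] := hY.
have i1 : L1 (fun x => Y' x * ch x) by exact: L1_mulb Y'K weight_L1.
have i2 : L1 (fun x => Y x * ch' x) by exact: L1_weight_d.
have i3 : L1 (fun x => Y x * ch x) by exact: L1_C11_weight hY.
have [S SE] : exists S, S = I (fun x => Y' x * ch x) + I (fun x => Y x * ch' x) by eexists.
suff : S = 0 by rewrite SE => /eqP; rewrite addr_eq0 => /eqP.
have key h : 0 < h -> h <= 1 -> `|S| <= 4 * KY * I om * h.
  move=> h0 h1.
  have -> : S = - (h^-1 * I (fun x => (Y (x + h) * ch (x + h) - Y x * ch x) - h * (Y' x * ch x + Y x * ch' x))).
    rewrite RintB; [|by apply: L1B => //; exact: (L1_shift h i3)|by apply: L1Z; exact: L1D].
    rewrite RintB//; last exact: (L1_shift h i3).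
    rewrite (Rint_shift h i3) subrr sub0r RintZ; last exact: L1D.
    by rewrite RintD// -SE mulrN opprK mulKf ?gt_eqF.
  rewrite normrN normrM gtr0_norm ?invr_gt0// mulrC ler_pdivrMr//.
  rewrite [leRHS](_ : _ = I (fun x => 4 * KY * h ^+ 2 * om x)); last by rewrite RintZ//; ring.
  apply: Rint_normle.
  - by apply: L1B; [apply: L1B => //; exact: (L1_shift h i3)|apply: L1Z; exact: L1D].
  - exact: L1Z.
  move=> x; rewrite (_ : _ - _ = rem Y Y' x h * ch x + Y (x + h) * rem ch ch' x h +
      h * ch' x * (Y (x + h) - Y x)); last by rewrite /rem; ring.
  case: hw => _ _ /(_ x) [/andP[a1 a2] a3] _ hr.
  have o0 := weight_om_ge0 x.
  rewrite (@le_trans _ _ (KY * h ^+ 2 * om x + KY * (h ^+ 2 * om x) + h * om x * (2 * KY * h)))//; last by lra.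
  rewrite (le_trans (ler_normD _ _))// lerD//.
    rewrite (le_trans (ler_normD _ _))// lerD// normrM.
      by rewrite (ger0_norm a1); apply: ler_pM.
    by apply: ler_pM => //; apply: hr; rewrite gtr0_norm.
  rewrite !normrM (gtr0_norm h0); apply: ler_pM => //.
  - by rewrite mulr_ge0// ltW.
  - by rewrite ler_wpM2l// ltW.
  - by have := lY x h; rewrite (gtr0_norm h0).
by apply/eqP; rewrite -normr_le0; apply: le0_of_linear key.
Qed.

End Weight.

(** * Kato's inequality *)

Section KatoSpace.
Variable al : R.
Hypothesis hal : 1 < al < 2.
Local Notation q := (qk al).

(* Lambda^al v = - Calpha al * Lop v v'; Lopm integrates the reflected remainder, which is the form
   produced by moving Lop to the weight. *)
Definition Lop (f f' : R -> R) (x : R) : R := I (fun z => rem f f' x z * q z).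
Definition Lopm (f f' : R -> R) (x : R) : R := I (fun z => rem f f' x (- z) * q z).

Lemma L1_q_dom (g : R -> R) C : meas g -> (forall z, `|g z| <= C * m2 z) -> L1 (fun z => g z * q z).
Proof.
move=> mg h; apply: (@L1_dom _ (fun z => C * (m2 z * q z))).
- by apply: measurable_funM => //; exact: meas_qk.
- exact/L1Z/L1_rho.
- by move=> z; rewrite normrM (ger0_norm (qk_ge0 al z)) mulrA ler_wpM2r ?qk_ge0.
Qed.

Lemma Lop_L1 K v v' x : C11 K v v' -> L1 (fun z => rem v v' x z * q z).
Proof.
move=> hv; apply: (@L1_q_dom _ (3 * K)); last exact: C11_m2 hv x.
by case: hv => mv *; exact: meas_rem1.
Qed.

Lemma Lop_bound K v v' x : C11 K v v' -> `|Lop v v' x| <= 3 * K * I (fun z => m2 z * q z).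
Proof.
move=> hv; rewrite -RintZ; last exact: L1_rho.
apply: Rint_normle; [exact: Lop_L1 hv|exact/L1Z/L1_rho|].
move=> z; rewrite normrM (ger0_norm (qk_ge0 al z)) mulrA ler_wpM2r ?qk_ge0//.
exact: C11_m2 hv x z.
Qed.

Lemma LopB K1 K2 v v' w w' x : C11 K1 v v' -> C11 K2 w w' ->
  Lop (fun x => v x - w x) (fun x => v' x - w' x) x = Lop v v' x - Lop w w' x.
Proof.
move=> hv hw; rewrite /Lop -RintB; [|exact: Lop_L1 hv|exact: Lop_L1 hw].
by apply: Rint_eq => z; rewrite /rem; ring.
Qed.

Lemma Lop_shift v v' a x : Lop (fun x => v (x + a)) (fun x => v' (x + a)) x = Lop v v' (x + a).
Proof. by apply: Rint_eq => z; rewrite /rem (addrAC x z a). Qed.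

Section Weighted.
Variables (Kw : R) (om ch ch' : R -> R).
Hypothesis hw : weight Kw om ch ch'.

Lemma Lopm_L1 x : L1 (fun z => rem ch ch' x (- z) * q z).
Proof.
apply: (@L1_q_dom _ (3 * Kw)); last by move=> z; rewrite -(m2N z); exact: weight_rem_m2 hw _ _.
case: hw => [[m m'] _ _ _ _].
by apply: (@meas_opp (fun z => rem ch ch' x z)); exact: meas_rem1.
Qed.

(** For fixed [z] the integrals over [x] agree: a translation moves the increment from [V] to [ch]
    and turns [z] into [- z], and [ibp] moves the linear term. Fubini transfers this to the
    operators. The majorant uses a pointwise remainder bound for [V] on one side and an integral
    remainder bound for [ch] on the other. *)
Lemma kato_fubini (V V' : R -> R) KV : C11 KV V V' ->
  [/\ L1 (fun x => ch x * Lop V V' x), L1 (fun x => V x * Lopm ch ch' x) &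
      I (fun x => ch x * Lop V V' x) = I (fun x => V x * Lopm ch ch' x)].
Proof.
move=> hV; have KV0 := C11_ge0 hV.
have [mV mV' VK V'K rV] := hV; have [[mch mch'] iom hch omK _] := hw.
have lV := C11_m2 hV; have ich := weight_L1 hw.
have O0 : 0 <= I om by apply: Rint_ge0; exact: weight_om_ge0 hw.
have mq := meas_qk al.
pose F1 x z := ch x * (rem V V' x z * q z).
pose F2 x z := V x * (rem ch ch' x (- z) * q z).
have irho := L1_rho hal.
have F1x x : L1 (F1 x) by apply: L1Z; exact: Lop_L1 hV.
have F2x x : L1 (F2 x) by apply: L1Z; exact: Lopm_L1.
have F1z z : L1 (F1 ^~ z).
  rewrite /F1; under eq_fun do rewrite mulrC mulrAC; apply: L1Zr.
  exact: (L1_mulb (meas_rem2 z mV mV') (fun x => lV x z) ich).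
have F2z z : L1 (F2 ^~ z).
  rewrite /F2; under eq_fun do rewrite mulrA; apply: L1Zr.
  exact: (L1_mulb mV VK (weight_rem_L1 hw _)).
have [A1 A2 A3] : [/\ L1 (fun x => I (F1 x)), L1 (fun z => I (F1 ^~ z)) &
      I (fun x => I (F1 x)) = I (fun z => I (F1 ^~ z))].
  apply: (@Rfubini F1 (fun z => 3 * KV * I om * (m2 z * q z)) _ F1x F1z).
  - apply: measurable_funM; first exact: meas2_fst.
    by apply: measurable_funM; [exact: meas2_rem|exact: meas2_snd].
  - exact: L1Z.
  - move=> z; rewrite [leRHS](_ : _ = I (fun x => (3 * KV * (m2 z * q z)) * om x)); last first.
      by rewrite RintZ//; ring.
    apply: Rint_le; [exact/L1_abs/F1z|exact: L1Z|].
    move=> x; have [/andP[h1 h2] _] := hch x.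
    rewrite /F1 normrM (ger0_norm h1) mulrC; apply: ler_pM => //.
    by rewrite normrM (ger0_norm (qk_ge0 al z)) mulrA ler_wpM2r ?qk_ge0.
have [B1 B2 B3] : [/\ L1 (fun x => I (F2 x)), L1 (fun z => I (F2 ^~ z)) &
      I (fun x => I (F2 x)) = I (fun z => I (F2 ^~ z))].
  apply: (@Rfubini F2 (fun z => KV * (3 * I om) * (m2 z * q z)) _ F2x F2z).
  - apply: measurable_funM; first exact: meas2_fst.
    by apply: measurable_funM; [exact: meas2_remN|exact: meas2_snd].
  - exact: L1Z.
  - move=> z; apply: (@le_trans _ _ (I (fun x => KV * q z * `|rem ch ch' x (- z)|))).
      apply: Rint_le; [exact/L1_abs/F2z|exact/L1Z/L1_abs/(weight_rem_L1 hw)|].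
      move=> x; rewrite /F2 normrM normrM (ger0_norm (qk_ge0 al z)).
      rewrite [leRHS](_ : _ = KV * (`|rem ch ch' x (- z)| * q z)); last by ring.
      apply: ler_wpM2r; last exact: VK.
      by apply: mulr_ge0; [exact: normr_ge0|exact: qk_ge0].
    rewrite RintZ; last exact/L1_abs/(weight_rem_L1 hw).
    rewrite [leRHS](_ : _ = KV * q z * (3 * I om * m2 (- z))); last by rewrite m2N; ring.
    apply: ler_wpM2l; last exact: (weight_rem_int hw).
    by apply: mulr_ge0; [exact: KV0|exact: qk_ge0].
have E z : I (F1 ^~ z) = I (F2 ^~ z).
  have i1 : L1 (fun x => ch x * V (x + z)).
    under eq_fun do rewrite mulrC.
    exact: (L1_mulb (meas_comp_shift z mV) (fun x => VK (x + z)) ich).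
  have i2 : L1 (fun x => V x * ch x) by exact: L1_mulb VK ich.
  have i3 : L1 (fun x => V' x * ch x) by exact: L1_mulb V'K ich.
  have i4 : L1 (fun x => V x * ch' x) by exact: L1_mulb VK (weight_L1' hw).
  have i5 : L1 (fun x => V x * ch (x - z)) by exact: L1_mulb VK (L1_shift (- z) ich).
  rewrite /F1 /F2.
  rewrite (@Rint_eq _ (fun x => q z * ((ch x * V (x + z) - V x * ch x) - z * (V' x * ch x)))); last first.
    by move=> x; rewrite /rem; ring.
  rewrite [RHS](@Rint_eq _ (fun x => q z * ((V x * ch (x - z) - V x * ch x) + z * (V x * ch' x)))); last first.
    by move=> x; rewrite /rem; ring.
  have j1 := L1B i1 i2; have j2 := L1Z z i3; have j3 := L1B i5 i2; have j4 := L1Z z i4.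
  rewrite (RintZ _ (L1B j1 j2)) (RintZ _ (L1D j3 j4)) (RintB j1 j2) (RintB i1 i2).
  rewrite (RintD j3 j4) (RintB i5 i2) (RintZ z i3) (RintZ z i4).
  rewrite (ibp hw hV) mulrN opprK; congr (_ * (_ - _ + _)).
  rewrite -(Rint_shift z i5); apply: Rint_eq => x.
  by rewrite addrK mulrC.
have E1 x : I (F1 x) = ch x * Lop V V' x by exact: (RintZ (ch x) (Lop_L1 x hV)).
have E2 x : I (F2 x) = V x * Lopm ch ch' x by exact: (RintZ (V x) (Lopm_L1 x)).
split.
- by move: A1; under eq_fun do rewrite E1.
- by move: B1; under eq_fun do rewrite E2.
- exact: (etrans (esym (Rint_eq E1)) (etrans A3 (etrans (Rint_eq E) (etrans (esym B3) (Rint_eq E2))))).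
Qed.

(** Take [V = 1] in the duality. *)
Lemma Lopm_L1x : L1 (Lopm ch ch').
Proof.
have [_ + _] := kato_fubini (C11_cst 1).
by under eq_fun do rewrite mul1r.
Qed.

(** The slice bound [g] is left free: for [phi r] a suitable [g] decays in [r], whereas
    [weight_rem_int] would give a multiple of the integral of [om], which grows with [r]. *)
Lemma Lopm_int_le (g : R -> R) : L1 (fun z => g z * q z) ->
  (forall z, I (fun x => `|rem ch ch' x (- z)|) <= g z) ->
  I (fun x => `|Lopm ch ch' x|) <= I (fun z => g z * q z).
Proof.
move=> ig hg; have [[mch mch'] _ _ _ _] := hw.
pose F x z := `|rem ch ch' x (- z) * q z|.
have Fx x : L1 (F x) by exact: L1_abs (Lopm_L1 x).
have Fz z : L1 (F ^~ z) by exact: L1_abs (L1Zr (q z) (weight_rem_L1 hw (- z))).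
have Fle z : I (F ^~ z) <= g z * q z.
  rewrite mulrC; apply: (@le_trans _ _ (I (fun x => q z * `|rem ch ch' x (- z)|))).
    apply: Rint_le => //; first exact/L1Z/L1_abs/(weight_rem_L1 hw).
    by move=> x; rewrite /F normrM (ger0_norm (qk_ge0 al z)) mulrC.
  rewrite RintZ; last exact/L1_abs/(weight_rem_L1 hw).
  by rewrite ler_wpM2l ?qk_ge0.
have [A1 A2 A3] : [/\ L1 (fun x => I (F x)), L1 (fun z => I (F ^~ z)) &
      I (fun x => I (F x)) = I (fun z => I (F ^~ z))].
  apply: (@Rfubini F (fun z => g z * q z) _ Fx Fz ig).
    apply: measurableT_comp => //; apply: measurable_funM; first exact: meas2_remN.
    by apply: meas2_snd; exact: meas_qk.
  move=> z; apply: le_trans (Fle z); rewrite le_eqVlt; apply/orP; left; apply/eqP.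
  by apply: Rint_eq => x; rewrite /F normr_id.
apply: (@le_trans _ _ (I (fun x => I (F x)))).
  by apply: Rint_le; [exact: L1_abs Lopm_L1x|exact: A1|move=> x; exact: Rint_norm (Lopm_L1 x)].
by rewrite A3; apply: Rint_le; [exact: A2|exact: ig|exact: Fle].
Qed.

(** The counterpart of [Lopm_int_le]: a sup bound is paired with an integrable difference, an
    integral bound with a bounded one. *)
Lemma Lopm_sup_le C : (forall x z, `|rem ch ch' x (- z)| <= C * m2 z) ->
  forall x, `|Lopm ch ch' x| <= C * I (fun z => m2 z * q z).
Proof.
move=> h x; rewrite -RintZ; last exact: L1_rho.
apply: Rint_normle; [exact: Lopm_L1|exact/L1Z/L1_rho|].
by move=> z; rewrite normrM (ger0_norm (qk_ge0 al z)) mulrA ler_wpM2r ?qk_ge0.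
Qed.

End Weighted.

End KatoSpace.

(** * Kato's inequality integrated in time *)

Section KatoTime.

Lemma le0_of_invn (S C : R) (N0 : nat) :
  (forall N, (N0 <= N)%N -> S <= C / N.+1%:R) -> S <= 0.
Proof.
move=> H; have [//|S0] := leP S 0.
pose N := maxn N0 (Num.truncn (C / S)).
have := H N (leq_maxl _ _); rewrite ler_pdivlMr//.
have h : C / S < N.+1%:R.
  by apply: lt_le_trans (truncnS_gt _) _; rewrite ler_nat ltnS leq_maxr.
by move: h; rewrite ltr_pdivrMr// mulrC => h1 h2; have := le_lt_trans h2 h1; rewrite ltxx.
Qed.

(** Integrates a differential inequality known only step by step: [N + 1] equal steps accumulate the
    error [C (t - s)^2 / (N + 1)]. The lower bound on [N] makes the steps at most 1. *)
Lemma euler_le (J : R -> R) (s t A C : R) : s <= t ->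
  (forall tau h, s <= tau -> 0 < h -> h <= 1 -> tau + h <= t ->
     J (tau + h) <= J tau + h * A + C * h ^+ 2) ->
  J t <= J s + (t - s) * A.
Proof.
rewrite le_eqVlt => /predU1P[->|st] H; first by rewrite subrr mul0r addr0.
rewrite -subr_le0; apply: (@le0_of_invn _ (C * (t - s) ^+ 2) (Num.truncn (t - s))) => N hN.
have [h hE] : exists h, h = (t - s) / N.+1%:R by eexists.
have h0 : 0 < h by rewrite hE divr_gt0// subr_gt0.
have h1 : h <= 1.
  rewrite hE ler_pdivrMr// mul1r ltW// (lt_le_trans (truncnS_gt _))//.
  by rewrite ler_nat ltnS.
have hN1 : N.+1%:R * h = t - s by rewrite hE mulrC divfK.
have key : forall i, (i <= N.+1)%N -> J (s + i%:R * h) <= J s + i%:R * (h * A + C * h ^+ 2).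
  elim => [|i IH] iN; first by rewrite !mul0r !addr0.
  have ih : s + i%:R * h + h <= t.
    rewrite -addrA -[X in _ + (_ + X)]mul1r -mulrDl natr1.
    by have : i.+1%:R * h <= N.+1%:R * h; [rewrite ler_pM2r// ler_nat|lra].
  rewrite -natr1 mulrDl mul1r addrA.
  have s1 : s <= s + i%:R * h by rewrite lerDl mulr_ge0// ltW.
  have := H _ h s1 h0 h1 ih; have := IH (ltnW iN); lra.
have E : N.+1%:R * (h * A + C * h ^+ 2) = (t - s) * A + C * (t - s) ^+ 2 / N.+1%:R.
  by rewrite hE; field; rewrite nat1r pnatr_eq0.
have := key N.+1 (leqnn _); rewrite hN1 (addrC s) subrK E.
by rewrite lerBlDl addrA.
Qed.

Variable al : R.
Hypothesis hal : 1 < al < 2.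
Local Notation Lop := (Lop al).
Local Notation Lopm := (Lopm al).
Variables (Kw : R) (om ch ch' : R -> R).
Hypothesis hw : weight Kw om ch ch'.

(* Convexity of eta gives eta'(v) Lop v <= Lop (eta o v) pointwise. *)
Lemma kato_nonlocal e K v v' : 0 < e -> C11 K v v' ->
  L1 (fun x => v x / eta e (v x) * (ch x * Lop v v' x)) /\
  I (fun x => v x / eta e (v x) * (ch x * Lop v v' x)) <=
  I (fun x => eta e (v x) * `|Lopm ch ch' x|).
Proof.
move=> e0 hv; have hV := C11_eta e0 hv; have [mv mv' vK v'K rv] := hv.
have [ic _ _] := kato_fubini hal hw hv.
have [iV iV2 EV] := kato_fubini hal hw hV.
have i1 : L1 (fun x => v x / eta e (v x) * (ch x * Lop v v' x)).
  exact: (L1_mulb (meas_deta e0 mv) (fun x => deta_le1 e0 (v x)) ic).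
split; first exact: i1.
apply: (@le_trans _ _ (I (fun x => eta e (v x) * Lopm ch ch' x))).
  rewrite -EV; apply: Rint_le; [exact: i1|exact: iV|move=> x].
  rewrite mulrCA; apply: ler_wpM2l; first by case: hw => _ _ /(_ x)[/andP[]].
  rewrite /Lop -RintZ; last exact: (Lop_L1 hal x hv).
  apply: Rint_le; [exact/L1Z/(Lop_L1 hal x hv)|exact: (Lop_L1 hal x hV)|].
  move=> z; rewrite mulrA; apply: ler_wpM2r; first exact: qk_ge0.
  by rewrite /rem mulrBr mulrA lerD2r; exact: eta_convex.
apply: Rint_le; [exact: iV2| |].
  by have := L1_abs iV2; under eq_fun do rewrite normrM (ger0_norm (eta_ge0 _ _)).
by move=> x; rewrite ler_wpM2l ?eta_ge0 ?ler_norm.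
Qed.

Lemma kato_space e K c v v' b b' f w : 0 < e -> 0 <= c ->
  C11 K v v' -> C11 K b b' -> meas f -> (forall x, `|f x| <= K) ->
  (forall x, w x = c * Lop v v' x - (b x * v' x + b' x * v x) + f x) ->
  L1 (fun x => v x / eta e (v x) * w x * ch x) /\
  I (fun x => v x / eta e (v x) * w x * ch x) <=
    c * I (fun x => `|v x| * `|Lopm ch ch' x|) + I (fun x => `|v x| * `|b x| * `|ch' x|)
    + I (fun x => `|f x| * ch x) + e * (c * I (fun x => `|Lopm ch ch' x|) + 2 * K * I om).
Proof.
move=> e0 c0 hv hb mf fK wE; have K0 := C11_ge0 hv.
have [inl nl] := kato_nonlocal e0 hv.
have hV := C11_eta e0 hv; have [mv mv' vK v'K rv] := hv.
have [mb mb' bK b'K rb] := hb.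
have [mV mV' VK V'K rV] := hV.
have [_ iom hch omK _] := hw.
have ich := weight_L1 hw; have ich' := weight_L1' hw.
have hY := C11M hb hV.
have [mY mY' YK Y'K rY] := hY.
have md := meas_deta e0 mv.
have dle := fun x => deta_le1 e0 (v x).
have iLm := Lopm_L1x hal hw.
pose g x := b' x * (eta e (v x) - v x * (v x / eta e (v x))).
have gK x : `|g x| <= K * e.
  have /andP[h1 h2] := eta_defect e0 (v x).
  by rewrite normrM; apply: ler_pM => //; rewrite ger0_norm.
have mg : meas g.
  by apply: measurable_funM => //; apply: measurable_funB => //; exact: measurable_funM.
have ifc : L1 (fun x => f x * ch x) by exact: L1_mulb fK ich.
have idf : L1 (fun x => v x / eta e (v x) * (f x * ch x)) by exact: L1_mulb dle ifc.
have iY : L1 (fun x => (b' x * eta e (v x) + b x * (v x / eta e (v x) * v' x)) * ch x).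
  exact: (L1_mulb mY' Y'K ich).
have iYc : L1 (fun x => (b x * eta e (v x)) * ch' x) by exact: (L1_mulb mY YK ich').
have ig : L1 (fun x => g x * ch x) by exact: L1_mulb gK ich.
have wE2 x : v x / eta e (v x) * w x * ch x =
    c * (v x / eta e (v x) * (ch x * Lop v v' x)) +
    (v x / eta e (v x) * (f x * ch x)
     + (g x * ch x - (b' x * eta e (v x) + b x * (v x / eta e (v x) * v' x)) * ch x)).
  by rewrite wE /g; ring.
have i0 : L1 (fun x => g x * ch x - (b' x * eta e (v x) + b x * (v x / eta e (v x) * v' x)) * ch x).
  exact: L1B.
have i1 : L1 (fun x => v x / eta e (v x) * (f x * ch x)
     + (g x * ch x - (b' x * eta e (v x) + b x * (v x / eta e (v x) * v' x)) * ch x)).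
  exact: L1D.
split.
  under eq_fun do rewrite wE2.
  by apply: L1D => //; exact: L1Z.
rewrite (Rint_eq wE2) RintD//; last exact: L1Z.
rewrite RintZ// RintD// RintB// (ibp hw hY) opprK.
have b1 : c * I (fun x => v x / eta e (v x) * (ch x * Lop v v' x)) <=
   c * I (fun x => `|v x| * `|Lopm ch ch' x|) + e * (c * I (fun x => `|Lopm ch ch' x|)).
  rewrite mulrCA -mulrDr ler_wpM2l//; apply: le_trans nl _.
  rewrite -RintZ; last exact: L1_abs.
  have ivL : L1 (fun x => `|v x| * `|Lopm ch ch' x|).
    apply: (@L1_mulb _ _ K); [exact: meas_norm|by move=> x; rewrite normr_id|exact: L1_abs].
  rewrite -RintD//; last exact/L1Z/L1_abs.
  apply: Rint_le.
  - apply: (@L1_mulb _ _ (K + e + 2 * K ^+ 2 / e)) => //; exact: L1_abs.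
  - by apply: L1D => //; exact/L1Z/L1_abs.
  - by move=> x; rewrite -mulrDl ler_wpM2r// eta_le.
have b2 : I (fun x => v x / eta e (v x) * (f x * ch x)) <= I (fun x => `|f x| * ch x).
  apply: Rint_le => //.
    by apply: (@L1_mulb _ _ K) => //; [exact: meas_norm|move=> x; rewrite normr_id].
  move=> x; have [/andP[h1 h2] _] := hch x.
  rewrite mulrA ler_wpM2r//; apply: le_trans (ler_norm _) _.
  by rewrite normrM -[leRHS]mul1r ler_wpM2r.
have b3 : I (fun x => g x * ch x) <= e * (K * I om).
  rewrite [leRHS](_ : _ = I (fun x => K * e * om x)); last by rewrite RintZ//; ring.
  apply: Rint_le => //; first exact: L1Z.
  move=> x; have [/andP[h1 h2] _] := hch x.
  apply: le_trans (ler_norm _) _; rewrite normrM (ger0_norm h1).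
  exact: ler_pM.
have b4 : I (fun x => b x * eta e (v x) * ch' x) <=
    I (fun x => `|v x| * `|b x| * `|ch' x|) + e * (K * I om).
  have iq : L1 (fun x => `|v x| * `|b x| * `|ch' x|).
    apply: (@L1_mulb _ _ (K * K)); [|move=> x|exact: L1_abs].
      by apply: measurable_funM; exact: meas_norm.
    by rewrite normrM !normr_id ler_pM.
  rewrite mulrA -RintZ// -RintD//; last exact: L1Z.
  apply: Rint_le => //; first by apply: L1D => //; exact: L1Z.
  move=> x; have [_ h2] := hch x.
  apply: le_trans (ler_norm _) _; rewrite !normrM (ger0_norm (eta_ge0 _ _)).
  apply: (@le_trans _ _ (`|b x| * (`|v x| + e) * `|ch' x|)).
    by rewrite ler_wpM2r// ler_wpM2l// eta_le.
  rewrite mulrDr mulrDl lerD//; first by rewrite [`|b x| * _]mulrC.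
  rewrite -!mulrA mulrCA ler_wpM2l ?(ltW e0)//; exact: ler_pM.
by lra.
Qed.

(** [w] is the time derivative of [v], known through its one-step expansion; [b] is a velocity and
    [f] a forcing. Keeping both slots lets convection be treated as transport for the plain
    difference and as forcing for the averaged one. The time steps are refined at fixed [e], and [e]
    tends to 0 last. *)
Lemma kato (s t c K A : R) (v v' b b' f w : R -> R -> R) : s <= t -> 0 <= c ->
  (forall tau, s <= tau <= t -> C11 K (v tau) (v' tau)) ->
  (forall tau, s <= tau <= t -> C11 K (b tau) (b' tau)) ->
  (forall tau, s <= tau <= t -> meas (f tau) /\ (forall x, `|f tau x| <= K)) ->
  (forall tau x, s <= tau <= t ->
     w tau x = c * Lop (v tau) (v' tau) x - (b tau x * v' tau x + b' tau x * v tau x) + f tau x) ->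
  (forall tau x, s <= tau <= t -> `|w tau x| <= K) ->
  (forall tau h x, s <= tau -> 0 < h -> tau + h <= t ->
     `|v (tau + h) x - v tau x - h * w tau x| <= K * h ^+ 2) ->
  (forall tau, s <= tau <= t ->
     c * I (fun x => `|v tau x| * `|Lopm ch ch' x|) +
     I (fun x => `|v tau x| * `|b tau x| * `|ch' x|) + I (fun x => `|f tau x| * ch x) <= A) ->
  I (fun x => `|v t x| * ch x) <= I (fun x => `|v s x| * ch x) + (t - s) * A.
Proof.
move=> st c0 hv hb hf wE wK hstep hA.
have sI : s <= s <= t by rewrite lexx.
have tI : s <= t <= t by rewrite lexx st.
have K0 := C11_ge0 (hv _ sI).
have [_ iom hch _ _] := hw; have ich := weight_L1 hw.
have O0 : 0 <= I om by apply: Rint_ge0; exact: weight_om_ge0 hw.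
have ch0 x : 0 <= ch x by case: (hch x) => /andP[].
have [Ce CeE] : exists Ce, Ce = c * I (fun x => `|Lopm ch ch' x|) + 2 * K * I om by eexists.
have iV e tau : 0 < e -> s <= tau <= t -> L1 (fun x => eta e (v tau x) * ch x).
  by move=> e0 ht; have [m _ VK _ _] := C11_eta e0 (hv _ ht); exact: L1_mulb VK ich.
have iv tau : s <= tau <= t -> L1 (fun x => `|v tau x| * ch x).
  move=> ht; have [m _ VK _ _] := hv _ ht.
  by apply: (@L1_mulb _ _ K) => // [|x]; [exact: meas_norm|rewrite normr_id].
have key e : 0 < e -> I (fun x => eta e (v t x) * ch x) <=
    I (fun x => eta e (v s x) * ch x) + (t - s) * (A + e * Ce).
  (* [K] comes from the Taylor error of [v]; [2 K^2 / e] comes from [eta_upper], the increment of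
     [v] being at most [2 K h] because [h <= 1]. *)
  move=> e0; apply: (@euler_le (fun tau => I (fun x => eta e (v tau x) * ch x)) s t _
     ((K + 2 * K ^+ 2 / e) * I om)) => // tau h stau h0 h1 htau.
  have ht : s <= tau <= t by rewrite stau/=; lra.
  have ht' : s <= tau + h <= t by rewrite htau andbT; lra.
  have [mf fK] := hf _ ht.
  have [iw hI] := kato_space e0 c0 (hv _ ht) (hb _ ht) mf fK (fun x => wE tau x ht).
  apply: (@le_trans _ _ (I (fun x => eta e (v tau x) * ch x +
     (h * (v tau x / eta e (v tau x) * w tau x * ch x) + (K + 2 * K ^+ 2 / e) * h ^+ 2 * om x)))).
    apply: Rint_le; first exact: iV.
      apply: L1D; first exact: iV.
      by apply: L1D; exact: L1Z.
    move=> x; have [/andP[h2 h3] _] := hch x.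
    have up := eta_upper e0 (v tau x) (v (tau + h) x).
    have dl := deta_le1 e0 (v tau x).
    have st1 := hstep tau h x stau h0 htau.
    have wk := wK tau x ht.
    have hh : h ^+ 2 <= h by rewrite expr2 ler_piMr// ltW.
    have dv : `|v (tau + h) x - v tau x| <= 2 * K * h.
      have -> : v (tau + h) x - v tau x = (v (tau + h) x - v tau x - h * w tau x) + h * w tau x by ring.
      rewrite (le_trans (ler_normD _ _))// normrM (gtr0_norm h0).
      have : K * h ^+ 2 <= K * h by rewrite ler_wpM2l.
      have : h * `|w tau x| <= h * K by rewrite ler_wpM2l// ltW.
      by lra.
    have sq : (v (tau + h) x - v tau x) ^+ 2 / (2 * e) <= 2 * K ^+ 2 / e * h ^+ 2.
      rewrite ler_pdivrMr ?mulr_gt0//.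
      rewrite [leRHS](_ : _ = (2 * K * h) ^+ 2); last by field; rewrite gt_eqF.
      rewrite -[leLHS]real_normK ?num_real// lerXn2r ?nnegrE//.
      by rewrite !mulr_ge0// ltW.
    have lin : v tau x / eta e (v tau x) * (v (tau + h) x - v tau x) <=
       h * (v tau x / eta e (v tau x) * w tau x) + K * h ^+ 2.
      rewrite -lerBlDl (_ : _ - _ = v tau x / eta e (v tau x) * (v (tau + h) x - v tau x - h * w tau x)); last by ring.
      apply: le_trans (ler_norm _) _; rewrite normrM -[leRHS]mul1r.
      exact: ler_pM.
    have E0 : 0 <= (K + 2 * K ^+ 2 / e) * h ^+ 2.
      rewrite mulr_ge0 ?sqr_ge0// addr_ge0// mulr_ge0 ?invr_ge0 ?(ltW e0)//.
      by rewrite mulr_ge0 ?sqr_ge0.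
    apply: (@le_trans _ _ ((eta e (v tau x) + (h * (v tau x / eta e (v tau x) * w tau x) +
        (K + 2 * K ^+ 2 / e) * h ^+ 2)) * ch x)); first by rewrite ler_wpM2r//; lra.
    have : (K + 2 * K ^+ 2 / e) * h ^+ 2 * ch x <= (K + 2 * K ^+ 2 / e) * h ^+ 2 * om x.
      by rewrite ler_wpM2l.
    by rewrite !mulrDl; lra.
  have i2 : L1 (fun x => h * (v tau x / eta e (v tau x) * w tau x * ch x)) by exact: L1Z.
  have i3 : L1 (fun x => (K + 2 * K ^+ 2 / e) * h ^+ 2 * om x) by exact: L1Z.
  rewrite RintD; [|exact: iV|exact: L1D]; rewrite RintD// !RintZ//.
  have := hA _ ht; rewrite CeE => hA'.
  have : h * I (fun x => v tau x / eta e (v tau x) * w tau x * ch x) <=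
     h * (A + e * (c * I (fun x => `|Lopm ch ch' x|) + 2 * K * I om)).
    by rewrite ler_wpM2l ?(ltW h0)//; lra.
  by lra.
rewrite -subr_le0; apply: (@le0_of_linear _ (I ch + (t - s) * Ce)) => e e0 _.
have := key e e0.
have : I (fun x => `|v t x| * ch x) <= I (fun x => eta e (v t x) * ch x).
  apply: Rint_le; [exact: iv|exact: iV|].
  by move=> x; rewrite ler_wpM2r// eta_ge_norm.
have : I (fun x => eta e (v s x) * ch x) <= I (fun x => `|v s x| * ch x) + e * I ch.
  rewrite -RintZ// -RintD; [|exact: iv|exact: L1Z].
  apply: Rint_le; [exact: iV|by apply: L1D; [exact: iv|exact: L1Z]|].
  by move=> x; rewrite -mulrDl ler_wpM2r// eta_le.
by lra.
Qed.

End KatoTime.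

(** * Smoothness of solutions as quantitative bounds on time strips *)

Lemma meas_derivable (f : R -> R) : (forall x, derivable f x 1) -> meas f.
Proof.
move=> df; apply: continuous_measurable_fun => x.
by apply: differentiable_continuous; apply/derivable1_diffP.
Qed.

Lemma is_derive_derive1 (f : R -> R) x : derivable f x 1 -> is_derive x 1 f (derive1 f x).
Proof. by move=> df; rewrite derive1E; exact: derivableP. Qed.

Lemma taylor2_glob (K : R) (f f' f'' : R -> R) : (forall x : R, is_derive x 1 f (f' x)) ->
  (forall x : R, is_derive x 1 f' (f'' x)) -> (forall x, `|f'' x| <= K) ->
  forall x y, `|rem f f' x y| <= K * y ^+ 2.
Proof.
move=> df df' f''K x y.
have h1 : x - `|y| - 1 < x < x + `|y| + 1 by apply/andP; split; have := normr_ge0 y; lra.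
have h2 : x - `|y| - 1 < x + y < x + `|y| + 1.
  by apply/andP; split; have := ler_norm y; have := ler_norm (- y); rewrite normrN; lra.
have := @taylor2_le _ _ K f f' f'' (fun x _ => df x) (fun x _ => df' x) (fun x _ => f''K x) _ _ h1 h2.
by rewrite [x + y - x]addrAC subrr add0r.
Qed.

(** All regularity used later, with one constant: expansions in [x] and in [t], and Lipschitz
    dependence of [ux] on [t]. Unlike [Cinfb_strip] it passes to differences and translates without
    computing a derivative. *)
Record strip_reg (K a T : R) (u ux ut : R -> R -> R) : Prop := StripReg {
  sr_C11 : forall t, a < t < T -> C11 K (u ^~ t) (ux ^~ t) ;
  sr_t : forall x t t', a < t < T -> a < t' < T ->
     `|u x t' - u x t - (t' - t) * ut x t| <= K * (t' - t) ^+ 2 ;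
  sr_ut : forall x t, a < t < T -> `|ut x t| <= K ;
  sr_utm : forall t, a < t < T -> meas (ut ^~ t) ;
  sr_uxt : forall x t t', a < t < T -> a < t' < T -> `|ux x t' - ux x t| <= K * `|t' - t| }.

Lemma Cinfb_strip_reg (a T : R) (u : R -> R -> R) : Cinfb_strip a T u ->
  exists K, strip_reg K a T u (dx u) (dt u).
Proof.
move=> hu.
have bnd s : exists M, forall x t, a < t < T -> `|iterpd s u x t| <= M by case: (hu s) => [[]].
have der s b x t : a < t < T -> derivable_dir b (iterpd s u) x t.
  by move=> ht; case: (hu s) => _ /(_ b x t ht).
have [M0 hM0] := bnd [::]; have [M1 hM1] := bnd [:: true].
have [M2 hM2] := bnd [:: true; true]; have [M3 hM3] := bnd [:: false].
(* [iterpd] applies the head of the word last, so [[:: false; true]] is [dt (dx u)]; it yields the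
   Lipschitz bound on [ux] in time. *)
have [M4 hM4] := bnd [:: false; false]; have [M5 hM5] := bnd [:: false; true].
pose K := `|M0| + `|M1| + `|M2| + `|M3| + `|M4| + `|M5|.
have [KM0 KM1 KM2] : [/\ M0 <= K, M1 <= K & M2 <= K].
  rewrite /K; have := ler_norm M0; have := ler_norm M1; have := ler_norm M2.
  have := normr_ge0 M0; have := normr_ge0 M1; have := normr_ge0 M2.
  have := normr_ge0 M3; have := normr_ge0 M4; have := normr_ge0 M5.
  by split; lra.
have [KM3 KM4 KM5] : [/\ M3 <= K, M4 <= K & M5 <= K].
  rewrite /K; have := ler_norm M3; have := ler_norm M4; have := ler_norm M5.
  have := normr_ge0 M0; have := normr_ge0 M1; have := normr_ge0 M2.
  have := normr_ge0 M3; have := normr_ge0 M4; have := normr_ge0 M5.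
  by split; lra.
exists K; split.
- move=> t ht; split.
  + by apply: meas_derivable => x; exact: (der [::] true x t ht).
  + by apply: meas_derivable => x; exact: (der [:: true] true x t ht).
  + by move=> x; apply: le_trans KM0; exact: hM0.
  + by move=> x; apply: le_trans KM1; exact: hM1.
  + apply: (@taylor2_glob K (u ^~ t) (dx u ^~ t) (dx (dx u) ^~ t)).
    * by move=> x; apply: is_derive_derive1; exact: (der [::] true x t ht).
    * by move=> x; apply: is_derive_derive1; exact: (der [:: true] true x t ht).
    * by move=> x; apply: le_trans KM2; exact: hM2.
- move=> x t t' ht ht'; rewrite [_ * dt u x t]mulrC.
  have H1 s : a < s < T -> is_derive s 1 (u x) (dt u x s).
    by move=> hs; apply: is_derive_derive1; exact: (der [::] false x s hs).
  have H2 s : a < s < T -> is_derive s 1 (dt u x) (dt (dt u) x s).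
    by move=> hs; apply: is_derive_derive1; exact: (der [:: false] false x s hs).
  have H3 s : a < s < T -> `|dt (dt u) x s| <= K.
    by move=> hs; apply: le_trans KM4; exact: hM4.
  exact: (@taylor2_le a T K (u x) (dt u x) (dt (dt u) x) H1 H2 H3 t t' ht ht').
- by move=> x t ht; apply: le_trans KM3; exact: hM3.
- by move=> t ht; apply: meas_derivable => x; exact: (der [:: false] true x t ht).
- move=> x t t' ht ht'.
  have H1 s : a < s < T -> is_derive s 1 (dx u x) (dt (dx u) x s).
    by move=> hs; apply: is_derive_derive1; exact: (der [:: true] false x s hs).
  have H2 s : a < s < T -> `|dt (dx u) x s| <= K.
    by move=> hs; apply: le_trans KM5; exact: hM5.
  exact: (@mvt_le a T K (dx u x) (dt (dx u) x) H1 H2 t t' ht ht').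
Qed.

Section Solution.
Variables (al : R) (u0 : R -> R) (u : R -> R -> R).
Hypothesis hu : is_solution al u0 u.

Lemma sol_reg a T : 0 < a < T -> exists K, strip_reg K a T u (dx u) (dt u).
Proof.
move=> /andP[a0 aT]; have [_ h _ _] := hu (lt_trans a0 aT).
by apply: Cinfb_strip_reg; apply: h; rewrite a0.
Qed.

Lemma sol_bound T : 0 < T -> exists2 M, 1 <= M & forall x t, 0 < t < T -> `|u x t| <= M.
Proof.
move=> T0; have [[_ [M hM]] _ _ _] := hu T0.
exists (1 + `|M|); first by rewrite lerDl.
by move=> x t ht; apply: le_trans (hM x t ht) _; have := ler_norm M; lra.
Qed.

Lemma sol_eq x t : 0 < t ->
  dt u x t = Calpha al * Lop al (u ^~ t) (dx u ^~ t) x - u x t * dx u x t.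
Proof.
move=> t0; have T0 : 0 < t + 1 by lra.
have [_ _ h _] := hu T0.
have ht : 0 < t < t + 1 by rewrite t0 ltrDl ltr01.
have := h x t ht.
have -> : frac_lap al (u ^~ t) x = - Calpha al * Lop al (u ^~ t) (dx u ^~ t) x by [].
by lra.
Qed.

Lemma sol_weak (ph : R -> R) : L1 ph ->
  (fun t => I (fun x => u x t * ph x)) @ 0^'+ --> I (fun x => u0 x * ph x).
Proof. by move=> iph; have [_ _ _ h] := hu ltr01; apply: h; exact: L1_integrable. Qed.

End Solution.

(** * The gradient estimate *)

Section NearMax.
Variable al : R.
Hypothesis hal : 1 < al < 2.
Local Notation q := (qk al).
Local Notation Lop := (Lop al).

Lemma q_integral_cvg0 (g : nat -> R -> R) C : (forall n, meas (g n)) ->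
  (forall n z, 0 <= g n z <= C * m2 z) -> (forall z, g ^~ z @ \oo --> 0) ->
  I (fun z => g n z * q z) @[n --> \oo] --> (0 : R).
Proof.
move=> mg hg g0.
have -> : (0 : R) = I (fun z => 0 * q z).
  rewrite (@Rint_eq _ (fun z => 0 * (m2 z * q z))); last by move=> z; rewrite !mul0r.
  by rewrite (RintZ 0 (L1_rho hal)) mul0r.
apply: (@Rint_cvg _ _ (fun z => C * (m2 z * q z))).
- by move=> n; apply: measurable_funM => //; exact: meas_qk.
- exact: L1Z (L1_rho hal).
- move=> n z; have /andP[h1 h2] := hg n z.
  by rewrite normrM (ger0_norm h1) (ger0_norm (qk_ge0 al z)) mulrA; apply: ler_wpM2r => //; exact: qk_ge0.
- by move=> z; apply: cvgMr_tmp; exact: g0.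
Qed.

(* Where v is within d^2 of its supremum, |v'| = O(d); gdel bounds the positive part of the remainder. *)
Definition gdel (d z : R) := Num.min (z ^+ 2) (d ^+ 2 + d * `|z|).

Lemma gdel_ge0 d z : 0 <= d -> 0 <= gdel d z.
Proof. by move=> d0; rewrite /gdel le_min sqr_ge0/= addr_ge0 ?sqr_ge0// mulr_ge0. Qed.

Lemma gdel_m2 d z : 0 <= d -> d <= 1 -> gdel d z <= 2 * m2 z.
Proof.
move=> d0 d1; rewrite -ler_pdivrMl// mulrC.
have g1 : gdel d z <= z ^+ 2 by rewrite /gdel ge_min lexx.
have g2 : gdel d z <= d ^+ 2 + d * `|z| by rewrite /gdel ge_min lexx orbT.
have z0 := normr_ge0 z.
apply: le_m2; first by have := sqr_ge0 z; lra.
have [z1|z1] := leP 1 `|z|.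
  have : d ^+ 2 <= 1 by rewrite expr_le1.
  have : d * `|z| <= `|z| by rewrite ler_piMl.
  lra.
have : z ^+ 2 <= `|z| by rewrite -real_normK ?num_real// expr2 ler_piMl// ltW.
lra.
Qed.

Lemma gdel_meas d : meas (gdel d).
Proof.
apply: measurable_minr; first exact: measurable_funX.
by apply: measurable_funD => //; apply: measurable_funM => //; exact: (@meas_norm id).
Qed.

Lemma gdel_L1 d : 0 <= d -> d <= 1 -> L1 (fun z => gdel d z * q z).
Proof.
move=> d0 d1; apply: (@L1_q_dom _ hal _ 2); first exact: gdel_meas.
by move=> z; rewrite ger0_norm ?gdel_ge0// gdel_m2.
Qed.

(** Dominated convergence with majorant [2 * m2]; one [d] then meets all smallness requirements at a
    near-maximum. *)
Lemma gdel_small (e : R) : 0 < e ->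
  exists d, [/\ 0 < d, d <= 1, d <= e & I (fun z => gdel d z * q z) <= e].
Proof.
move=> e0; pose d (n : nat) : R := n.+1%:R^-1.
have dp n : 0 < d n by rewrite invr_gt0.
have d1 n : d n <= 1 by rewrite invf_le1// ler1n.
have d0 : d @ \oo --> (0 : R) by exact: cvg_harmonic.
have g0 z : gdel (d n) z @[n --> \oo] --> (0 : R).
  have H : d n ^+ 2 + d n * `|z| @[n --> \oo] --> (0 : R).
    have -> : (0 : R) = 0 * 0 + 0 * `|z| by rewrite !mul0r addr0.
    by apply: cvgD; [under eq_fun do rewrite expr2; exact: cvgM|apply: cvgMr_tmp].
  apply: (@squeeze_cvgr _ _ _ _ (fun=> 0) (fun n => d n ^+ 2 + d n * `|z|)) => //.
    by apply: nearW => n; rewrite gdel_ge0 ?(ltW (dp n))//= /gdel ge_min lexx orbT.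
  exact: cvg_cst.
have gb n z : 0 <= gdel (d n) z <= 2 * m2 z by rewrite gdel_ge0 ?gdel_m2 ?(ltW (dp n)).
have C0 := q_integral_cvg0 (fun n => gdel_meas (d n)) gb g0.
have H : \forall n \near \oo, I (fun z => gdel (d n) z * q z) <= e.
  move/cvgrPdist_le : C0 => /(_ e e0); apply: filterS => n.
  by rewrite sub0r normrN; apply: le_trans (ler_norm _).
have H2 : \forall n \near \oo, d n <= e.
  move/cvgrPdist_le : d0 => /(_ e e0); apply: filterS => n.
  by rewrite sub0r normrN; apply: le_trans (ler_norm _).
have [n [h1 h2]] := filter_ex (filterI H H2).
by exists (d n); split.
Qed.

Section AtNearMax.
Variables (K S d x : R) (v v' : R -> R).
Hypotheses (hv : C11 K v v') (vS : forall y, v y <= S) (d0 : 0 < d) (d1 : d <= 1)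
  (hx : S - d ^+ 2 <= v x).

(** From [x] to [x + d] or [x - d] the function can grow by at most [d^2], and the Taylor error is
    [K d^2]; hence [|v' x| d <= (1 + K) d^2]. *)
Lemma near_max_d : `|v' x| <= (1 + K) * d.
Proof.
case: hv => _ _ _ _ rK.
have h1 := rK x d; have h2 := rK x (- d); rewrite sqrrN in h2.
move: h1 h2; rewrite /rem !ler_norml => /andP[a1 a2] /andP[b1 b2].
have := vS (x + d); have := vS (x - d) => s1 s2.
apply/andP; split; rewrite -(ler_pM2r d0); move: a1 b1 hx; rewrite !expr2; lra.
Qed.

(** At an exact maximum the remainder is nonpositive. Here [v (x + z) - v x <= d^2] and the slope
    bound give the second entry of [gdel], Taylor the first. *)
Lemma near_max_rem z : rem v v' x z <= (1 + K) * gdel d z.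
Proof.
have K0 := C11_ge0 hv; have hd := near_max_d; case: hv => _ _ _ _ rK.
rewrite -ler_pdivrMl; last by lra.
rewrite /gdel le_min !ler_pdivrMl; last by lra.
- apply/andP; split; first by have := rK x z; have := ler_norm (rem v v' x z); have := sqr_ge0 z; lra.
  have h : - (v' x * z) <= (1 + K) * d * `|z|.
    by apply: le_trans (ler_norm _) _; rewrite normrN normrM ler_wpM2r.
  have := vS (x + z); have : 0 <= K * d ^+ 2 by rewrite mulr_ge0 ?sqr_ge0.
  by move: hx; rewrite /rem; lra.
- by lra.
Qed.

(* Only the annulus r < z <= 2 r is kept as a good term; the integral of a translation difference
   over it is O(|k|) by annulus_shift. *)
Lemma Lop_near_max (r : R) : 0 < r ->
  Lop v v' x <= (1 + K) * I (fun z => gdel d z * q z) + ((2 * r) `^ (1 + al))^-1 *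
     (I (fun z => \1_`]r, 2 * r] z * v (x + z)) - r * v x + 2 * r ^+ 2 * (1 + K) * d).
Proof.
move=> r0; have K0 := C11_ge0 hv; have hd := near_max_d.
have [mv _ vK _ _] := hv.
set Q := (_ `^ _)^-1; have Q0 : 0 <= Q by rewrite invr_ge0 powR_ge0.
have rr : r <= 2 * r by lra.
have i1 : L1 (fun z => \1_`]r, 2 * r] z * v (x + z)).
  under eq_fun do rewrite mulrC; apply: (@L1_mulb _ _ K); last exact: L1_indic.
    by under eq_fun do rewrite addrC; exact: meas_comp_shift.
  by move=> z; exact: vK.
(* On the annulus the remainder is at most [v (x + z) + c], since the slope costs at most
   [(1 + K) d] times [2 r]. *)
pose c := (1 + K) * d * (2 * r) - v x.
have i2 : L1 (fun z => c * \1_`]r, 2 * r] z) by exact/L1Z/L1_indic.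
have -> : (1 + K) * I (fun z => gdel d z * q z) + Q *
     (I (fun z => \1_`]r, 2 * r] z * v (x + z)) - r * v x + 2 * r ^+ 2 * (1 + K) * d) =
   I (fun z => (1 + K) * (gdel d z * q z) + Q * (\1_`]r, 2 * r] z * v (x + z) + c * \1_`]r, 2 * r] z)).
  rewrite RintD; [|exact/L1Z/gdel_L1/d1/ltW|exact/L1Z/L1D].
  rewrite RintZ; last exact/gdel_L1/d1/ltW.
  rewrite RintZ; last exact: L1D.
  rewrite RintD// RintZ; last exact: L1_indic.
  by rewrite Rint_indic// /c; ring.
apply: Rint_le.
- exact: (Lop_L1 hal x hv).
- by apply: L1D; apply: L1Z; [exact/gdel_L1/d1/ltW|exact: L1D].
move=> z; have hr := near_max_rem z.
rewrite indicE; case: (boolP (z \in _)) => zI; last first.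
  rewrite mul0r mulr0 addr0 mulr0 addr0 mulrA; apply: ler_wpM2r hr; exact: qk_ge0.
move: zI; rewrite inE/= in_itv/= => /andP[z1 z2]; rewrite mul1r mulr1.
have z0 : 0 < z by lra.
have qQ : Q <= q z.
  rewrite /Q /qk gtr0_norm// lef_pV2 ?posrE ?powR_gt0//; last by lra.
  by apply: ge0_ler_powR; rewrite ?nnegrE; case/andP: hal => *; lra.
(* The bracket is nonpositive, so replacing [q z] by the smaller value [Q] of the kernel at [2 r]
   can only increase the product. *)
have h1 : (rem v v' x z - (1 + K) * gdel d z) * q z <= (rem v v' x z - (1 + K) * gdel d z) * Q.
  by apply: ler_wnM2l => //; lra.
have h2 : (rem v v' x z - (1 + K) * gdel d z) * Q <= (v (x + z) + c) * Q.
  apply: ler_wpM2r => //.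
  have g0 : 0 <= (1 + K) * gdel d z by rewrite mulr_ge0 ?gdel_ge0 ?(ltW d0)//; lra.
  have : - (v' x * z) <= (1 + K) * d * (2 * r).
    apply: le_trans (ler_norm _) _; rewrite normrN normrM (gtr0_norm z0); apply: ler_pM => //.
    exact: ltW.
  by rewrite /rem /c; lra.
lra.
Qed.

End AtNearMax.

(** Moving the translation onto the indicator leaves a difference of two indicators, supported
    within [|k|] of the end points [r] and [2 r]: two intervals of length [2 |k|], each with
    [|u| <= M]. The slope of [u] does not enter. *)
Lemma annulus_shift (M r k x : R) (u : R -> R) : 0 < r -> meas u -> (forall y, `|u y| <= M) ->
  I (fun z => \1_`]r, 2 * r] z * (u (x + z + k) - u (x + z))) <= 4 * M * `|k|.
Proof.
move=> r0 mu0 uM; have M0 : 0 <= M by apply: le_trans (uM 0).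
have mux : meas (fun z => u (x + z)) by under eq_fun do rewrite addrC; exact: meas_comp_shift.
have L z0 : L1 (fun z => \1_`]r, 2 * r] (z + z0)) by exact: (L1_shift z0 (L1_indic r (2 * r))).
have i1 z0 : L1 (fun z => \1_`]r, 2 * r] (z + z0) * u (x + z)).
  by under eq_fun do rewrite mulrC; exact: (L1_mulb mux (fun z => uM (x + z)) (L z0)).
have iu : L1 (fun z => \1_`]r, 2 * r] z * u (x + z)).
  by have := i1 0; under eq_fun do rewrite addr0.
have i1k : L1 (fun z => \1_`]r, 2 * r] z * u (x + z + k)).
  by have := L1_shift k (i1 (- k)); under eq_fun do rewrite addrK addrA.
have -> : I (fun z => \1_`]r, 2 * r] z * (u (x + z + k) - u (x + z))) =
    I (fun z => (\1_`]r, 2 * r] (z - k) - \1_`]r, 2 * r] z) * u (x + z)).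
  rewrite (@Rint_eq _ (fun z => \1_`]r, 2 * r] z * u (x + z + k) - \1_`]r, 2 * r] z * u (x + z))); last first.
    by move=> z; ring.
  rewrite (RintB i1k iu) [RHS](@Rint_eq _ (fun z => \1_`]r, 2 * r] (z - k) * u (x + z) - \1_`]r, 2 * r] z * u (x + z))); last first.
    by move=> z; ring.
  rewrite (RintB (i1 (- k)) iu) -(Rint_shift k (i1 (- k))).
  by congr (_ - _); apply: Rint_eq => z; rewrite addrK addrA.
have k0 := normr_ge0 k; have k1 := ler_norm k; have k2 := ler_norm (- k); rewrite normrN in k2.
have j1 := L1_indic (r - `|k|) (r + `|k|); have j2 := L1_indic (2 * r - `|k|) (2 * r + `|k|).
have -> : 4 * M * `|k| = I (fun z => M * (\1_`](r - `|k|), (r + `|k|)] z + \1_`](2 * r - `|k|), (2 * r + `|k|)] z)).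
  rewrite (RintZ _ (L1D j1 j2)) (RintD j1 j2) Rint_indic; last by lra.
  by rewrite Rint_indic; [ring|lra].
apply: Rint_le.
- have := L1B (i1 (- k)) iu; congr (L1f _); apply/funext => z; ring.
- exact: L1Z (L1D j1 j2).
move=> z; apply: le_trans (ler_norm _) _; rewrite normrM mulrC; apply: ler_pM => //.
rewrite !indicE !mem_setE !in_itv/=.
case: (boolP (r < z - k <= 2 * r)) => [/andP[a1 a2]|a].
  case: (boolP (r < z <= 2 * r)) => [_|b]; first by rewrite subrr normr0 addr_ge0.
  rewrite subr0 normr1.
  have [c1|c1] := leP z r.
    have -> : (r - `|k| < z <= r + `|k|) by apply/andP; split; lra.
    by rewrite lerDl.
  have -> : (2 * r - `|k| < z <= 2 * r + `|k|).
    move: b; rewrite c1/= -ltNge => b; apply/andP; split; lra.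
  by rewrite lerDr.
case: (boolP (r < z <= 2 * r)) => [/andP[b1 b2]|_]; last by rewrite subrr normr0 addr_ge0.
rewrite sub0r normrN normr1.
have [c1|c1] := leP (z - k) r.
  have -> : (r - `|k| < z <= r + `|k|) by apply/andP; split; lra.
  by rewrite lerDl.
have -> : (2 * r - `|k| < z <= 2 * r + `|k|).
  move: a; rewrite c1/= -ltNge => a; apply/andP; split; lra.
by rewrite lerDr.
Qed.

End NearMax.

(** * A backward Riccati inequality and the decay of the slope *)

Section GradientBound.
Section Riccati.
Variables (G : R -> R) (a t c A0 C al : R).
Hypotheses (c0 : 0 < c) (A00 : 0 < A0) (al1 : 1 <= al).
Hypothesis step : forall s h, a < s - h -> 0 < h -> s <= t -> A0 <= G s ->
  G s + h * c * G s `^ (1 + al) - C * h ^+ 2 <= G (s - h).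

(** Small steps backwards in time never lower [G] below [G s >= A0], so [step] keeps applying, each
    time at the initial rate or better. *)
Lemma riccati_lin s tau : s <= t -> A0 <= G s -> a < tau -> tau <= s ->
  G s + (s - tau) * (c * G s `^ (1 + al)) <= G tau.
Proof.
move=> st AG atau; rewrite le_eqVlt => /predU1P[->|taus].
  by rewrite subrr mul0r addr0.
have [B BE] : exists B, B = c * G s `^ (1 + al) by eexists.
have G0 : 0 < G s by exact: lt_le_trans AG.
have B0 : 0 < B by rewrite BE mulr_gt0// powR_gt0.
rewrite -BE -subr_le0.
apply: (@le0_of_invn _ (C * (s - tau) ^+ 2) (Num.truncn (C * (s - tau) / B))) => N hN.
have [h hE] : exists h, h = (s - tau) / N.+1%:R by eexists.
have h0 : 0 < h by rewrite hE divr_gt0// subr_gt0.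
have hN1 : N.+1%:R * h = s - tau by rewrite hE mulrC divfK.
have ChB : C * h <= B.
  have : C * (s - tau) / B <= N.+1%:R.
    by rewrite ltW// (lt_le_trans (truncnS_gt _))// ler_nat ltnS.
  by rewrite ler_pdivrMr// -hN1 mulrCA ler_pM2l.
have inc : 0 <= h * B - C * h ^+ 2.
  by rewrite expr2 mulrA [h * B]mulrC -mulrBl mulr_ge0 ?(ltW h0)// subr_ge0.
have key : forall i, (i <= N.+1)%N -> G s + i%:R * (h * B - C * h ^+ 2) <= G (s - i%:R * h).
  elim => [|i IH] iN; first by rewrite !mul0r subr0 addr0.
  have {}IH := IH (ltnW iN).
  have ih : i.+1%:R * h <= s - tau by rewrite -hN1 ler_pM2r// ler_nat.
  have GA : G s <= G (s - i%:R * h).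
    by apply: le_trans IH; rewrite lerDl mulr_ge0.
  have i0 : 0 <= i%:R * h by rewrite mulr_ge0// ltW.
  have E : s - i.+1%:R * h = s - i%:R * h - h by rewrite -natr1; ring.
  have H : G (s - i%:R * h) + h * c * G (s - i%:R * h) `^ (1 + al) - C * h ^+ 2
      <= G (s - i%:R * h - h).
    apply: step => //; [by rewrite -E; lra|by lra|exact: le_trans GA].
  have P : h * B <= h * c * G (s - i%:R * h) `^ (1 + al).
    rewrite BE mulrA ler_pM2l ?mulr_gt0//.
    have Gp : 0 <= G (s - i%:R * h) by exact: le_trans (ltW G0) GA.
    have a0 : 0 <= 1 + al by move: al1; lra.
    by apply: ge0_ler_powR => //; rewrite nnegrE// ltW.
  rewrite E -natr1 mulrDl mul1r; apply: le_trans H; lra.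
have := key N.+1 (leqnn _); rewrite hN1 subKr.
have -> : N.+1%:R * (h * B - C * h ^+ 2) = (s - tau) * B - C * (s - tau) ^+ 2 / N.+1%:R.
  by rewrite hE; field; rewrite nat1r pnatr_eq0.
by move=> k; rewrite lerBlDl -lerBlDr -addrA.
Qed.

(* Backwards in time G doubles within w = 1 / (c G^al); as al >= 1 the successive doubling times are at
   most w, w / 2, w / 4, ..., so G would be unbounded on a past of length 2 w. *)
Lemma riccati B0 : (forall s, a < s <= t -> G s <= B0) -> a < t -> A0 <= G t ->
  G t `^ al * (c * (t - a)) <= 2.
Proof.
move=> GB at' AG; rewrite leNgt; apply/negP => H.
have [y yE] : exists y, y = G t by eexists.
rewrite -yE in H AG *.
have y0 : 0 < y by exact: lt_le_trans AG.
have ya0 : 0 < y `^ al by rewrite powR_gt0.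
have [w wE] : exists w, w = (c * y `^ al)^-1 by eexists.
have w0 : 0 < w by rewrite wE invr_gt0 mulr_gt0.
have wc : w * (c * y `^ al) = 1 by rewrite wE mulVf// gt_eqF// mulr_gt0.
have w2 : 2 * w < t - a.
  rewrite wE ltr_pdivrMr ?mulr_gt0//; move: H; rewrite (_ : y `^ al * _ = (t - a) * (c * y `^ al))//; ring.
pose p (j : nat) : R := 2 ^- j.
have pS j : p j = 2 * p j.+1 by rewrite /p exprS; field; rewrite expf_neq0.
have p0 j : 0 < p j by rewrite invr_gt0 exprn_gt0.
have p1 j : p j <= 1 by rewrite invf_le1 ?exprn_gt0// exprn_ege1// ler1n.
pose tau j := t - 2 * w * (1 - p j).
have tau_a j : a < tau j.
  rewrite /tau; have : 2 * w * (1 - p j) <= 2 * w.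
    rewrite -[leRHS]mulr1; apply: ler_wpM2l; first by rewrite mulr_ge0// ltW.
    by have := p0 j; lra.
  by lra.
have tau_t j : tau j <= t.
  by rewrite /tau gerBl mulr_ge0// ?subr_ge0// mulr_ge0// ltW.
have key j : 2 ^+ j * y <= G (tau j).
  elim: j => [|j IH]; first by rewrite /tau /p expr0 invr1 subrr mulr0 subr0 mul1r yE.
  have e1 : 1 <= 2 ^+ j :> R by rewrite exprn_ege1// ler1n.
  have yj : y <= 2 ^+ j * y by rewrite ler_peMl// ltW.
  have AGj : A0 <= G (tau j) by exact: le_trans (le_trans AG yj) IH.
  have tt : tau j.+1 <= tau j.
    by rewrite /tau lerD2l lerN2 ler_wpM2l//; [rewrite mulr_ge0// ltW|have := pS j; have := p0 j.+1; lra].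
  have := riccati_lin (tau_t j) AGj (tau_a j.+1) tt.
  have -> : tau j - tau j.+1 = w * p j by rewrite /tau pS; ring.
  apply: le_trans.
  have P : 2 ^+ j * y * (2 ^+ j * y `^ al) <= G (tau j) `^ (1 + al).
    have y2 : 0 <= 2 ^+ j * y by rewrite mulr_ge0// ltW.
    apply: (@le_trans _ _ ((2 ^+ j * y) `^ (1 + al))).
      rewrite powRD; last by apply/implyP => _; rewrite gt_eqF// mulr_gt0// exprn_gt0.
      rewrite powRr1//; apply: ler_wpM2l => //.
      rewrite powRM ?(ltW y0)//; apply: ler_wpM2r; first exact: powR_ge0.
      exact: le1r_powR.
    have a0 : 0 <= 1 + al by move: al1; lra.
    by apply: ge0_ler_powR => //; rewrite nnegrE// (le_trans _ IH).
  have Q : w * p j * (c * (2 ^+ j * y * (2 ^+ j * y `^ al))) = 2 ^+ j * y.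
    transitivity ((p j * 2 ^+ j) * (w * (c * y `^ al)) * (2 ^+ j * y)); first by ring.
    by rewrite wc /p mulVf ?expf_neq0// !mul1r.
  have : w * p j * (c * (2 ^+ j * y * (2 ^+ j * y `^ al))) <= w * p j * (c * G (tau j) `^ (1 + al)).
    apply: ler_wpM2l; first by rewrite mulr_ge0// ltW.
    by apply: ler_wpM2l => //; exact: ltW.
  by rewrite Q exprS -mulrA mulr2n mulrDl mul1r; lra.
(* This [j] gives [2^(j + 1) y <= B0 < (j + 1) y], which is absurd. *)
pose j := Num.truncn (B0 / y).
have : 2 ^+ j.+1 * y <= B0.
  by apply: le_trans (key _) (GB _ _); rewrite tau_a tau_t.
have : B0 / y < j.+1%:R by exact: truncnS_gt.
rewrite ltr_pdivrMr// => h1 h2; have := lt_le_trans (le_lt_trans h2 h1) (lexx _).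
rewrite ltr_pM2r// -natrX ltr_nat ltnNge.
by rewrite ltnW// ltn_expl.
Qed.

End Riccati.

Variable al : R.
Hypothesis hal : 1 < al < 2.
Local Notation Lop := (Lop al).

Section Step.
Variables (u ux ut : R -> R -> R) (K M a : R).
Hypothesis reg : strip_reg K a 2 u ux ut.
Hypothesis M1 : 1 <= M.
Hypothesis uM : forall x t, a < t < 2 -> `|u x t| <= M.
Hypothesis eqn : forall x t, a < t < 2 ->
  ut x t = Calpha al * Lop (u ^~ t) (ux ^~ t) x - u x t * ux x t.

(** With [r = 8 M / G] the annulus contributes [4 M |k| - 8 M |k|], weighted by the kernel at
    [2 r = 16 M / G]. Times [Calpha al] this is [- |k| * grad_c * G^(1 + al)]. *)
Definition grad_c : R := 4 * M * Calpha al * ((16 * M) `^ (1 + al))^-1.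
(** Above this threshold half of the gain absorbs the convective term [2 G^2], as [1 + al > 2]. The
    summand 1 ensures [G >= 1]. *)
Definition grad_A0 : R := 1 + (4 / grad_c) `^ (al - 1)^-1.

Lemma grad_c_gt0 : 0 < grad_c.
Proof.
have C0 := Calpha_gt0 hal.
by rewrite /grad_c !mulr_gt0// ?invr_gt0 ?powR_gt0 ?mulr_gt0//; move: M1; lra.
Qed.

Lemma grad_A0P G : grad_A0 <= G -> 2 * G ^+ 2 <= grad_c / 2 * G `^ (1 + al).
Proof.
have c0 := grad_c_gt0; have [a1 a2] := andP hal.
rewrite /grad_A0 => AG; have p0 : 0 <= (4 / grad_c) `^ (al - 1)^-1 by exact: powR_ge0.
have G0 : 0 < G by lra.
have h : 4 / grad_c <= G `^ (al - 1).
  have c4 : 0 <= 4 / grad_c by rewrite ltW// divr_gt0.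
  have -> : 4 / grad_c = ((4 / grad_c) `^ (al - 1)^-1) `^ (al - 1).
    by rewrite -powRrM mulVf ?powRr1//; lra.
  by apply: ge0_ler_powR; rewrite ?nnegrE//; lra.
have -> : G `^ (1 + al) = G ^+ 2 * G `^ (al - 1).
  rewrite -powR_mulrn ?(ltW G0)// -powRD; last by apply/implyP => _; rewrite gt_eqF.
  by congr (_ `^ _); ring.
have : grad_c / 2 * (G ^+ 2 * (4 / grad_c)) <= grad_c / 2 * (G ^+ 2 * G `^ (al - 1)).
  apply: ler_wpM2l; first by rewrite ltW// divr_gt0.
  by apply: ler_wpM2l => //; exact: sqr_ge0.
apply: le_trans; rewrite le_eqVlt; apply/orP; left; apply/eqP; field.
by rewrite gt_eqF.
Qed.

Variable k : R.
Hypotheses (k0 : k != 0) (Kk : K * `|k| <= 1).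

Definition supD (t : R) : R := sup (range (fun x => u (x + k) t - u x t)).

Lemma D_le2M t x : a < t < 2 -> `|u (x + k) t - u x t| <= 2 * M.
Proof.
by move=> ht; apply: le_trans (ler_normB _ _) _; have := uM (x + k) ht; have := uM x ht; lra.
Qed.

Lemma has_supD t : a < t < 2 -> has_sup (range (fun x => u (x + k) t - u x t)).
Proof.
move=> ht; split; first by exists (u (0 + k) t - u 0 t), 0.
by exists (2 * M) => _ [x _ <-]; apply: le_trans (ler_norm _) (D_le2M x ht).
Qed.

Lemma supD_ub t x : a < t < 2 -> u (x + k) t - u x t <= supD t.
Proof. by move=> ht; apply: (ub_le_sup (has_supD ht).2); exists x. Qed.

Lemma supD_le t : a < t < 2 -> supD t <= 2 * M.
Proof.
move=> ht; apply: ge_sup; first exact: (has_supD ht).1.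
by move=> _ [x _ <-]; apply: le_trans (ler_norm _) (D_le2M x ht).
Qed.

(** Going back in time avoids following a maximum: [x] is a near-maximum at time [s], and [supD] at
    time [s - h] is at least the increment at the same [x]. The error [2 K h^2] stems from the time
    expansions at [x] and at [x + k]. *)
Lemma grad_step s h : a < s - h -> 0 < h -> s < 2 -> grad_A0 <= supD s / `|k| ->
  supD s / `|k| + h * (grad_c / 2) * (supD s / `|k|) `^ (1 + al) - 2 * K / `|k| * h ^+ 2
  <= supD (s - h) / `|k|.
Proof.
move=> ash h0 s2 AG; have Kk' := Kk; have kp : 0 < `|k| by rewrite normr_gt0.
have hs : a < s < 2 by apply/andP; split; lra.
have hsh : a < s - h < 2 by apply/andP; split; lra.
have c0 := grad_c_gt0; have C0 := Calpha_gt0 hal; have [a1 a2] := andP hal.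
have [S SE] : exists S, S = supD s by eexists.
have [G GE] : exists G, G = supD s / `|k| by eexists.
have SG : S = G * `|k| by rewrite SE GE divfK// gt_eqF.
have G1 : 1 <= G.
  by rewrite GE; apply: le_trans AG; rewrite /grad_A0 lerDl powR_ge0.
have hG := @grad_A0P G; rewrite -GE in AG *; have {}hG := hG AG.
have M0 : 0 < M by move: M1; lra.
have G0 : 0 < G by lra.
rewrite ler_pdivlMr//.
rewrite [leLHS](_ : _ = S + h * (grad_c / 2) * G `^ (1 + al) * `|k| - 2 * K * h ^+ 2); last first.
  by rewrite SG; field; rewrite gt_eqF.
have uC := sr_C11 reg hs.
have K0 := C11_ge0 uC.
pose v x := u (x + k) s - u x s; pose v' x := ux (x + k) s - ux x s.
have hv : C11 (K + K) v v' by exact: C11B (C11_shift k uC) uC.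
(* This radius makes [r * S] equal to [8 M |k|], twice the bound of [annulus_shift]. *)
have [r rE] : exists r, r = 8 * M / G by eexists.
have r0 : 0 < r by rewrite rE divr_gt0// mulr_gt0.
have rS : r * S = 8 * M * `|k| by rewrite rE SG; field; rewrite gt_eqF.
have [Q QE] : exists Q, Q = ((2 * r) `^ (1 + al))^-1 by eexists.
have Q0 : 0 <= Q by rewrite QE invr_ge0 powR_ge0.
have QG : Calpha al * (4 * M) * Q = grad_c * G `^ (1 + al).
  rewrite QE rE (_ : 2 * (8 * M / G) = 16 * M * G^-1); last by ring.
  rewrite powRM ?invr_ge0 ?(ltW G0)//; last by rewrite mulr_ge0// ltW.
  rewrite -(powR_inv1 (ltW G0)) -powRrM mulN1r powRN invfM invrK /grad_c.
  by ring.
have [c3 c3E] : exists c3, c3 = (1 + (K + K)) + Q * (r + 2 * r ^+ 2 * (1 + (K + K))) by eexists.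
have [c4 c4E] : exists c4, c4 = Calpha al * c3 + M * (1 + (K + K)) by eexists.
(* The near-maximum errors are at most [e] times a constant and vanish with [e]; the summand 1 pays
   for [S - d^2 <= v x]. *)
rewrite -subr_le0; apply: (@le0_of_linear _ (1 + h * c4)) => e e0 e1.
have ek : 0 < Num.min e `|k| by rewrite lt_min e0.
have [d [d0 d1 dek hI]] := gdel_small hal ek.
have de : d <= e by apply: le_trans dek _; rewrite ge_min lexx.
have dk : d <= `|k| by apply: le_trans dek _; rewrite ge_min lexx orbT.
have {}hI : I (fun z => gdel d z * qk al z) <= e by apply: le_trans hI _; rewrite ge_min lexx.
have d2 : d ^+ 2 <= d by rewrite expr2 ler_piMr// ltW.
have [_ [x _ <-] hx] := sup_adherent (exprn_gt0 2 d0) (has_supD hs).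
have {}hx : S - d ^+ 2 <= v x by rewrite SE ltW.
have vS y : v y <= S by rewrite SE; exact: supD_ub.
have vx := vS x.
have hd := near_max_d hv vS d0 hx.
have hL := Lop_near_max hal hv vS d0 d1 hx r0.
have hann : I (fun z => \1_`]r, 2 * r] z * v (x + z)) <= 4 * M * `|k|.
  exact: (@annulus_shift M r k x (u ^~ s) r0 (let: And5 m _ _ _ _ := uC in m) (fun y => uM y hs)).
have L1' : Lop v v' x <= - (4 * M * `|k|) * Q + e * c3.
  apply: le_trans hL _; rewrite -QE c3E.
  have b1 : (1 + (K + K)) * I (fun z => gdel d z * qk al z) <= (1 + (K + K)) * e.
    by apply: ler_wpM2l => //; lra.
  have b2 : Q * (I (fun z => \1_`]r, 2 * r] z * v (x + z)) - r * v x + 2 * r ^+ 2 * (1 + (K + K)) * d) <=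
     Q * (4 * M * `|k| - (8 * M * `|k| - r * e) + 2 * r ^+ 2 * (1 + (K + K)) * e).
    apply: ler_wpM2l => //.
    have : r * (S - d ^+ 2) <= r * v x by rewrite ler_pM2l.
    have : r * d ^+ 2 <= r * e by rewrite ler_pM2l//; lra.
    have : 2 * r ^+ 2 * (1 + (K + K)) * d <= 2 * r ^+ 2 * (1 + (K + K)) * e.
      apply: ler_wpM2l => //; apply: mulr_ge0; last by lra.
      by apply: mulr_ge0 => //; exact: sqr_ge0.
    by rewrite mulrBr rS; lra.
  by lra.
have DtE : ut (x + k) s - ut x s = Calpha al * Lop v v' x - (u (x + k) s * v' x + v x * ux x s).
  rewrite !eqn// (LopB hal x (C11_shift k uC) uC).
  have -> : Lop (fun x => u (x + k) s) (fun x => ux (x + k) s) x = Lop (u ^~ s) (ux ^~ s) (x + k).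
    exact: (@Lop_shift al (u ^~ s) (ux ^~ s) k x).
  by rewrite /v /v'; ring.
have T1 : - (u (x + k) s * v' x) <= M * (1 + (K + K)) * e.
  apply: le_trans (ler_norm _) _; rewrite normrN normrM -mulrA; apply: ler_pM => //.
    exact: uM.
  by apply: le_trans hd _; apply: ler_wpM2l => //; lra.
have kS : `|k| <= S by rewrite SG ler_peMl.
have vn : `|v x| <= S by rewrite ler_norml; apply/andP; split => //; lra.
(* The slope is read off the increment itself: [ux x s * k] differs from [v x] by at most
   [K k^2 <= |k| <= S]. *)
have uxb : `|ux x s| <= 2 * G.
  rewrite -(ler_pM2r kp) -normrM.
  have -> : ux x s * k = v x - rem (u ^~ s) (ux ^~ s) x k by rewrite /v /rem; ring.
  apply: le_trans (ler_normB _ _) _.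
  have : `|rem (u ^~ s) (ux ^~ s) x k| <= K * k ^+ 2 by case: uC => _ _ _ _; exact.
  rewrite -[k ^+ 2]real_normK ?num_real// expr2 mulrA => rr.
  have : K * `|k| * `|k| <= 1 * `|k| by apply: ler_wpM2r.
  have : 1 * `|k| <= G * `|k| by apply: ler_wpM2r.
  by rewrite -mulrA -SG; lra.
have T2 : - (v x * ux x s) <= 2 * `|k| * G ^+ 2.
  apply: le_trans (ler_norm _) _; rewrite normrN normrM.
  rewrite (_ : 2 * `|k| * G ^+ 2 = S * (2 * G)); last by rewrite SG; ring.
  exact: ler_pM.
have Dt : ut (x + k) s - ut x s <= - (`|k| * (grad_c / 2 * G `^ (1 + al))) + e * c4.
  rewrite DtE c4E.
  have : Calpha al * Lop v v' x <= Calpha al * (- (4 * M * `|k|) * Q + e * c3) by rewrite ler_pM2l.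
  have -> : Calpha al * (- (4 * M * `|k|) * Q + e * c3) = - (`|k| * (grad_c * G `^ (1 + al))) + e * (Calpha al * c3).
    by rewrite -QG; ring.
  have : `|k| * (2 * G ^+ 2) <= `|k| * (grad_c / 2 * G `^ (1 + al)) by rewrite ler_pM2l.
  by lra.
have st1 := sr_t reg (x + k) hs hsh; have st2 := sr_t reg x hs hsh.
rewrite (_ : s - h - s = - h) in st1 st2; last by ring.
rewrite sqrrN in st1 st2.
have : u (x + k) (s - h) - u x (s - h) <= supD (s - h) by exact: supD_ub.
move: st1 st2; rewrite !ler_norml => /andP[n1 _] /andP[_ n2].
have : h * (ut (x + k) s - ut x s) <= h * (- (`|k| * (grad_c / 2 * G `^ (1 + al))) + e * c4).
  by rewrite ler_pM2l.
by move: hx; rewrite /v; lra.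
Qed.

End Step.

(** [riccati] on [[t/2, t]] bounds [G^al] by a constant over [t] that depends only on [M] and [al].
    The strip constant [K] is not controlled as [t] tends to 0, but it only restricts how small [k]
    must be. Increments by [k] and [- k] bound the slope from both sides as [k] tends to 0. *)
Lemma gradient_bound (u0 : R -> R) (u : R -> R -> R) : is_solution al u0 u ->
  exists2 Cg, 0 <= Cg & forall x t : R, 0 < t -> t <= 1 -> `|dx u x t| <= Cg * t `^ (- al^-1).
Proof.
move=> hu; have T2 : 0 < 2 :> R by [].
have [M M1 uM] := sol_bound hu T2.
have [a1 a2] := andP hal.
have c0 := grad_c_gt0 M1.
pose Cg := grad_A0 M + (4 / (grad_c M / 2)) `^ al^-1.
have A1 : 1 <= grad_A0 M by rewrite /grad_A0 lerDl powR_ge0.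
exists Cg; first by rewrite addr_ge0 ?powR_ge0//; lra.
move=> x t t0 t1.
have ht : 0 < t / 2 < 2 by apply/andP; split; lra.
have [K reg] := sol_reg hu ht.
have uM' x0 s : t / 2 < s < 2 -> `|u x0 s| <= M.
  by move=> /andP[h1 h2]; apply: uM; apply/andP; split; lra.
have eqn x0 s : t / 2 < s < 2 -> dt u x0 s = Calpha al * Lop (u ^~ s) (dx u ^~ s) x0 - u x0 s * dx u x0 s.
  by move=> /andP[h1 _]; apply: (sol_eq hu); lra.
have htt : t / 2 < t < 2 by apply/andP; split; lra.
have K0 := C11_ge0 (sr_C11 reg htt).
have key (k : R) : k != 0 -> K * `|k| <= 1 -> u (x + k) t - u x t <= `|k| * (Cg * t `^ (- al^-1)).
  move=> k0 Kk; have kp : 0 < `|k| by rewrite normr_gt0.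
  rewrite mulrC -ler_pdivrMr//.
  apply: (@le_trans _ _ (supD u k t / `|k|)).
    by rewrite ler_pM2r ?invr_gt0//; exact: (supD_ub uM').
  have tp : 1 <= t `^ (- al^-1).
    rewrite powRN -[leLHS]invr1 lef_pV2 ?posrE ?powR_gt0//.
    apply: (@le_trans _ _ (1 `^ al^-1)); last by rewrite powR1.
    by apply: ge0_ler_powR; rewrite ?nnegrE ?invr_ge0//; lra.
  (* Below the threshold there is nothing to gain: [t <= 1] makes the power of [t] at least 1. *)
  have [h|h] := leP (grad_A0 M) (supD u k t / `|k|); last first.
    apply: le_trans (ltW h) _; apply: (@le_trans _ _ Cg); first by rewrite lerDl powR_ge0.
    by apply: ler_peMr => //; rewrite addr_ge0 ?powR_ge0//; lra.
  have H : (supD u k t / `|k|) `^ al * (grad_c M / 2 * (t - t / 2)) <= 2.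
    apply: (@riccati (fun s => supD u k s / `|k|) (t / 2) t (grad_c M / 2) (grad_A0 M) (2 * K / `|k|) al _ _ _ _ (2 * M / `|k|)) => //.
    - by rewrite divr_gt0.
    - by lra.
    - by lra.
    - move=> s h' h1 h2 h3; apply: (grad_step reg M1 uM' eqn k0 Kk h1 h2); lra.
    - move=> s /andP[s1 s2]; have hs : t / 2 < s < 2 by apply/andP; split; lra.
      by apply: ler_wpM2r; [rewrite invr_ge0|exact: (supD_le uM' k hs)].
    - by lra.
  have [G GE] : exists G, G = supD u k t / `|k| by eexists.
  rewrite -GE in H h *; have G0 : 0 < G by lra.
  have Gal : G `^ al <= 4 / (grad_c M / 2) * t^-1.
    rewrite -[leRHS](_ : 2 / (grad_c M / 2 * (t - t / 2)) = _); last first.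
      by field; rewrite !gt_eqF.
    rewrite ler_pdivlMr//; apply: mulr_gt0; [by rewrite divr_gt0|lra].
  have : G <= (4 / (grad_c M / 2)) `^ al^-1 * t `^ (- al^-1).
    have al0 : 0 < al by lra.
    have -> : G = (G `^ al) `^ al^-1 by rewrite -powRrM divff ?gt_eqF// powRr1// ltW.
    have c40 : 0 <= 4 / (grad_c M / 2) by rewrite ltW// divr_gt0// divr_gt0.
    rewrite -mulN1r powRrM powR_inv1 ?(ltW t0)// -powRM// ?invr_ge0 ?(ltW t0)//.
    by apply: ge0_ler_powR => //; rewrite ?nnegrE ?invr_ge0 ?powR_ge0// ?(ltW al0)// mulr_ge0// invr_ge0 ltW.
  move=> H1; apply: le_trans H1 _; rewrite /Cg [leRHS]mulrDl lerDr.
  by apply: mulr_ge0; [lra|exact: powR_ge0].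
rewrite -subr_le0; apply: (@le0_of_linear _ 1) => e e0 e1.
(* Then [K * k <= e <= 1], which admits [k] in [key] and makes the Taylor error at most [e]. *)
have [k kE] : exists k, k = e / (K + 1) by eexists.
have k0 : 0 < k by rewrite kE divr_gt0//; lra.
have Kke : K * k <= e.
  by rewrite kE mulrA ler_pdivrMr; [rewrite mulrC ler_wpM2l ?(ltW e0)//|]; lra.
have uC := sr_C11 reg htt.
have [B BE] : exists B, B = Cg * t `^ (- al^-1) by eexists.
rewrite -BE in key *.
have k1 := key k; have k2 := key (- k); rewrite normrN gtr0_norm// in k1 k2.
have {}k1 : u (x + k) t - u x t <= k * B by apply: k1; [rewrite gt_eqF|lra].
have {}k2 : u (x - k) t - u x t <= k * B by apply: k2; [rewrite oppr_eq0 gt_eqF|lra].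
have [_ _ _ _ rK] := uC.
have r1 := rK x k; have r2 := rK x (- k); rewrite sqrrN in r2.
move: r1 r2; rewrite /rem !ler_norml => /andP[r1 _] /andP[r2 _].
have Kk2 : K * k ^+ 2 <= k * e by rewrite expr2 mulrA [leRHS]mulrC ler_pM2r.
have : `|dx u x t| <= B + e; last by lra.
by rewrite ler_norml; apply/andP; split; rewrite -(ler_pM2r k0); lra.
Qed.

End GradientBound.

(** * Solutions and weights *)

Section PhiWeight.
Variable al : R.
Hypothesis hal : 1 < al < 2.
Local Notation Lop := (Lop al).
Local Notation Lopm := (Lopm al).

Lemma weight_phi (r : R) : 1 <= r -> weight 6 (fun x => 6 * phi r x) (phi r) (dphi r).
Proof.
move=> r1; have r0 : 0 < r by lra.
split.
- by split; [exact: phi_meas|exact: dphi_meas].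
- exact/L1Z/L1_phi.
- move=> x; have p := phi_gt0 r x; split; first by apply/andP; split; lra.
  apply: le_trans (dphi_le x r0) _; rewrite ler_pdivrMr//.
  have : 6 * phi r x * 1 <= 6 * phi r x * r by rewrite ler_wpM2l//; lra.
  lra.
- by move=> x; have := phi_le1 r x; lra.
move=> x y y1; apply: le_trans (rem_phi_small x r0 (le_trans y1 r1)) _.
rewrite mulrA [y ^+ 2 * 6]mulrC; apply: ler_wpM2r; first exact/ltW/phi_gt0.
apply: ler_wpM2l => //; rewrite expr_div_n ler_pdivrMr ?exprn_gt0//.
by apply: ler_peMr; [exact: sqr_ge0|exact: exprn_ege1].
Qed.

(* phi_r has its second derivative of size r^-2 on a set of size r, hence a remainder of integral
   O(z^2 / r) for |z| <= r. *)
Definition grem (r z : R) : R := Num.min (z ^+ 2 / r) `|z|.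

Lemma rem_phi_int (r z : R) : 0 < r -> I (fun x => `|rem (phi r) (dphi r) x z|) <= 24 * grem r z.
Proof.
move=> r0; have ip := L1_phi r0; have Ip := Rint_phi_le r0.
have il : L1 (fun x => `|rem (phi r) (dphi r) x z|).
  apply: L1_abs; apply: L1B; first by apply: L1B => //; exact: L1_shift.
  apply: L1Zr; apply: (@L1_dom _ (fun x => r^-1 * phi r x)).
  - exact: dphi_meas.
  - exact: L1Z.
  - by move=> x; rewrite mulrC; exact: dphi_le.
have I0 : 0 <= I (phi r) by apply: Rint_ge0 => x; exact/ltW/phi_gt0.
have [zr|zr] := leP `|z| r.
  have -> : grem r z = z ^+ 2 / r.
    rewrite /grem min_l// ler_pdivrMr// -real_normK ?num_real// expr2.
    by apply: ler_wpM2l.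
  apply: (@le_trans _ _ (I (fun x => 6 * (z / r) ^+ 2 * phi r x))).
    by apply: Rint_le => //; [exact: L1Z|move=> x; exact: rem_phi_small].
  rewrite RintZ//.
  have -> : 24 * (z ^+ 2 / r) = 6 * (z / r) ^+ 2 * (4 * r) by field; rewrite gt_eqF.
  by apply: ler_wpM2l => //; rewrite mulr_ge0 ?sqr_ge0.
have -> : grem r z = `|z|.
  rewrite /grem min_r// ler_pdivlMr// -[leRHS]real_normK ?num_real// expr2.
  by apply: ler_wpM2l => //; exact: ltW.
apply: (@le_trans _ _ (I (fun x => `|z| / r * (phi r (x + z) + 2 * phi r x)))).
  apply: Rint_le => //.
    by apply: L1Z; apply: L1D; [exact: L1_shift|exact: L1Z].
  by move=> x; apply: rem_phi_large => //; exact: ltW.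
rewrite RintZ; last by apply: L1D; [exact: L1_shift|exact: L1Z].
rewrite RintD; [|exact: L1_shift|exact: L1Z].
rewrite Rint_shift// RintZ//.
have -> : 24 * `|z| = `|z| / r * (24 * r) by field; rewrite gt_eqF.
apply: ler_wpM2l; last by lra.
by rewrite divr_ge0// ltW.
Qed.

(** For [|z| <= r] one has [(z / r)^2 <= m2 z / r], using [r >= 1]. The factor [1 / r] is what makes
    mass move slowly into the tails. *)
Lemma rem_phi_sup (r x z : R) : 1 <= r -> `|rem (phi r) (dphi r) x z| <= 6 / r * m2 z.
Proof.
move=> r1; have r0 : 0 < r by lra.
have p1 := phi_le1 r x; have p2 := phi_le1 r (x + z).
have q1 := phi_gt0 r x; have q2 := phi_gt0 r (x + z).
rewrite mulrAC ler_pdivlMr//.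
have [zr|zr] := leP `|z| r.
  have h := rem_phi_small x r0 zr.
  apply: (@le_trans _ _ (6 * (z / r) ^+ 2 * r)).
    apply: ler_wpM2r; first exact: ltW.
    by apply: le_trans h _; apply: ler_piMr => //; rewrite mulr_ge0 ?sqr_ge0.
  have -> : 6 * (z / r) ^+ 2 * r = 6 * (z ^+ 2 / r) by field; rewrite gt_eqF.
  apply: ler_wpM2l => //; apply: le_m2.
    by rewrite ler_pdivrMr// ler_peMr ?sqr_ge0.
  by rewrite ler_pdivrMr// -real_normK ?num_real// expr2; apply: ler_wpM2l.
have h := rem_phi_large x r0 (ltW zr).
have -> : m2 z = `|z|.
  by rewrite /m2 min_r// -real_normK ?num_real// expr2 ler_peMl//; lra.
apply: (@le_trans _ _ (`|z| / r * 3 * r)).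
  apply: ler_wpM2r; first exact: ltW.
  by apply: le_trans h _; apply: ler_wpM2l; [rewrite divr_ge0// ltW|lra].
have -> : `|z| / r * 3 * r = 3 * `|z| by field; rewrite gt_eqF.
by have := normr_ge0 z; lra.
Qed.

Definition lam (r : R) : R := I (fun x => `|Lopm (phi r) (dphi r) x|).

Lemma lam_ge0 (r : R) : 0 <= lam r. Proof. exact: Rint_ge0. Qed.

Lemma grem_meas (r : R) : meas (fun z => 24 * grem r z).
Proof.
apply: measurable_funM => //; apply: measurable_minr; last exact: (@meas_norm id).
by apply: measurable_funM => //; exact: measurable_funX.
Qed.

Lemma grem_bound (r z : R) : 1 <= r -> 0 <= 24 * grem r z <= 24 * m2 z.
Proof.
move=> r1; have r0 : 0 < r by lra.
apply/andP; split.
  by rewrite mulr_ge0// /grem le_min normr_ge0 andbT divr_ge0 ?sqr_ge0// ltW.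
apply: ler_wpM2l => //; apply: le_m2; rewrite /grem ge_min; last by rewrite lexx orbT.
by rewrite ler_pdivrMr// ler_peMr ?sqr_ge0.
Qed.

(** Dominated convergence suffices: [grem r z <= z^2 / r] vanishes for each [z], under the fixed
    majorant [m2 z], whose linear growth the kernel integrates because [al > 1]. *)
Lemma lam_cvg0 : lam n.+1%:R @[n --> \oo] --> (0 : R).
Proof.
have n1 n : 1 <= n.+1%:R :> R by rewrite ler1n.
have n0 n : 0 < n.+1%:R :> R by [].
have H : I (fun z => 24 * grem n.+1%:R z * qk al z) @[n --> \oo] --> (0 : R).
  apply: (@q_integral_cvg0 _ hal (fun n z => 24 * grem n.+1%:R z) 24).
  - by move=> n; exact: grem_meas.
  - by move=> n z; exact: grem_bound.
  - move=> z; have -> : (0 : R) = 24 * 0 by rewrite mulr0.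
    apply: cvgMl_tmp.
    apply: (@squeeze_cvgr _ _ _ _ (fun=> 0) (fun n => z ^+ 2 * n.+1%:R^-1)).
    + apply: nearW => n; rewrite /grem ge_min lexx/= andbT le_min normr_ge0 andbT.
      by rewrite divr_ge0 ?sqr_ge0.
    + exact: cvg_cst.
    + have -> : (0 : R) = z ^+ 2 * 0 by rewrite mulr0.
      by apply: cvgMl_tmp; exact: cvg_harmonic.
apply: (@squeeze_cvgr _ _ _ _ (fun=> 0) (fun n => I (fun z => 24 * grem n.+1%:R z * qk al z))) => //.
  apply: nearW => n; rewrite lam_ge0/=.
  apply: (Lopm_int_le hal (weight_phi (n1 n))).
    apply: (@L1_q_dom _ hal _ 24); first exact: grem_meas.
    by move=> z; have /andP[h1 h2] := grem_bound z (n1 n); rewrite ger0_norm.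
  move=> z; apply: le_trans (rem_phi_int (- z) (n0 n)) _.
  by rewrite /grem sqrrN normrN.
exact: cvg_cst.
Qed.

(* ux and ut are parameters rather than dx u and dt u, so that translates of solutions satisfy the
   predicate without computing their derivatives. *)
Record regsol (u0 : R -> R) (u ux ut : R -> R -> R) : Prop := RegSol {
  rs_reg : forall a T, 0 < a < T -> exists K, strip_reg K a T u ux ut ;
  rs_bound : forall T : R, 0 < T -> exists2 M, 1 <= M & forall x t : R, 0 < t < T -> `|u x t| <= M ;
  rs_eq : forall x t, 0 < t -> ut x t = Calpha al * Lop (u ^~ t) (ux ^~ t) x - u x t * ux x t ;
  rs_weak : forall ph, L1 ph ->
    (fun t => I (fun x => u x t * ph x)) @ 0^'+ --> I (fun x => u0 x * ph x) ;
  rs_grad : exists2 Cg, 0 <= Cg & forall x t : R, 0 < t -> t <= 1 -> `|ux x t| <= Cg * t `^ (- al^-1) ;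
  rs_u0 : meas u0 /\ exists M0, forall x, `|u0 x| <= M0 }.

Lemma sol_regsol u0 u : is_solution al u0 u -> meas u0 -> (exists M0, forall x, `|u0 x| <= M0) ->
  regsol u0 u (dx u) (dt u).
Proof.
move=> hu mu0 bu0; split.
- by move=> a T; exact: (sol_reg hu).
- exact: (sol_bound hu).
- by move=> x t; exact: (sol_eq hu).
- by move=> ph; exact: (sol_weak hu).
- exact: (gradient_bound hal hu).
- by split.
Qed.

(** Lets a solution be compared with its own translates; in the weak limit the translation moves to
    the test function. *)
Lemma regsol_shift k u0 u ux ut : regsol u0 u ux ut ->
  regsol (fun x => u0 (x + k)) (fun x => u (x + k)) (fun x => ux (x + k)) (fun x => ut (x + k)).
Proof.
move=> [h1 h2 h3 h4 h5 [h6 h7]]; split.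
- move=> a T aT; have [K [r1 r2 r3 r4 r5]] := h1 _ _ aT; exists K; split.
  + by move=> t ht; exact: C11_shift k (r1 t ht).
  + by move=> x; exact: r2.
  + by move=> x; exact: r3.
  + by move=> t ht; exact: meas_comp_shift (r4 t ht).
  + by move=> x; exact: r5.
- by move=> T T0; have [M M1 hM] := h2 _ T0; exists M => // x; exact: hM.
- move=> x t t0; rewrite h3//; congr (_ * _ - _).
  by rewrite -(@Lop_shift al (u ^~ t) (ux ^~ t) k x).
- move=> ph iph.
  have := h4 _ (L1_shift (- k) iph).
  have [M0 hM0] := h7.
  have e0 : I (fun x => u0 (x + k) * ph x) = I (fun x => u0 x * ph (x - k)).
    have i0 : L1 (fun x => u0 x * ph (x - k)) by exact: L1_mulb hM0 (L1_shift (- k) iph).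
    by rewrite -(Rint_shift k i0); apply: Rint_eq => x; rewrite addrK.
  rewrite e0; apply: cvg_trans; apply: near_eq_cvg.
  near=> t; have t0 : 0 < t by near: t; exact: nbhs_right_gt.
  have [M M1 hM] := h2 (t + 1) (addr_gt0 t0 ltr01).
  have t2 : 0 < t / 2 < t + 1 by apply/andP; split; lra.
  have [K [r1 _ _ _ _]] := h1 _ _ t2.
  have ht : t / 2 < t < t + 1 by apply/andP; split; lra.
  have [mu _ uK _ _] := r1 t ht.
  have i0 : L1 (fun x => u x t * ph (x - k)) by exact: L1_mulb uK (L1_shift (- k) iph).
  by rewrite -(Rint_shift k i0); apply: Rint_eq => x; rewrite addrK.
- by have [Cg c0 hC] := h5; exists Cg => // x; exact: hC.
- split; first exact: meas_comp_shift.
  by have [M0 hM0] := h7; exists M0.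
Unshelve. all: try end_near.
Qed.

End PhiWeight.

(** * The initial layer *)

Definition avg (d : R) (f : R -> R) (x : R) : R := d^-1 * I (fun y => \1_`]0, d] y * f (x + y)).

Section Avg.
Variable d : R.
Hypothesis d0 : 0 < d.
Let one : R -> R := \1_`]0, d].

Lemma one_le1 y : 0 <= one y <= 1.
Proof. by rewrite /one indicE; case: (_ \in _); rewrite /= ?ler01 ?lexx. Qed.

Lemma one_L1 : L1 one. Proof. exact: L1_indic. Qed.

Lemma Rint_one : I one = d.
Proof. by rewrite /one Rint_indic ?subr0// ltW. Qed.

Lemma avg_L1 f K x : meas f -> (forall x, `|f x| <= K) -> L1 (fun y => one y * f (x + y)).
Proof.
move=> mf fK; under eq_fun do rewrite mulrC.
apply: L1_mulb one_L1; last by move=> y; exact: fK.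
by under eq_fun do rewrite addrC; exact: meas_comp_shift.
Qed.

Lemma avg_le f K x : meas f -> (forall x, `|f x| <= K) -> `|avg d f x| <= K.
Proof.
move=> mf fK; rewrite /avg normrM gtr0_norm ?invr_gt0// mulrC ler_pdivrMr//.
rewrite -[X in _ <= _ * X]Rint_one -(RintZ _ one_L1).
apply: Rint_normle; [exact: (avg_L1 x mf fK)|exact/L1Z/one_L1|].
move=> y; have /andP[h1 h2] := one_le1 y.
by rewrite normrM (ger0_norm h1) mulrC; apply: ler_wpM2r.
Qed.

Lemma avgB f g K1 K2 x : meas f -> (forall x, `|f x| <= K1) -> meas g -> (forall x, `|g x| <= K2) ->
  avg d (fun x => f x - g x) x = avg d f x - avg d g x.
Proof.
move=> mf fK mg gK; rewrite /avg -mulrBr -(RintB (avg_L1 x mf fK) (avg_L1 x mg gK)).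
by congr (_ * _); apply: Rint_eq => y; rewrite mulrBr.
Qed.

Lemma avgZ c f K x : meas f -> (forall x, `|f x| <= K) ->
  avg d (fun x => c * f x) x = c * avg d f x.
Proof.
move=> mf fK; rewrite /avg mulrCA -(RintZ c (avg_L1 x mf fK)).
by congr (_ * _); apply: Rint_eq => y; rewrite mulrCA.
Qed.

(** Measurability of the parameter integral is read off Fubini; the weight [phi 1] makes the double
    integral finite and is divided out afterwards. *)
Lemma avg_meas f K : meas f -> (forall x, `|f x| <= K) -> meas (avg d f).
Proof.
move=> mf fK; have K0 : 0 <= K by apply: le_trans (fK 0).
have ip := L1_phi (@ltr01 R).
pose F (x y : R) := phi 1 x * (one y * f (x + y)).
have Fx x : L1 (F x) by exact: (L1Z _ (avg_L1 x mf fK)).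
have Fy y : L1 (F ^~ y).
  have H : L1 (fun x => one y * (f (x + y) * phi 1 x)).
    by apply: L1Z; exact: (L1_mulb (meas_comp_shift y mf) (fun x => fK (x + y)) ip).
  by have -> : F ^~ y = (fun x => one y * (f (x + y) * phi 1 x)) by apply/funext => x; rewrite /F; ring.
have [H _ _] : [/\ L1 (fun x => I (F x)), L1 (fun y => I (F ^~ y)) &
      I (fun x => I (F x)) = I (fun y => I (F ^~ y))].
  apply: (@Rfubini F (fun y => K * I (phi 1) * one y) _ Fx Fy).
  - apply: measurable_funM; first exact: meas2_fst (phi_meas 1).
    by apply: measurable_funM; [apply: meas2_snd; exact: L1_meas one_L1|exact: meas2_add].
  - exact: L1Z one_L1.
  - move=> y; rewrite [leRHS](_ : _ = I (fun x => (K * one y) * phi 1 x)); last by rewrite (RintZ _ ip); ring.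
    apply: Rint_le; [exact: L1_abs (Fy y)|exact: L1Z ip|].
    move=> x; have /andP[h1 h2] := one_le1 y; have p := phi_gt0 1 x.
    rewrite /F !normrM (gtr0_norm p) (ger0_norm h1) mulrC [K * _]mulrC.
    by apply: ler_wpM2r; [exact: ltW|exact: ler_wpM2l].
have -> : avg d f = (fun x => d^-1 * I (F x) * (1 + (x / 1) ^+ 2)).
  apply/funext => x; rewrite /F (RintZ _ (avg_L1 x mf fK)) /avg /phi.
  by field; rewrite !gt_eqF//; have := phi_den 1 x; rewrite ?divr1 ?expr2; lra.
apply: measurable_funM; first by apply: measurable_funM => //; exact: L1_meas H.
by apply: measurable_funD => //; apply: measurable_funX; exact: measurable_funM.
Qed.

Lemma avg_rem K f f' x z : C11 K f f' ->
  rem (avg d f) (avg d f') x z = d^-1 * I (fun y => one y * rem f f' (x + y) z).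
Proof.
move=> [mf mf' fK f'K _].
have i1 := avg_L1 x mf fK; have i2 := avg_L1 (x + z) mf fK; have i3 := avg_L1 x mf' f'K.
have -> : I (fun y => one y * rem f f' (x + y) z) =
  I (fun y => (one y * f (x + z + y) - one y * f (x + y)) - z * (one y * f' (x + y))).
  by apply: Rint_eq => y; rewrite /rem (addrAC x z y); ring.
rewrite (RintB (L1B i2 i1) (L1Z z i3)) (RintB i2 i1) (RintZ z i3) /rem /avg.
by ring.
Qed.

Lemma avg_C11 K f f' : C11 K f f' -> C11 K (avg d f) (avg d f').
Proof.
move=> hf; have K0 := C11_ge0 hf; have [mf mf' fK f'K rK] := hf.
split.
- exact: avg_meas mf fK.
- exact: avg_meas mf' f'K.
- by move=> x; exact: avg_le.
- by move=> x; exact: avg_le.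
move=> x z; rewrite (avg_rem x z hf).
by apply: (@avg_le (fun y => rem f f' y z) _ x) => // ; exact: meas_rem2.
Qed.

Lemma avg_close K f f' x : C11 K f f' -> `|avg d f x - f x| <= 2 * K * d.
Proof.
move=> hf; have K0 := C11_ge0 hf; have hl := C11_lip hf; have [mf mf' fK f'K rK] := hf.
have i1 := avg_L1 x mf fK.
have -> : avg d f x - f x = d^-1 * I (fun y => one y * f (x + y) - f x * one y).
  rewrite (RintB i1 (L1Z _ one_L1)) (RintZ _ one_L1) Rint_one /avg.
  by field; rewrite gt_eqF.
rewrite normrM gtr0_norm ?invr_gt0// mulrC ler_pdivrMr//.
rewrite -[X in _ <= _ * X]Rint_one -(RintZ _ one_L1).
apply: Rint_normle; [exact: L1B i1 (L1Z _ one_L1)|exact: L1Z one_L1|].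
move=> y; have -> : one y * f (x + y) - f x * one y = (f (x + y) - f x) * one y by ring.
have /andP[h1 h2] := one_le1 y.
rewrite normrM (ger0_norm h1) /one indicE.
case: (boolP (y \in _)) => yI; last by rewrite !mulr0.
rewrite !mulr1; move: yI; rewrite inE/= in_itv/= => /andP[y1 y2].
apply: le_trans (hl x y) _; rewrite (gtr0_norm y1); apply: ler_wpM2l => //.
by rewrite mulr_ge0.
Qed.

(** All translates of [|f|] have the same integral, and the averaging kernel has mass 1. *)
Lemma avg_int_le f K : L1 f -> (forall x, `|f x| <= K) ->
  L1 (avg d f) /\ I (fun x => `|avg d f x|) <= I (fun x => `|f x|).
Proof.
move=> iF fK; have mf := L1_meas iF; have ia := L1_abs iF.
have aK x : `| `|f x| | <= K by rewrite normr_id.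
have ma := L1_meas ia.
pose F (x y : R) := one y * `|f (x + y)|.
have Fx x : L1 (F x) by exact: (avg_L1 x ma aK).
have Fy y : L1 (F ^~ y) by apply: L1Z; exact: L1_shift y ia.
have F0 x y : 0 <= F x y by have /andP[h1 h2] := one_le1 y; rewrite /F mulr_ge0.
have Iy y : I (F ^~ y) = I (fun x => `|f x|) * one y.
  by rewrite /F (RintZ _ (L1_shift y ia)) (Rint_shift y ia) mulrC.
have [H1 H2 H3] : [/\ L1 (fun x => I (F x)), L1 (fun y => I (F ^~ y)) &
      I (fun x => I (F x)) = I (fun y => I (F ^~ y))].
  apply: (@Rfubini F (fun y => I (fun x => `|f x|) * one y) _ Fx Fy).
  - by apply: measurable_funM; [apply: meas2_snd; exact: L1_meas one_L1|exact: (meas2_add ma)].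
  - exact: L1Z one_L1.
  - move=> y; rewrite -Iy le_eqVlt; apply/orP; left; apply/eqP.
    by apply: Rint_eq => x; rewrite ger0_norm.
have le1 x : `|avg d f x| <= d^-1 * I (F x).
  rewrite /avg normrM gtr0_norm ?invr_gt0//; apply: ler_wpM2l; first by rewrite invr_ge0 ltW.
  apply: Rint_normle; [exact: (avg_L1 x mf fK)|exact: Fx|].
  by move=> y; have /andP[h1 h2] := one_le1 y; rewrite normrM (ger0_norm h1).
have iA : L1 (avg d f) by apply: (L1_dom (avg_meas mf fK) (L1Z d^-1 H1)).
split=> //.
apply: le_trans (Rint_le (L1_abs iA) (L1Z d^-1 H1) le1) _.
rewrite (RintZ _ H1) H3 (Rint_eq Iy) (RintZ _ one_L1) Rint_one.
by rewrite mulrCA mulVf ?mulr1// gt_eqF.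
Qed.

Variable al : R.
Hypothesis hal : 1 < al < 2.

(** Averaging acts in [y], the operator in [z], and Fubini exchanges them. *)
Lemma avg_Lop K f f' x : C11 K f f' ->
  Lop al (avg d f) (avg d f') x = avg d (Lop al f f') x.
Proof.
move=> hf; have K0 := C11_ge0 hf; have lf := C11_m2 hf; have [mf mf' fK f'K rK] := hf.
pose F (y z : R) := one y * (rem f f' (x + y) z * qk al z).
have Fx y : L1 (F y) by exact: L1Z (Lop_L1 hal (x + y) hf).
have Gz z : L1 (fun y => one y * rem f f' (x + y) z).
  apply: (@avg_L1 (fun y => rem f f' y z)); first exact: meas_rem2.
  by move=> y; exact: rK.
have Fz z : L1 (F ^~ z).
  have -> : F ^~ z = (fun y => one y * rem f f' (x + y) z * qk al z) by apply/funext => y; rewrite /F mulrA.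
  exact: L1Zr (Gz z).
have [H1 H2 H3] : [/\ L1 (fun y => I (F y)), L1 (fun z => I (F ^~ z)) &
      I (fun y => I (F y)) = I (fun z => I (F ^~ z))].
  apply: (@Rfubini F (fun z => 3 * K * d * (m2 z * qk al z)) _ Fx Fz).
  - apply: measurable_funM; first by apply: meas2_fst; exact: L1_meas one_L1.
    apply: measurable_funM; last by apply: meas2_snd; exact: meas_qk.
    have := @meas2_rem (fun y => f (x + y)) (fun y => f' (x + y)).
    have -> : (fun p : mR2 => rem (fun y => f (x + y)) (fun y => f' (x + y)) p.1 p.2) =
      (fun p : mR2 => rem f f' (x + p.1) p.2) by apply/funext => p; rewrite /rem addrA.
    by apply; under eq_fun do rewrite addrC; exact: meas_comp_shift.
  - exact: L1Z (L1_rho hal).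
  - move=> z; rewrite [leRHS](_ : _ = I (fun y => (3 * K * (m2 z * qk al z)) * one y)); last first.
      by rewrite (RintZ _ one_L1) Rint_one; ring.
    apply: Rint_le; [exact: L1_abs (Fz z)|exact: L1Z one_L1|].
    move=> y; have /andP[h1 h2] := one_le1 y.
    rewrite /F !normrM (ger0_norm h1) (ger0_norm (qk_ge0 al z)) mulrC.
    apply: ler_wpM2r => //; rewrite mulrA; apply: ler_wpM2r; first exact: qk_ge0.
    exact: lf.
rewrite /Lop /avg.
transitivity (I (fun z => d^-1 * I (F ^~ z))).
  apply: Rint_eq => z; rewrite (avg_rem x z hf) -mulrA; congr (_ * _).
  by rewrite mulrC -(RintZ _ (Gz z)); apply: Rint_eq => y; rewrite /F; ring.
rewrite (RintZ _ H2) -H3; congr (_ * _); apply: Rint_eq => y.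
by rewrite /F (RintZ _ (Lop_L1 hal (x + y) hf)).
Qed.

End Avg.

(** On [[s1, 2 s1]] the singular forcing, taken at the left end, contributes [E2 s1^(1 - th)]. Over
    [s1 = s / 2^n] with [n >= 1] this is a geometric series of ratio [2^(th - 1) < 1]. *)
Lemma dyadic (J : R -> R) (E1 E2 th s L : R) : 0 < th < 1 -> 0 <= E1 -> 0 <= E2 -> 0 < s ->
  (forall s1 s2 : R, 0 < s1 -> s1 < s2 -> s2 <= s -> J s2 <= J s1 + (s2 - s1) * (E1 + E2 * s1 `^ (- th))) ->
  J (s / 2 ^+ n) @[n --> \oo] --> L ->
  J s <= L + s * E1 + E2 * s `^ (1 - th) * (2^-1 `^ (1 - th) / (1 - 2^-1 `^ (1 - th))).
Proof.
move=> /andP[th0 th1] E10 E20 s0 H HL.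
have [rho rhoE] : exists rho, rho = 2^-1 `^ (1 - th) :> R by eexists.
have rho0 : 0 < rho by rewrite rhoE powR_gt0.
have rho1 : rho < 1.
  rewrite rhoE -[ltRHS](_ : 1 `^ (1 - th) = 1); last by rewrite powR1.
  by apply: gt0_ltr_powR; rewrite ?subr_gt0// ?nnegrE// invf_lt1// ltr1n.
rewrite -rhoE; have [D DE] : exists D, D = E2 * s `^ (1 - th) by eexists.
have D0 : 0 <= D by rewrite DE mulr_ge0// powR_ge0.
have r10 : 1 - rho != 0 by rewrite subr_eq0 gt_eqF.
have key n : J s <= J (s / 2 ^+ n) + s * E1 * (1 - 2 ^- n) + D * (rho / (1 - rho)) * (1 - rho ^+ n).
  elim: n => [|n IH]; first by rewrite !expr0 invr1 !subrr !mulr0 mulr1 !addr0.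
  apply: le_trans IH _.
  have e0 : 0 < 2 ^+ n :> R by rewrite exprn_gt0.
  have [s1 s1E] : exists s1, s1 = s / 2 ^+ n.+1 by eexists.
  have s2E : s / 2 ^+ n = 2 * s1 by rewrite s1E exprS; field; rewrite gt_eqF.
  have s10 : 0 < s1 by rewrite s1E divr_gt0// exprn_gt0.
  have lt12 : s1 < 2 * s1 by lra.
  have s2s : 2 * s1 <= s.
    rewrite -s2E ler_pdivrMr// ler_peMr ?(ltW s0)// exprn_ege1// ler1n.
    done.
  have := H s1 (2 * s1) s10 lt12 s2s; rewrite -s1E s2E.
  have P : s1 * (E2 * s1 `^ (- th)) = D * rho ^+ n.+1.
    have -> : s1 * (E2 * s1 `^ (- th)) = E2 * (s1 `^ 1 * s1 `^ (- th)) by rewrite powRr1 ?(ltW s10)//; ring.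
    rewrite -powRD; last by apply/implyP => _; rewrite gt_eqF.
    rewrite DE rhoE -mulrA s1E -exprVn powRM ?(ltW s0)// ?exprn_ge0//.
    have b0 : 0 <= 2^-1 :> R by [].
    rewrite -(powR_mulrn n.+1 b0) -powRrM (mulrC n.+1%:R) powRrM (powR_mulrn n.+1 (powR_ge0 _ _)).
    by ring.
  have -> : 2 * s1 - s1 = s1 by ring.
  rewrite mulrDr P => h.
  have E3 : s * E1 * (1 - 2 ^- n.+1) = s * E1 * (1 - 2 ^- n) + s1 * E1.
    by rewrite s1E exprS; field; rewrite gt_eqF.
  have E4 : D * (rho / (1 - rho)) * (1 - rho ^+ n.+1) =
     D * (rho / (1 - rho)) * (1 - rho ^+ n) + D * rho ^+ n.+1.
    by rewrite exprS; field.
  by rewrite E3 E4; lra.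
rewrite -subr_le0; apply: (@le0_of_linear _ 1) => e e0 _.
move/cvgrPdist_le : HL => /(_ e e0) /filter_ex[n hn].
have k := key n.
have a1 : s * E1 * (1 - 2 ^- n) <= s * E1.
  apply: ler_piMr; first by rewrite mulr_ge0// ltW.
  by rewrite gerBl invr_ge0 exprn_ge0.
have a2 : D * (rho / (1 - rho)) * (1 - rho ^+ n) <= D * (rho / (1 - rho)).
  apply: ler_piMr; first by rewrite mulr_ge0// divr_ge0 ?subr_ge0 ?(ltW rho0)// ltW.
  by rewrite gerBl exprn_ge0// ltW.
have := ler_norm (- (L - J (s / 2 ^+ n))); rewrite normrN -DE; lra.
Qed.

(** * Common bounds for a pair of solutions *)

Section TwoSolutions.

Lemma strip_regB K1 K2 a T (u ux ut v vx vt : R -> R -> R) :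
  strip_reg K1 a T u ux ut -> strip_reg K2 a T v vx vt ->
  strip_reg (K1 + K2) a T (fun x t => u x t - v x t) (fun x t => ux x t - vx x t)
    (fun x t => ut x t - vt x t).
Proof.
move=> [a1 a2 a3 a4 a5] [b1 b2 b3 b4 b5]; split.
- by move=> t ht; exact: C11B (a1 t ht) (b1 t ht).
- move=> x t t' ht ht'.
  rewrite (_ : u x t' - v x t' - (u x t - v x t) - (t' - t) * (ut x t - vt x t) =
    (u x t' - u x t - (t' - t) * ut x t) - (v x t' - v x t - (t' - t) * vt x t)); last by ring.
  rewrite [leRHS]mulrDl; by apply: le_trans (ler_normB _ _) (lerD (a2 _ _ _ ht ht') (b2 _ _ _ ht ht')).
- by move=> x t ht; apply: le_trans (ler_normB _ _) (lerD (a3 _ _ ht) (b3 _ _ ht)).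
- by move=> t ht; exact: measurable_funB (a4 t ht) (b4 t ht).
- move=> x t t' ht ht'.
  rewrite (_ : ux x t' - vx x t' - (ux x t - vx x t) = (ux x t' - ux x t) - (vx x t' - vx x t)); last by ring.
  rewrite [leRHS]mulrDl; by apply: le_trans (ler_normB _ _) (lerD (a5 _ _ _ ht ht') (b5 _ _ _ ht ht')).
Qed.

Lemma strip_regW K1 K2 a T (u ux ut : R -> R -> R) : K1 <= K2 ->
  strip_reg K1 a T u ux ut -> strip_reg K2 a T u ux ut.
Proof.
move=> K12 [a1 a2 a3 a4 a5]; split=> //.
- by move=> t ht; exact: C11W K12 (a1 t ht).
- by move=> x t t' ht ht'; apply: le_trans (a2 _ _ _ ht ht') _; rewrite ler_wpM2r ?sqr_ge0.
- by move=> x t ht; apply: le_trans (a3 _ _ ht) _.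
- by move=> x t t' ht ht'; apply: le_trans (a5 _ _ _ ht ht') _; rewrite ler_wpM2r.
Qed.

Lemma avg_lin3 (d h K1 K2 K3 x : R) (f g k : R -> R) :
  meas f -> (forall x, `|f x| <= K1) -> meas g -> (forall x, `|g x| <= K2) ->
  meas k -> (forall x, `|k x| <= K3) ->
  avg d (fun x => f x - g x - h * k x) x = avg d f x - avg d g x - h * avg d k x.
Proof.
move=> mf fK mg gK mk kK.
have mfg : meas (fun x => f x - g x) by exact: measurable_funB.
have bfg y : `|f y - g y| <= K1 + K2 by apply: le_trans (ler_normB _ _) (lerD _ _).
have mhk : meas (fun x => h * k x) by exact: measurable_funM.
have bhk y : `|h * k y| <= `|h| * K3 by rewrite normrM ler_wpM2l.
by rewrite (avgB d x mfg bfg mhk bhk) (avgB d x mf fK mg gK) (avgZ d h x mk kK).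
Qed.

Variable al : R.
Hypothesis hal : 1 < al < 2.
Variables (u0 v0 : R -> R) (u ux ut v vx vt : R -> R -> R).
Hypotheses (hu : regsol al u0 u ux ut) (hv : regsol al v0 v vx vt).

Lemma pair_reg a T : 0 < a < T -> exists K, [/\ 0 <= K, strip_reg K a T u ux ut,
  strip_reg K a T v vx vt & forall t, a < t < T -> forall x, [/\ `|u x t| <= K, `|ux x t| <= K, `|v x t| <= K & `|vx x t| <= K]].
Proof.
move=> aT; have [K1 r1] := rs_reg hu aT; have [K2 r2] := rs_reg hv aT.
have aT' : a < (a + T) / 2 < T by move/andP: aT => [? ?]; apply/andP; split; lra.
have k1 : 0 <= K1 := C11_ge0 (sr_C11 r1 aT').
have k2 : 0 <= K2 := C11_ge0 (sr_C11 r2 aT').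
have q1 : strip_reg (K1 + K2) a T u ux ut by apply: strip_regW r1; rewrite lerDl.
have q2 : strip_reg (K1 + K2) a T v vx vt by apply: strip_regW r2; rewrite lerDr.
exists (K1 + K2); split=> //; first exact: addr_ge0.
by move=> t ht x; have [_ _ h1 h2 _] := sr_C11 q1 ht; have [_ _ h3 h4 _] := sr_C11 q2 ht.
Qed.

Lemma pair_bound T : 0 < T -> exists2 M, 1 <= M &
  forall x t : R, 0 < t < T -> `|u x t| <= M /\ `|v x t| <= M.
Proof.
move=> T0; have [M1 m1 h1] := rs_bound hu T0; have [M2 m2 h2] := rs_bound hv T0.
exists (M1 + M2); first lra.
by move=> x t ht; split; [apply: le_trans (h1 x t ht) _|apply: le_trans (h2 x t ht) _]; lra.
Qed.

Lemma pair_grad : exists2 Cg, 0 <= Cg & forall x t : R, 0 < t -> t <= 1 ->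
  `|ux x t| <= Cg * t `^ (- al^-1) /\ `|vx x t| <= Cg * t `^ (- al^-1).
Proof.
have [C1 c1 h1] := rs_grad hu; have [C2 c2 h2] := rs_grad hv.
exists (C1 + C2); first exact: addr_ge0.
move=> x t t0 t1; split; [apply: le_trans (h1 x t t0 t1) _|apply: le_trans (h2 x t t0 t1) _];
  by apply: ler_wpM2r; rewrite ?powR_ge0// ?lerDl ?lerDr.
Qed.

Lemma diff_weak (ph : R -> R) : L1 ph ->
  (fun t => I (fun x => (u x t - v x t) * ph x)) @ 0^'+ --> I (fun x => (u0 x - v0 x) * ph x).
Proof.
move=> iph; have [mu0 [B1 bu0]] := rs_u0 hu; have [mv0 [B2 bv0]] := rs_u0 hv.
have -> : I (fun x => (u0 x - v0 x) * ph x) = I (fun x => u0 x * ph x) - I (fun x => v0 x * ph x).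
  rewrite -RintB; [|exact: L1_mulb bu0 iph|exact: L1_mulb bv0 iph].
  by apply: Rint_eq => x; rewrite mulrBl.
have H : (fun t => I (fun x => u x t * ph x) - I (fun x => v x t * ph x)) @ 0^'+ -->
  I (fun x => u0 x * ph x) - I (fun x => v0 x * ph x).
  exact: cvgB (rs_weak hu iph) (rs_weak hv iph).
move: H; apply: cvg_trans; apply: near_eq_cvg.
near=> t; have t0 : 0 < t by near: t; exact: nbhs_right_gt.
have t2 : 0 < t / 2 < t + 1 by apply/andP; split; lra.
have ht : t / 2 < t < t + 1 by apply/andP; split; lra.
have [K [_ r1 r2 _]] := pair_reg t2.
have [m1 _ b1 _ _] := sr_C11 r1 ht; have [m3 _ b3 _ _] := sr_C11 r2 ht.
rewrite /= -[LHS]RintB; [|exact: L1_mulb b1 iph|exact: L1_mulb b3 iph].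
by apply: Rint_eq => x; rewrite mulrBl.
Unshelve. all: try end_near.
Qed.

Lemma halving_cvg (s : R) : 0 < s -> s / 2 ^+ n @[n --> \oo] --> 0^'+.
Proof.
move=> s0.
have H : s / 2 ^+ n @[n --> \oo] --> (0 : R).
  have -> : (0 : R) = s * 0 by rewrite mulr0.
  apply: cvgMl_tmp; under eq_fun do rewrite -exprVn.
  by apply: cvg_expr; rewrite ger0_norm// invf_lt1// ltr1n.
move=> P hP; have hn : \forall n \near \oo, 0 < s / 2 ^+ n -> P (s / 2 ^+ n) := H _ hP.
apply: (@filterS _ \oo _ _ _ _ hn) => n; apply.
by apply: divr_gt0 => //; exact: exprn_gt0.
Qed.

End TwoSolutions.

(** * Kato's inequality for space averages *)

Section AveragedKato.
Variable al : R.
Hypothesis hal : 1 < al < 2.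
Local Notation Lop := (Lop al).
Variables (u0 v0 : R -> R) (u ux ut v vx vt : R -> R -> R).
Hypotheses (hu : regsol al u0 u ux ut) (hv : regsol al v0 v vx vt).

(* The convective term is treated as a forcing here, bounded through the gradient estimate. *)
Lemma avg_kato (M Cg d r s1 s2 : R) : 1 <= M -> 0 <= Cg ->
  (forall x t : R, 0 < t < 2 -> `|u x t| <= M /\ `|v x t| <= M) ->
  (forall x t : R, 0 < t -> t <= 1 ->
    `|ux x t| <= Cg * t `^ (- al^-1) /\ `|vx x t| <= Cg * t `^ (- al^-1)) ->
  0 < d -> 1 <= r -> 0 < s1 -> s1 < s2 -> s2 <= 1 ->
  I (fun x => `|avg d (fun y => u y s2 - v y s2) x| * phi r x) <=
  I (fun x => `|avg d (fun y => u y s1 - v y s1) x| * phi r x) +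
    (s2 - s1) * (Calpha al * (2 * M * lam al r) + 2 * M * Cg * I (phi r) * s1 `^ (- al^-1)).
Proof.
move=> M1 Cg0 hM hC d0 r1 s10 s12 s21.
have r0 : 0 < r by lra.
have al0 : 0 < al by move/andP: hal => [? ?]; lra.
have c0 : 0 < Calpha al := Calpha_gt0 hal.
have ip := L1_phi r0.
have I0 : 0 <= I (phi r) by apply: Rint_ge0 => x; exact/ltW/phi_gt0.
have aT : 0 < s1 / 2 < 2 by apply/andP; split; lra.
have [K [K0 ru rv hK]] := pair_reg hu hv aT.
have rw := strip_regB ru rv.
pose N t x := u x t * ux x t - v x t * vx x t.
have tin tau : s1 <= tau <= s2 -> s1 / 2 < tau < 2 by move=> /andP[? ?]; apply/andP; split; lra.
have mN tau : s1 <= tau <= s2 -> meas (N tau).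
  move=> /tin h; have [a1 a2 _ _ _] := sr_C11 ru h; have [b1 b2 _ _ _] := sr_C11 rv h.
  by apply: measurable_funB; apply: measurable_funM.
have bN tau x : s1 <= tau <= s2 -> `|N tau x| <= 2 * K * K.
  move=> /tin h; have [a1 a2 a3 a4] := hK _ h x.
  apply: le_trans (ler_normB _ _) _; rewrite !normrM.
  have := ler_pM (normr_ge0 _) (normr_ge0 _) a1 a2.
  have := ler_pM (normr_ge0 _) (normr_ge0 _) a3 a4; lra.
have sN tau x : s1 <= tau <= s2 -> `|N tau x| <= 2 * M * Cg * s1 `^ (- al^-1).
  move=> /andP[h1 h2].
  have t02 : 0 < tau < 2 by apply/andP; split; lra.
  have t0 : 0 < tau by lra.
  have t1 : tau <= 1 by lra.
  have [a1 a3] := hM x tau t02; have [a2 a4] := hC x tau t0 t1.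
  (* The power decreases in time, so its value at [s1] serves for the whole step. *)
  have dec : tau `^ (- al^-1) <= s1 `^ (- al^-1).
    rewrite !powRN lef_pV2 ?posrE ?powR_gt0//.
    by apply: ge0_ler_powR => //; rewrite ?nnegrE ?invr_ge0; apply: ltW.
  apply: le_trans (ler_normB _ _) _; rewrite !normrM.
  have := ler_pM (normr_ge0 _) (normr_ge0 _) a1 a2.
  have := ler_pM (normr_ge0 _) (normr_ge0 _) a3 a4.
  have M0 : 0 <= M by lra.
  have := ler_wpM2l (mulr_ge0 (mulr_ge0 (ler0n R 2) M0) Cg0) dec.
  lra.
apply: (@kato al hal _ _ _ _ (weight_phi r1) s1 s2 (Calpha al) (2 * K + 2 * K * K) _
   (fun t => avg d (fun y => u y t - v y t)) (fun t => avg d (fun y => ux y t - vx y t))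
   (fun _ _ => 0) (fun _ _ => 0) (fun t x => - avg d (N t) x)
   (fun t => avg d (fun y => ut y t - vt y t))).
- exact: ltW.
- exact: ltW.
- move=> tau /tin h; apply: C11W (avg_C11 d0 (sr_C11 rw h)).
  by have := mulr_ge0 K0 K0; lra.
- move=> tau _; apply: C11W (C11_cst 0); rewrite normr0.
  by have := mulr_ge0 K0 K0; lra.
- move=> tau h; split; first by apply: measurableT_comp => //; exact: (avg_meas d0 (mN _ h) (bN tau ^~ h)).
  move=> x; rewrite normrN; apply: le_trans (avg_le d0 x (mN _ h) (bN tau ^~ h)) _; lra.
- move=> tau x h; have h' := tin _ h.
  have t0 : 0 < tau by move/andP: h => [? ?]; lra.
  rewrite (avg_Lop d0 hal x (sr_C11 rw h')) !mul0r addr0 subr0.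
  pose g y := Lop (fun y => u y tau - v y tau) (fun y => ux y tau - vx y tau) y.
  have gE y : Calpha al * g y = (ut y tau - vt y tau) + N tau y.
    rewrite /g (LopB hal y (sr_C11 ru h') (sr_C11 rv h')).
    by rewrite (rs_eq hu y t0) (rs_eq hv y t0) /N; ring.
  (* Measurability of the nonlocal term is taken from the equation, whose other terms are
     measurable. *)
  have mg : meas g.
    have -> : g = (fun y => (Calpha al)^-1 * ((ut y tau - vt y tau) + N tau y)).
      by apply/funext => y; rewrite -gE mulrA mulVf ?mul1r// gt_eqF.
    by apply: measurable_funM => //; apply: measurable_funD; [exact: (sr_utm rw h')|exact: mN].
  have bg y := Lop_bound hal y (sr_C11 rw h').
  rewrite -(avgZ d (Calpha al) x mg bg).
  have mcg : meas (fun y => Calpha al * g y) by exact: measurable_funM.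
  have bcg y : `|Calpha al * g y| <= Calpha al * (3 * (K + K) * I (fun z => m2 z * qk al z)).
    by rewrite normrM gtr0_norm//; apply: ler_wpM2l; [exact: ltW|exact: bg].
  rewrite -(avgB d x mcg bcg (mN _ h) (bN tau ^~ h)).
  by congr (avg d _ x); apply/funext => y; rewrite gE addrK.
- move=> tau x /tin h.
  apply: le_trans (avg_le d0 x (sr_utm rw h) (fun y => sr_ut rw y h)) _.
  by have := mulr_ge0 K0 K0; lra.
- move=> tau h x h1 h2 h3.
  have t1 : s1 / 2 < tau < 2 by apply/andP; split; lra.
  have t2 : s1 / 2 < tau + h < 2 by apply/andP; split; lra.
  have [m1 _ b1 _ _] := sr_C11 rw t1; have [m3 _ b3 _ _] := sr_C11 rw t2.
  rewrite -(avg_lin3 d h x m3 b3 m1 b1 (sr_utm rw t1) (fun y => sr_ut rw y t1)).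
  apply: (@le_trans _ _ ((K + K) * h ^+ 2)).
    apply: avg_le => //.
      apply: measurable_funB; [exact: measurable_funB|apply: measurable_funM => //; exact: (sr_utm rw t1)].
    by move=> y; have := sr_t rw y t1 t2; rewrite (_ : tau + h - tau = h)//; ring.
  by apply: ler_wpM2r; [exact: sqr_ge0|have := mulr_ge0 K0 K0; lra].
move=> tau h; have h' := tin _ h.
rewrite (_ : I (fun x => _ * `|0| * _) = 0); last first.
  by rewrite -[RHS](mul0r (I (phi r))) -(RintZ 0 ip); apply: Rint_eq => x; rewrite normr0 mulr0 !mul0r.
rewrite addr0; apply: lerD.
  apply: ler_wpM2l; first exact: ltW.
  have iL := L1_abs (Lopm_L1x hal (weight_phi r1)).
  have [m1 _ b1 _ _] := sr_C11 rw h'.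
  have bA x : `|avg d (fun y => u y tau - v y tau) x| <= 2 * M.
    apply: avg_le => // y.
    have t02 : 0 < tau < 2 by move/andP: h' => [? ?]; apply/andP; split; lra.
    have [a1 a2] := hM y tau t02; apply: le_trans (ler_normB _ _) _; lra.
  rewrite /lam -(RintZ _ iL).
  apply: Rint_le; [|exact: L1Z|by move=> x; apply: ler_wpM2r].
  apply: (L1_mulb _ _ iL (K := 2 * M)); last by move=> x; rewrite normr_id.
  by apply: meas_norm; exact: avg_meas b1.
have mf := avg_meas d0 (mN _ h) (bN tau ^~ h).
have bf x := avg_le d0 x (mN _ h) (sN tau ^~ h).
rewrite [leRHS]mulrAC -(RintZ _ ip).
apply: Rint_le; [|exact: L1Z|].
  apply: (L1_mulb _ _ ip (K := 2 * M * Cg * s1 `^ (- al^-1))).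
    by apply: meas_norm; apply: measurableT_comp.
  by move=> x; rewrite normr_id normrN.
by move=> x; rewrite normrN; apply: ler_wpM2r; [exact/ltW/phi_gt0|exact: bf].
Qed.

End AveragedKato.

(** * The weighted norm of the difference near time zero *)

Section InitialLayer.

Lemma avg_shiftE (d K x : R) (f : R -> R) : meas f -> (forall x, `|f x| <= K) ->
  avg d f x = d^-1 * I (fun y => f y * \1_`]0, d] (y - x)).
Proof.
move=> mf fK; rewrite /avg; congr (_ * _).
have i : L1 (fun y => f y * \1_`]0, d] (y - x)).
  by apply: (L1_mulb mf fK); exact: L1_shift (L1_indic 0 d).
rewrite -(Rint_shift x i); apply: Rint_eq => y.
by rewrite addrK mulrC [x + y]addrC.
Qed.

Lemma phi_cvg1 (x : R) : phi n.+1%:R x @[n --> \oo] --> (1 : R).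
Proof.
have H : x * n.+1%:R^-1 @[n --> \oo] --> (0 : R).
  by rewrite -[X in _ --> X](mulr0 x); apply: cvgMl_tmp; exact: cvg_harmonic.
have H2 : 1 + (x * n.+1%:R^-1) * (x * n.+1%:R^-1) @[n --> \oo] --> (1 + 0 * 0 : R).
  by apply: cvgD; [exact: cvg_cst|exact: (cvgM H H)].
have n1 : 1 + 0 * 0 != 0 :> R by rewrite mul0r addr0 oner_eq0.
have H3 : (1 + (x * n.+1%:R^-1) * (x * n.+1%:R^-1))^-1 @[n --> \oo] --> ((1 + 0 * 0)^-1 : R).
  exact: (cvgV n1 H2).
move: H3; rewrite mul0r addr0 invr1; apply: cvg_trans.
by apply: near_eq_cvg; apply: nearW => n; rewrite /phi -expr2.
Qed.

Lemma L1_of_le (f : R -> R) (V : R) : meas f -> (\int[mu]_x `|(f x)|%:E <= V%:E)%E ->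
  L1 f /\ I (fun x => `|f x|) <= V.
Proof.
move=> mf h; have iF : L1 f.
  split; apply/integrableP; split; first exact/measurable_EFinP.
  by apply: le_lt_trans (ltry V); rewrite /=.
by split=> //; rewrite -lee_fin -RintE//; exact: L1_abs.
Qed.

(** Supplies a time at which the initial-layer error [s^(1 - 1/al)] equals a prescribed [h]. *)
Lemma powR_root (a h : R) : 0 < a <= 1 -> 0 < h <= 1 ->
  [/\ 0 < h `^ a^-1, h `^ a^-1 <= h & (h `^ a^-1) `^ a = h].
Proof.
move=> /andP[a0 a1] /andP[h0 h1]; split; first by rewrite powR_gt0.
  rewrite -[leRHS]powRr1 ?(ltW h0)//; apply: ger_powR; first by rewrite h0.
  by rewrite -invr1 lef_pV2 ?posrE.
by rewrite -powRrM mulVf ?gt_eqF// powRr1// ltW.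
Qed.

Variable al : R.
Hypothesis hal : 1 < al < 2.
Variables (u0 v0 : R -> R) (u ux ut v vx vt : R -> R -> R).
Hypotheses (hu : regsol al u0 u ux ut) (hv : regsol al v0 v vx vt).
Hypothesis hL : L1 (fun x => u0 x - v0 x).
Let V := I (fun x => `|u0 x - v0 x|).

Lemma sol_C11 t : 0 < t -> exists K, C11 K (fun x => u x t - v x t) (fun x => ux x t - vx x t).
Proof.
move=> t0; have t2 : 0 < t / 2 < t + 1 by apply/andP; split; lra.
have ht : t / 2 < t < t + 1 by apply/andP; split; lra.
have [K [_ ru rv _]] := pair_reg hu hv t2.
by exists (K + K); exact: (sr_C11 (strip_regB ru rv) ht).
Qed.

Lemma avg_init_cvg (d s x : R) : 0 < d -> 0 < s ->
  avg d (fun y => u y (s / 2 ^+ n) - v y (s / 2 ^+ n)) x @[n --> \oo] -->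
  avg d (fun y => u0 y - v0 y) x.
Proof.
move=> d0 s0; have [mu0 [B1 bu0]] := rs_u0 hu; have [mv0 [B2 bv0]] := rs_u0 hv.
have b0 y : `|u0 y - v0 y| <= B1 + B2 by apply: le_trans (ler_normB _ _) (lerD _ _).
rewrite (avg_shiftE d x (measurable_funB mu0 mv0) b0).
have e n : avg d (fun y => u y (s / 2 ^+ n) - v y (s / 2 ^+ n)) x =
    d^-1 * I (fun y => (u y (s / 2 ^+ n) - v y (s / 2 ^+ n)) * \1_`]0, d] (y - x)).
  have sn : 0 < s / 2 ^+ n by apply: divr_gt0 => //; exact: exprn_gt0.
  by have [K [m1 _ b1 _ _]] := sol_C11 sn; exact: (avg_shiftE d x m1 b1).
rewrite (eq_cvg _ _ e); apply: cvgMl_tmp.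
have H := diff_weak hu hv (L1_shift (- x) (L1_indic 0 d)).
exact: (cvg_comp _ _ (halving_cvg s0) H).
Qed.

(** Two limits in a fixed order. At fixed [d] the starting time tends to 0 and the averaged initial
    norm is at most [V] by [avg_int_le]. Then [d] tends to 0 at the fixed positive time [s], where
    the difference is Lipschitz. [E] depends on [r], but on neither [d] nor [s]. *)
Lemma initial_layer r : 1 <= r -> exists2 E, 0 <= E & forall s : R, 0 < s -> s <= 1 ->
  I (fun x => `|u x s - v x s| * phi r x) <= V + E * (s + s `^ (1 - al^-1)).
Proof.
move=> r1; have r0 : 0 < r by lra.
have al0 : 0 < al by move/andP: hal => [? ?]; lra.
have th : 0 < al^-1 < 1 by rewrite invr_gt0 al0 invf_lt1//; move/andP: hal => [].
have [M M1 hM] := pair_bound hu hv (ltr0n R 2).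
have [Cg Cg0 hC] := pair_grad hu hv.
have ip := L1_phi r0.
have I0 : 0 <= I (phi r) by apply: Rint_ge0 => x; exact/ltW/phi_gt0.
have M0 : 0 <= M by lra.
have c0 : 0 <= Calpha al := ltW (Calpha_gt0 hal).
have [E1 E1E] : exists E1 : R, E1 = Calpha al * (2 * M * lam al r) by eexists.
have [E2 E2E] : exists E2 : R, E2 = 2 * M * Cg * I (phi r) by eexists.
have E10 : 0 <= E1.
  rewrite E1E; apply: mulr_ge0 => //; apply: mulr_ge0; [exact: mulr_ge0|exact: lam_ge0].
have E20 : 0 <= E2.
  by rewrite E2E; apply: mulr_ge0 => //; apply: mulr_ge0 => //; exact: mulr_ge0.
pose rho : R := 2^-1 `^ (1 - al^-1) / (1 - 2^-1 `^ (1 - al^-1)).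
have rho0 : 0 <= rho.
  apply: divr_ge0; first exact: powR_ge0.
  rewrite subr_ge0 -[leRHS](_ : 1 `^ (1 - al^-1) = 1); last by rewrite powR1.
  apply: ge0_ler_powR; rewrite ?nnegrE//.
  by move/andP: th => [? ?]; lra.
  by rewrite invf_le1// ler1n.
exists (E1 + E2 * rho); first by apply: addr_ge0 => //; exact: mulr_ge0.
move=> s s0 s1; have [K hK] := sol_C11 s0.
have K0 := C11_ge0 hK.
rewrite -subr_le0; apply: (@le0_of_linear _ (2 * K * I (phi r))) => d d0 d1.
have D : I (fun x => `|avg d (fun y => u y s - v y s) x| * phi r x) <=
   V + s * E1 + E2 * s `^ (1 - al^-1) * rho.
  have B n x : `|avg d (fun y => u y (s / 2 ^+ n) - v y (s / 2 ^+ n)) x| <= 2 * M.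
    have sn : 0 < s / 2 ^+ n by apply: divr_gt0 => //; exact: exprn_gt0.
    have [K' [m1 _ b1 _ _]] := sol_C11 sn.
    apply: avg_le => // y.
    have sn2 : s / 2 ^+ n <= 1.
      by rewrite ler_pdivrMr ?exprn_gt0// mul1r; apply: le_trans s1 _; rewrite exprn_ege1// ler1n.
    have t02 : 0 < s / 2 ^+ n < 2 by rewrite sn/=; apply: le_lt_trans sn2 _; rewrite ltr1n.
    have [a1 a2] := hM y _ t02; apply: le_trans (ler_normB _ _) _.
    by rewrite mulr_natl mulr2n; exact: lerD.
  have step s1' s2' : 0 < s1' -> s1' < s2' -> s2' <= s ->
      I (fun x => `|avg d (fun y => u y s2' - v y s2') x| * phi r x) <=
      I (fun x => `|avg d (fun y => u y s1' - v y s1') x| * phi r x) +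
        (s2' - s1') * (E1 + E2 * s1' `^ (- al^-1)).
    move=> h1 h2 h3; rewrite E1E E2E.
    exact: (avg_kato hal hu hv M1 Cg0 hM hC d0 r1 h1 h2 (le_trans h3 s1)).
  have [mu0 [B1 bu0]] := rs_u0 hu; have [mv0 [B2 bv0]] := rs_u0 hv.
  have b0 y : `|u0 y - v0 y| <= B1 + B2 by apply: le_trans (ler_normB _ _) (lerD _ _).
  have m0 := measurable_funB mu0 mv0.
  have lim : I (fun x => `|avg d (fun y => u y (s / 2 ^+ n) - v y (s / 2 ^+ n)) x| * phi r x) @[n --> \oo]
      --> I (fun x => `|avg d (fun y => u0 y - v0 y) x| * phi r x).
    apply: (@Rint_cvg _ _ (fun x => 2 * M * phi r x)).
    - move=> n; have sn : 0 < s / 2 ^+ n by apply: divr_gt0 => //; exact: exprn_gt0.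
      have [K' [m1 _ b1 _ _]] := sol_C11 sn.
      apply: measurable_funM; last exact: phi_meas.
      by apply: meas_norm; exact: avg_meas b1.
    - exact: L1Z.
    - move=> n x; rewrite normrM normr_id (gtr0_norm (phi_gt0 r x)).
      by apply: ler_wpM2r; [exact/ltW/phi_gt0|exact: B].
    - by move=> x; apply: cvgMr_tmp; apply: cvg_norm; exact: avg_init_cvg.
  apply: le_trans (dyadic th E10 E20 s0 step lim) _; rewrite -/rho lerD2r lerD2r.
  have [iA lA] := avg_int_le d0 hL b0.
  apply: le_trans lA; apply: Rint_le; [|exact: L1_abs|].
    have p1 x : `|phi r x| <= 1 by rewrite (gtr0_norm (phi_gt0 r x)) phi_le1.
    by under eq_fun do rewrite mulrC; exact: (L1_mulb (phi_meas r) p1 (L1_abs iA)).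
  by move=> x; apply: ler_piMr => //; exact: phi_le1.
have C : I (fun x => `|u x s - v x s| * phi r x) <=
    I (fun x => `|avg d (fun y => u y s - v y s) x| * phi r x) + 2 * K * I (phi r) * d.
  have hA := avg_C11 d0 hK; have [m1 _ b1 _ _] := hK; have [m2 _ b2 _ _] := hA.
  have i1 : L1 (fun x => `|u x s - v x s| * phi r x).
    by apply: (L1_mulb (meas_norm m1) _ ip (K := K)) => x; rewrite normr_id.
  have i2 : L1 (fun x => `|avg d (fun y => u y s - v y s) x| * phi r x).
    by apply: (L1_mulb (meas_norm m2) _ ip (K := K)) => x; rewrite normr_id.
  rewrite [leRHS](_ : _ = I (fun x => `|avg d (fun y => u y s - v y s) x| * phi r x + 2 * K * d * phi r x)); last first.
    by rewrite (RintD i2 (L1Z _ ip)) (RintZ _ ip); ring.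
  apply: Rint_le => //; first by apply: L1D => //; exact: L1Z.
  move=> x; rewrite -mulrDl; apply: ler_wpM2r; first exact/ltW/phi_gt0.
  have := avg_close d0 x hK; rewrite distrC => hc.
  have := ler_normD (avg d (fun y => u y s - v y s) x) (u x s - v x s - avg d (fun y => u y s - v y s) x).
  by rewrite addrC subrK; lra.
have e1 : 0 <= E1 * s `^ (1 - al^-1) by rewrite mulr_ge0// powR_ge0.
have e2 : 0 <= E2 * rho * s by apply: mulr_ge0; [exact: mulr_ge0|exact: ltW].
lra.
Qed.

End InitialLayer.

(** * Contraction in L^1 *)

Section Contraction.
Variable al : R.
Hypothesis hal : 1 < al < 2.
Local Notation Lopm := (Lopm al).
Variables (u0 v0 : R -> R) (u ux ut v vx vt : R -> R -> R).
Hypotheses (hu : regsol al u0 u ux ut) (hv : regsol al v0 v vx vt).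

(* u ux - v vx is the derivative of the product of w = u - v and b = (u + v) / 2. *)
Lemma kato_diff (Kw s t A : R) (om ch ch' : R -> R) : weight Kw om ch ch' -> 0 < s -> s <= t ->
  (forall tau, s <= tau <= t ->
     Calpha al * I (fun x => `|u x tau - v x tau| * `|Lopm ch ch' x|) +
     I (fun x => `|u x tau - v x tau| * `|2^-1 * (u x tau + v x tau)| * `|ch' x|) <= A) ->
  I (fun x => `|u x t - v x t| * ch x) <= I (fun x => `|u x s - v x s| * ch x) + (t - s) * A.
Proof.
move=> hw s0 st hA.
have aT : 0 < s / 2 < t + 1 by apply/andP; split; lra.
have [K [K0 ru rv hK]] := pair_reg hu hv aT.
have rw := strip_regB ru rv.
have tin tau : s <= tau <= t -> s / 2 < tau < t + 1 by move=> /andP[? ?]; apply/andP; split; lra.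
apply: (@kato al hal _ _ _ _ hw s t (Calpha al) (2 * K) A
   (fun t x => u x t - v x t) (fun t x => ux x t - vx x t)
   (fun t x => 2^-1 * (u x t + v x t)) (fun t x => 2^-1 * (ux x t + vx x t)) (fun t x => 0)
   (fun t x => ut x t - vt x t)).
- exact: st.
- exact/ltW/Calpha_gt0.
- by move=> tau /tin h; apply: C11W (sr_C11 rw h); lra.
- move=> tau /tin h; apply: C11W (C11Z 2^-1 (C11D (sr_C11 ru h) (sr_C11 rv h))).
  by rewrite ger0_norm//; lra.
- by move=> tau h; split=> // x; rewrite normr0 mulr_ge0.
- move=> tau x h; have h' := tin _ h; have t0 : 0 < tau by move/andP: h => [? ?]; lra.
  rewrite (LopB hal x (sr_C11 ru h') (sr_C11 rv h')) (rs_eq hu x t0) (rs_eq hv x t0).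
  by field.
- by move=> tau x /tin h; apply: le_trans (sr_ut rw x h) _; lra.
- move=> tau h x h1 h2 h3.
  have t1 : s / 2 < tau < t + 1 by apply/andP; split; lra.
  have t2 : s / 2 < tau + h < t + 1 by apply/andP; split; lra.
  have e : tau + h - tau = h by ring.
  have := sr_t rw x t1 t2; rewrite e => a; apply: le_trans a _.
  by apply: ler_wpM2r; [exact: sqr_ge0|lra].
move=> tau h; rewrite [X in _ + X](_ : _ = 0); first by rewrite addr0; exact: hA.
by rewrite -[RHS](mul0r (I om)) -(RintZ 0); [apply: Rint_eq => x; rewrite normr0 !mul0r|case: hw].
Qed.

Hypothesis hL : L1 (fun x => u0 x - v0 x).
Let V := I (fun x => `|u0 x - v0 x|).

Lemma diff_phi_L1 r t : 0 < r -> 0 < t -> L1 (fun x => `|u x t - v x t| * phi r x).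
Proof.
move=> r0 t0; have [K [m1 _ b1 _ _]] := sol_C11 hu hv t0.
by apply: (L1_mulb (meas_norm m1) _ (L1_phi r0) (K := K)) => x; rewrite normr_id.
Qed.

(** Convection costs [M / r] times the weighted norm itself. In place of Gronwall, the supremum [A]
    of the norm over [[s, t]] satisfies [A <= J s + t B + q A] with [q = t M / r], and the last term
    is absorbed. The time [s] then tends to 0 by [initial_layer]. *)
Lemma contraction_phi (M r t : R) : 1 <= M ->
  (forall x s : R, 0 < s < t + 1 -> `|u x s| <= M /\ `|v x s| <= M) -> 1 <= r -> 0 < t ->
  t * M / r <= 2^-1 ->
  (1 - t * M / r) * I (fun x => `|u x t - v x t| * phi r x) <=
    V + t * (Calpha al * (2 * M * lam al r)).
Proof.
move=> M1 hM r1 t0 q2; have r0 : 0 < r by lra.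
have M0 : 0 <= M by lra.
have [q qE] : exists q : R, q = t * M / r by eexists.
have [B BE] : exists B : R, B = Calpha al * (2 * M * lam al r) by eexists.
rewrite -qE -BE.
have ip := L1_phi r0.
have c0 : 0 <= Calpha al := ltW (Calpha_gt0 hal).
have B0 : 0 <= B by rewrite BE; apply: mulr_ge0 => //; apply: mulr_ge0; [exact: mulr_ge0|exact: lam_ge0].
have q0 : 0 <= q by rewrite qE; apply: divr_ge0; [apply: mulr_ge0 => //|]; exact: ltW.
pose J s := I (fun x => `|u x s - v x s| * phi r x).
have J0 s : 0 <= J s by apply: Rint_ge0 => x; apply: mulr_ge0 => //; exact/ltW/phi_gt0.
have wM s x : 0 < s <= t -> `|u x s - v x s| <= 2 * M /\ `|2^-1 * (u x s + v x s)| <= M.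
  move=> /andP[s0 st]; have h : 0 < s < t + 1 by rewrite s0/=; lra.
  have [a1 a2] := hM x s h; split; first by apply: le_trans (ler_normB _ _) _; lra.
  by rewrite normrM ger0_norm//; have := ler_normD (u x s) (v x s); lra.
have JM s : 0 < s <= t -> J s <= 2 * M * I (phi r).
  move=> h; rewrite -(RintZ _ ip); apply: Rint_le; [|exact: L1Z|].
    by apply: diff_phi_L1 => //; move/andP: h => [].
  by move=> x; apply: ler_wpM2r; [exact/ltW/phi_gt0|have [] := wM s x h].
have step s tau A : 0 < s -> s <= tau -> tau <= t -> (forall sg, s <= sg <= t -> J sg <= A) ->
    J tau <= J s + (tau - s) * (B + M / r * A).
  move=> s0 st tt hA; apply: (kato_diff (weight_phi r1)) => // sg /andP[h1 h2].
  have h3 : 0 < sg <= t by apply/andP; split; lra.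
  have sg0 : 0 < sg by lra.
  have [K [m1 _ b1 _ _]] := sol_C11 hu hv sg0.
  apply: lerD.
    rewrite BE; apply: ler_wpM2l => //.
    have iL := L1_abs (Lopm_L1x hal (weight_phi r1)).
    rewrite /lam -(RintZ _ iL); apply: Rint_le; [|exact: L1Z|].
      by apply: (L1_mulb (meas_norm m1) _ iL (K := K)) => x; rewrite normr_id.
    by move=> x; apply: ler_wpM2r => //; have [] := wM sg x h3.
  apply: (@le_trans _ _ (M / r * J sg)).
    rewrite -(RintZ _ (diff_phi_L1 r0 sg0)); apply: Rint_le.
    - have id : L1 (fun x => `|dphi r x|).
        by apply: (L1_dom (meas_norm (dphi_meas r)) (L1Z r^-1 ip)) => x; rewrite normr_id mulrC dphi_le.
      have [K2 [m2 _ b2 _ _]] : exists K, C11 K (fun x => 2^-1 * (u x sg + v x sg)) (fun x => 2^-1 * (ux x sg + vx x sg)).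
        have t2 : 0 < sg / 2 < sg + 1 by apply/andP; split; lra.
        have ht : sg / 2 < sg < sg + 1 by apply/andP; split; lra.
        have [K' [_ ru rv _]] := pair_reg hu hv t2.
        by eexists; exact: C11Z (C11D (sr_C11 ru ht) (sr_C11 rv ht)).
      apply: (L1_mulb _ _ id (K := K * K2)).
        by apply: measurable_funM; exact: meas_norm.
      by move=> x; rewrite normrM !normr_id; apply: ler_pM.
    - exact: L1Z (diff_phi_L1 r0 sg0).
    move=> x; have [_ a2] := wM sg x h3.
    have -> : M / r * (`|u x sg - v x sg| * phi r x) = `|u x sg - v x sg| * M * (phi r x / r) by ring.
    by apply: ler_pM; [apply: mulr_ge0| |apply: ler_wpM2l|exact: dphi_le].
  apply: ler_wpM2l; first by apply: divr_ge0 => //; exact: ltW.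
  by apply: hA; apply/andP; split; lra.
have key s : 0 < s -> s <= t -> (1 - q) * J t <= J s + t * B.
  move=> s0 st.
  pose S := [set J tau | tau in [set tau | s <= tau <= t]].
  have hS : has_sup S.
    split; first by exists (J t), t; rewrite //= st lexx.
    exists (2 * M * I (phi r)) => _ [tau /= /andP[h1 h2] <-]; apply: JM.
    by apply/andP; split; lra.
  have [A AE] : exists A : R, A = sup S by eexists.
  have ub sg : s <= sg <= t -> J sg <= A.
    by move=> h; rewrite AE; apply: ub_le_sup; [case: hS|exists sg].
  have A0 : 0 <= A by apply: le_trans (J0 t) (ub t _); rewrite st lexx.
  have D0 : 0 <= B + M / r * A.
    by apply: addr_ge0 => //; apply: mulr_ge0 => //; apply: divr_ge0 => //; exact: ltW.
  have le : A <= J s + t * B + q * A.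
    rewrite [leLHS]AE; apply: ge_sup; first by case: hS.
    move=> _ [tau /= /andP[h1 h2] <-]; apply: le_trans (step s tau A s0 h1 h2 ub) _.
    have -> : J s + t * B + q * A = J s + t * (B + M / r * A) by rewrite qE; ring.
    by rewrite lerD2l; apply: ler_wpM2r => //; lra.
  have q1 : 0 <= 1 - q by rewrite qE; lra.
  have : (1 - q) * J t <= (1 - q) * A by apply: ler_wpM2l => //; apply: ub; rewrite st lexx.
  lra.
have [E E0 hE] := initial_layer hal hu hv hL r1.
rewrite -subr_le0; apply: (@le0_of_linear _ (2 * E)) => h h0 h1.
have al0 : 0 < al by move/andP: hal => [? ?]; lra.
have th : 0 < 1 - al^-1 <= 1.
  have i0 : 0 < al^-1 by rewrite invr_gt0.
  have i1 : al^-1 < 1 by rewrite invf_lt1//; move/andP: hal => [].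
  by apply/andP; split; lra.
have [h' [h'0 h't h'h h'i]] : exists h' : R, [/\ 0 < h', h' <= t, h' <= h & h' <= 1].
  by exists (Num.min h t); rewrite lt_min h0 t0 !ge_min !lexx orbT h1 orTb.
have h'1 : 0 < h' <= 1 by rewrite h'0 h'i.
have [s0 s1 se] := powR_root th h'1.
have hs1 : h' `^ (1 - al^-1)^-1 <= 1 by lra.
have hst : h' `^ (1 - al^-1)^-1 <= t by lra.
have k := key _ s0 hst; have := hE _ s0 hs1; rewrite se -/(J _) -/(J _) -/V => e.
have : E * (h' `^ (1 - al^-1)^-1 + h') <= E * (2 * h) by apply: ler_wpM2l => //; lra.
rewrite -/(J t); lra.
Qed.

(** As [r] grows, both [t M / r] and [lam al r] vanish and [phi r] tends to 1; Fatou gives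
    integrability and the bound at once. *)
Lemma contraction (t : R) : 0 < t -> L1 (fun x => u x t - v x t) /\
  I (fun x => `|u x t - v x t|) <= V.
Proof.
move=> t0; have t10 : 0 < t + 1 by lra.
have [M M1 hM] := pair_bound hu hv t10.
have M0 : 0 <= M by lra.
have c0 : 0 <= Calpha al := ltW (Calpha_gt0 hal).
have [K [m1 _ b1 _ _]] := sol_C11 hu hv t0.
apply: L1_of_le => //.
pose J n := I (fun x => `|u x t - v x t| * phi n.+1%:R x).
have n1 n : 1 <= n.+1%:R :> R by rewrite ler1n.
have n0 n : 0 < n.+1%:R :> R by [].
apply: (@fatou_le setT (fun n x => `|u x t - v x t| * phi n.+1%:R x)) => //.
- by move=> n; apply: measurable_funM; [exact: meas_norm|exact: phi_meas].
- by move=> n x _; apply: mulr_ge0 => //; exact/ltW/phi_gt0.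
- move=> x _; rewrite -[X in _ --> X]mulr1; apply: cvgMl_tmp; exact: phi_cvg1.
move=> e e0.
pose q n : R := t * M * n.+1%:R^-1.
pose B n : R := V + t * (Calpha al * (2 * M * lam al n.+1%:R)).
have hq : q n @[n --> \oo] --> (0 : R).
  by rewrite -[X in _ --> X](mulr0 (t * M)); apply: cvgMl_tmp; exact: cvg_harmonic.
have hB : B n @[n --> \oo] --> V.
  have -> : V = V + t * (Calpha al * (2 * M * 0)) by ring.
  apply: cvgD; first exact: cvg_cst.
  by apply: cvgMl_tmp; apply: cvgMl_tmp; apply: cvgMl_tmp; exact: lam_cvg0.
have hX : B n + 2 * q n * B n @[n --> \oo] --> V.
  have -> : V = V + 2 * 0 * V by ring.
  by apply: cvgD => //; apply: cvgM => //; exact: cvgMl_tmp.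
near=> n.
have q2 : q n <= 2^-1.
  have : `|0 - q n| <= 2^-1 by near: n; move/cvgrPdist_le : hq; apply.
  by rewrite sub0r normrN; apply: le_trans; exact: ler_norm.
have : `|V - (B n + 2 * q n * B n)| <= e by near: n; move/cvgrPdist_le : hX; apply.
have q0 : 0 <= q n by apply: mulr_ge0; [apply: mulr_ge0 => //; exact: ltW|].
have h := contraction_phi M1 hM (n1 n) t0 q2.
rewrite distrC => hV; rewrite (RintE (diff_phi_L1 (n0 n) t0)) -EFinD lee_fin.
have hn := le_trans (ler_norm _) hV.
move: h; rewrite -/(q n) -/(B n) -/(J n).
have J0 : 0 <= J n by apply: Rint_ge0 => x; apply: mulr_ge0 => //; exact/ltW/phi_gt0.
move: q0 q2 hn J0; move: (J n) (B n) (q n) => Jn Bn qn q0 q2 hn J0 h.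
(* From [(1 - q) J <= B] and [q <= 1/2] follows [J <= 2 B], hence [J <= B + 2 q B], a bound without
   division that tends to [V]. *)
have J2 : 0 <= 2 * Bn - Jn.
  have q3 : 0 <= 2^-1 - qn by lra.
  have := mulr_ge0 J0 q3; lra.
have := mulr_ge0 q0 J2; lra.
Unshelve. all: try end_near.
Qed.

End Contraction.

(** * Initial data of bounded variation *)

(* On a window the integral of F (x + k) - F x telescopes to an end piece of length k. *)
Lemma monotone_translate_pos (F : R -> R) (B k : R) : 0 <= k -> {homo F : x y / x <= y} ->
  (forall x, 0 <= F x <= B) ->
  L1 (fun x => F (x + k) - F x) /\ I (fun x => `|F (x + k) - F x|) <= B * k.
Proof.
move=> k0 hF FB; have mF : meas F by exact: nondecreasing_measurable.
have F0 x : 0 <= F x by have /andP[] := FB x.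
have FleB x : F x <= B by have /andP[] := FB x.
have Fn x : `|F x| <= B by rewrite ger0_norm.
have B0 : 0 <= B := le_trans (F0 0) (FleB 0).
have mD : meas (fun x => F (x + k) - F x) by apply: measurable_funB => //; exact: meas_comp_shift.
apply: L1_of_le => //.
apply: (@fatou_le setT (fun n x => `|F (x + k) - F x| * \1_`]- n%:R, n%:R] x)) => //.
- move=> n; apply: measurable_funM; first exact: meas_norm.
  exact: L1_meas (L1_indic _ _).
- move=> x _; rewrite -[X in _ --> X]mulr1; apply: cvgMl_tmp.
  apply: cvg_near_cst; near=> n; rewrite indicE mem_set//= in_itv/=.
  have h : `|x| < n%:R by near: n; exact: nbhs_infty_gtr.
  by rewrite ltrNl; apply/andP; split; [apply: le_lt_trans h; rewrite -normrN ler_norm|apply/ltW/le_lt_trans/h; exact: ler_norm].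
move=> e e0; apply: nearW => n.
have nn : - n%:R <= n%:R :> R by rewrite lerNl; apply: le_trans (ler0n _ n); rewrite lerNl oppr0.
have ii := @L1_indic (- n%:R) n%:R.
have i1 : L1 (fun x => F (x + k) * \1_`]- n%:R, n%:R] x).
  by apply: (L1_mulb _ _ ii (K := B)) => //; exact: meas_comp_shift.
have i2 : L1 (fun x => F x * \1_`]- n%:R, n%:R] x) by exact: (L1_mulb mF Fn ii).
have e1 x : `|F (x + k) - F x| * \1_`]- n%:R, n%:R] x =
    F (x + k) * \1_`]- n%:R, n%:R] x - F x * \1_`]- n%:R, n%:R] x.
  by rewrite ger0_norm ?mulrBl// subr_ge0; apply: hF; rewrite lerDl.
have -> : (\int[mu]_x (`|F (x + k) - F x| * \1_`]- n%:R, n%:R] x)%:E =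
   (I (fun x => F (x + k) * \1_`]- n%:R, n%:R] x - F x * \1_`]- n%:R, n%:R] x))%:E)%E.
  by rewrite -RintE; [apply: eq_integral => x _; rewrite e1|exact: L1B].
rewrite -EFinD lee_fin.
suff : I (fun x => F (x + k) * \1_`]- n%:R, n%:R] x - F x * \1_`]- n%:R, n%:R] x) <= B * k by move=> h; lra.
rewrite (RintB i1 i2).
have i3 := L1_shift (- k) i1; have i4 := @L1_indic n%:R (n%:R + k).
rewrite -(Rint_shift (- k) i1) -(RintB i3 i2).
have -> : B * k = I (fun x => B * \1_`]n%:R, n%:R + k] x).
  by rewrite (RintZ _ i4) Rint_indic ?lerDl//; ring.
apply: Rint_le; [exact: L1B|exact: L1Z|].
move=> x; rewrite subrK -mulrBr.
have q : \1_`]- n%:R, n%:R] (x - k) - \1_`]- n%:R, n%:R] x <= \1_`]n%:R, n%:R + k] x :> R.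
  rewrite lerBlDr !indicE.
  case: (boolP (x - k \in _)) => [|_]; last by rewrite addr_ge0.
  rewrite inE/= in_itv/= => /andP[h1 h2].
  have [xn|xn] := leP x n%:R.
    rewrite [in leRHS](mem_set (A := `]- n%:R, n%:R])) ?lerDr//=.
    by rewrite in_itv/= xn andbT; lra.
  rewrite mem_set ?lerDl//=; rewrite in_itv/= xn/=; lra.
apply: le_trans (ler_wpM2l (F0 x) q) _.
by apply: ler_wpM2r => //; rewrite indicE.
Unshelve. all: try end_near.
Qed.

Lemma monotone_translate (F : R -> R) (B k : R) : {homo F : x y / x <= y} ->
  (forall x, 0 <= F x <= B) ->
  L1 (fun x => F (x + k) - F x) /\ I (fun x => `|F (x + k) - F x|) <= B * `|k|.
Proof.
move=> hF FB; have [k0|k0] := leP 0 k; first by rewrite ger0_norm//; exact: monotone_translate_pos.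
have nk : 0 <= - k by rewrite oppr_ge0 ltW.
have [iD lD] := monotone_translate_pos nk hF FB.
have e x : F (x + k) - F x = - (F (x + k - k) - F (x + k)) by rewrite addrK; ring.
have i' := L1_shift k iD.
rewrite ltr0_norm//; split.
  by under eq_fun do rewrite e -mulN1r; exact: L1Z.
apply: le_trans lD; rewrite -[leRHS](Rint_shift k (L1_abs iD)).
by rewrite le_eqVlt; apply/orP; left; apply/eqP; apply: Rint_eq => x; rewrite e normrN.
Qed.

Lemma measure_cdf_bounds (nu : {finite_measure set R -> \bar R}) :
  let F := fun x : R => fine (nu [set` `]-oo, x]]) in
  {homo F : x y / x <= y} /\ forall x, 0 <= F x <= fine (nu setT).
Proof.
have fn (A : set R) : measurable A -> nu A \is a fin_num by move=> mA; exact: fin_num_measure.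
split.
  move=> x y xy; apply: fine_le; [exact: fn|exact: fn|].
  by apply: le_measure; rewrite ?inE//; apply: subset_itvl; rewrite bnd_simp.
move=> x; apply/andP; split; first by apply: fine_ge0; exact: measure_ge0.
by apply: fine_le; [exact: fn|exact: fn|apply: le_measure; rewrite ?inE].
Qed.

(** The Jordan decomposition writes the datum as a constant plus a difference of two bounded
    monotone functions; the [V] obtained is the total variation of [m]. *)
Lemma init_data_props (c : R) (m : {charge set R -> \bar R}) :
  [/\ meas (init_data c m), exists M0, forall x, `|init_data c m x| <= M0 &
   exists2 V, 0 <= V & forall k, L1 (fun x => init_data c m (x + k) - init_data c m x) /\
     I (fun x => `|init_data c m (x + k) - init_data c m x|) <= V * `|k|].
Proof.
have [P [N PN]] := Hahn_decomposition m.
pose p : {finite_measure set R -> \bar R} := jordan_pos PN.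
pose n : {finite_measure set R -> \bar R} := jordan_neg PN.
have [hp bp] := measure_cdf_bounds p; have [hn bn] := measure_cdf_bounds n.
pose F (x : R) := fine (p [set` `]-oo, x]]); pose G (x : R) := fine (n [set` `]-oo, x]]).
have E x : init_data c m x = c + (F x - G x).
  have mA : measurable [set` `]-oo, x]] by [].
  have fp : p [set` `]-oo, x]] \is a fin_num by exact: fin_num_measure.
  have fn : n [set` `]-oo, x]] \is a fin_num by exact: fin_num_measure.
  rewrite /init_data (jordan_decomp PN mA) /F /G -fineB//.
  by rewrite /cadd/= cscaleN1.
have E' k x : init_data c m (x + k) - init_data c m x = (F (x + k) - F x) - (G (x + k) - G x).
  by rewrite !E; ring.
have mF : meas F by exact: nondecreasing_measurable.
have mG : meas G by exact: nondecreasing_measurable.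
split.
- have -> : init_data c m = (fun x => c + (F x - G x)) by apply/funext.
  by apply: measurable_funD => //; exact: measurable_funB.
- exists (`|c| + (fine (p setT) + fine (n setT))) => x; rewrite E.
  apply: le_trans (ler_normD _ _) _; rewrite lerD2l; apply: le_trans (ler_normB _ _) _.
  have /andP[a1 a2] := bp x; have /andP[b1 b2] := bn x.
  by apply: lerD; rewrite ger0_norm.
exists (fine (p setT) + fine (n setT)).
  by apply: addr_ge0; apply: fine_ge0; exact: measure_ge0.
move=> k; have [i1 l1] := monotone_translate k hp bp; have [i2 l2] := monotone_translate k hn bn.
split; first by under eq_fun do rewrite E'; exact: L1B.
rewrite mulrDl; apply: le_trans (lerD l1 l2).
rewrite -(RintD (L1_abs i1) (L1_abs i2)); apply: Rint_le.
- by under eq_fun do rewrite E'; apply/L1_abs/L1B.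
- by apply: L1D; exact: L1_abs.
- by move=> x; rewrite E'; exact: ler_normB.
Qed.

(** * The space derivative *)

Section SpaceDerivative.

Lemma L1_eq f g : f =1 g -> L1 f -> L1 g.
Proof. by move=> /funext ->. Qed.

Lemma diffquot_cvg K (f f' : R -> R) x : C11 K f f' ->
  (f (x + n.+1%:R^-1) - f x) * n.+1%:R @[n --> \oo] --> f' x.
Proof.
move=> hf; have K0 := C11_ge0 hf; have [_ _ _ _ hr] := hf.
have H : K * n.+1%:R^-1 @[n --> \oo] --> (0 : R).
  by rewrite -[X in _ --> X](mulr0 K); apply: cvgMl_tmp; exact: cvg_harmonic.
apply/cvgrPdist_le => e e0; move/cvgrPdist_le : H => /(_ e e0).
apply: filterS => n; rewrite sub0r normrN => h.
have n0 : n.+1%:R != 0 :> R by [].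
have := hr x n.+1%:R^-1.
have -> : f' x - (f (x + n.+1%:R^-1) - f x) * n.+1%:R = - (rem f f' x n.+1%:R^-1 * n.+1%:R).
  by rewrite /rem; field.
rewrite normrN normrM (ger0_norm (ler0n R n.+1)) => h2.
apply: le_trans (le_trans (ler_norm _) h).
have -> : K * n.+1%:R^-1 = K * n.+1%:R^-1 ^+ 2 * n.+1%:R :> R by field.
exact: ler_wpM2r.
Qed.

(** The cut-off wanted for the tails is [1 - phi r], which is not an integrable weight. Replacing 1
    by [phi r'] makes it admissible; the sign comes from the monotonicity of [phi] in the radius. *)
Lemma weight_phiB (r r' : R) : 1 <= r -> r <= r' ->
  weight 12 (fun x : R => 6 * phi r' x + 6 * phi r x) (fun x : R => phi r' x - phi r x)
    (fun x : R => dphi r' x - dphi r x).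
Proof.
move=> r1 rr'; have r'1 : 1 <= r' by lra.
have r0 : 0 < r by lra.
have [[a1 a2] a3 a4 a5 a6] := weight_phi r1.
have [[b1 b2] b3 b4 b5 b6] := weight_phi r'1.
split.
- by split; exact: measurable_funB.
- exact: L1D.
- move=> x; have [/andP[c1 c2] c3] := a4 x; have [/andP[d1 d2] d3] := b4 x.
  have h := phi_homo x r0 rr'; split; first by apply/andP; split; lra.
  by apply: le_trans (ler_normB _ _) _; exact: lerD.
- by move=> x; have := a5 x; have := b5 x; lra.
move=> x y y1.
have -> : rem (fun x => phi r' x - phi r x) (fun x => dphi r' x - dphi r x) x y =
  rem (phi r') (dphi r') x y - rem (phi r) (dphi r) x y by rewrite /rem; ring.
by apply: le_trans (ler_normB _ _) _; rewrite mulrDr; apply: lerD; [exact: b6|exact: a6].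
Qed.

Variable al : R.
Hypothesis hal : 1 < al < 2.
Local Notation Lopm := (Lopm al).
Variables (u0 : R -> R) (u ux ut : R -> R -> R) (V : R).
Hypotheses (hu : regsol al u0 u ux ut)
  (hV : forall k, L1 (fun x => u0 (x + k) - u0 x) /\ I (fun x => `|u0 (x + k) - u0 x|) <= V * `|k|).

Lemma regsol_C11 t : 0 < t -> exists K, C11 K (u ^~ t) (ux ^~ t).
Proof.
move=> t0; have t2 : 0 < t / 2 < t + 1 by apply/andP; split; lra.
have ht : t / 2 < t < t + 1 by apply/andP; split; lra.
by have [K r] := rs_reg hu t2; exists K; exact: (sr_C11 r ht).
Qed.

Lemma translate_le k t : 0 < t -> L1 (fun x => u (x + k) t - u x t) /\
  I (fun x => `|u (x + k) t - u x t|) <= V * `|k|.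
Proof.
move=> t0; have [i0 l0] := hV k.
have [h1 h2] := contraction hal (regsol_shift k hu) hu i0 t0.
by split=> //; exact: le_trans h2 l0.
Qed.

(** Fatou for difference quotients, whose norms are at most [V] by contraction against
    translates. *)
Lemma ux_L1 t : 0 < t -> L1 (ux ^~ t) /\ I (fun x => `|ux x t|) <= V.
Proof.
move=> t0; have [K hK] := regsol_C11 t0; have [m1 m2 _ _ _] := hK.
apply: L1_of_le => //.
apply: (@fatou_le setT (fun n x => `|(u (x + n.+1%:R^-1) t - u x t) * n.+1%:R|)) => //.
- move=> n; apply: meas_norm; apply: measurable_funM => //.
  by apply: measurable_funB => //; exact: (meas_comp_shift n.+1%:R^-1 m1).
- by move=> x _; apply: cvg_norm; exact: (diffquot_cvg hK).
move=> e e0; apply: nearW => n.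
have [i1 l1] := translate_le n.+1%:R^-1 t0.
have i2 := L1_abs (L1Zr n.+1%:R i1).
rewrite (RintE i2) -EFinD lee_fin.
have -> : I (fun x => `|(u (x + n.+1%:R^-1) t - u x t) * n.+1%:R|) =
   n.+1%:R * I (fun x => `|u (x + n.+1%:R^-1) t - u x t|).
  by rewrite -(RintZ _ (L1_abs i1)); apply: Rint_eq => x; rewrite normrM (ger0_norm (ler0n R n.+1)) mulrC.
have : n.+1%:R * I (fun x => `|u (x + n.+1%:R^-1) t - u x t|) <= n.+1%:R * (V * `|n.+1%:R^-1|).
  exact: ler_wpM2l.
have -> : n.+1%:R * (V * `|n.+1%:R^-1|) = V :> R.
  by rewrite ger0_norm; [field|rewrite invr_ge0].
by move=> h; lra.
Qed.

Lemma quot_int_cvg ch t : L1 ch -> 0 < t ->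
  n.+1%:R * I (fun x => `|u (x + n.+1%:R^-1) t - u x t| * ch x) @[n --> \oo] --> I (fun x => `|ux x t| * ch x).
Proof.
move=> ich t0; have [K hK] := regsol_C11 t0; have [m1 m2 b1 _ _] := hK.
have K0 := C11_ge0 hK.
have im k : L1 (fun x => `|u (x + k) t - u x t| * ch x).
  apply: (L1_mulb _ _ ich (K := K + K)).
    by apply: meas_norm; apply: measurable_funB => //; exact: (meas_comp_shift k m1).
  by move=> x; rewrite normr_id; apply: le_trans (ler_normB _ _) (lerD _ _).
have e n : n.+1%:R * I (fun x => `|u (x + n.+1%:R^-1) t - u x t| * ch x) =
   I (fun x => `|(u (x + n.+1%:R^-1) t - u x t) * n.+1%:R| * ch x).
  rewrite -(RintZ _ (im _)); apply: Rint_eq => x.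
  by rewrite normrM (ger0_norm (ler0n R n.+1)); ring.
rewrite (eq_cvg _ _ e).
apply: (@Rint_cvg _ _ (fun x => 2 * K * `|ch x|)).
- move=> n; apply: measurable_funM; last exact: L1_meas ich.
  apply: meas_norm; apply: measurable_funM => //.
  by apply: measurable_funB => //; exact: (meas_comp_shift n.+1%:R^-1 m1).
- exact/L1Z/L1_abs.
- move=> n x; rewrite normrM normr_id; apply: ler_wpM2r => //.
  rewrite normrM (ger0_norm (ler0n R n.+1)).
  have n0 : 0 <= n.+1%:R^-1 :> R by rewrite invr_ge0.
  have := C11_lip hK x n.+1%:R^-1; rewrite (ger0_norm n0).
  by rewrite -ler_pdivlMr ?invr_gt0// invrK.
move=> x; apply: cvgMr_tmp; apply: cvg_norm; exact: (diffquot_cvg hK).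
Qed.

(** Kato's inequality for [u] and its translate by [k], divided by [k]. The difference has L^1 norm
    at most [V k], so sup bounds on [Lopm] of the weight and on its derivative are called for, and
    both are [O(1 / r)]. The constants 12 and 2 are twice those for a single [phi]. *)
Lemma tail_step (M r r' s t : R) : 1 <= M ->
  (forall x tau : R, 0 < tau < t + 1 -> `|u x tau| <= M) -> 1 <= r -> r <= r' -> 0 < s -> s <= t ->
  I (fun x => `|ux x t| * (phi r' x - phi r x)) <= I (fun x => `|ux x s| * (phi r' x - phi r x)) +
    (t - s) * ((Calpha al * (12 * I (fun z => m2 z * qk al z)) + 2 * M) * V / r).
Proof.
move=> M1 hM r1 rr' s0 st; have r0 : 0 < r by lra.
have r'0 : 0 < r' by lra.
have t0 : 0 < t by lra.
have M0 : 0 <= M by lra.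
have c0 : 0 <= Calpha al := ltW (Calpha_gt0 hal).
have hw := weight_phiB r1 rr'.
have ich := weight_L1 hw.
have [Q QE] : exists Q : R, Q = I (fun z => m2 z * qk al z) by eexists.
have Q0 : 0 <= Q by rewrite QE; apply: Rint_ge0 => z; apply: mulr_ge0; [exact: m2_ge0|exact: qk_ge0].
rewrite -QE.
have [B BE] : exists B : R, B = (Calpha al * (12 * Q) + 2 * M) * V / r by eexists.
rewrite -BE.
have step n : n.+1%:R * I (fun x => `|u (x + n.+1%:R^-1) t - u x t| * (phi r' x - phi r x)) <=
   n.+1%:R * I (fun x => `|u (x + n.+1%:R^-1) s - u x s| * (phi r' x - phi r x)) + (t - s) * B.
  have [k kE] : exists k : R, k = n.+1%:R^-1 by eexists.
  have k0 : 0 < k by rewrite kE invr_gt0.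
  have nk : n.+1%:R = k^-1 by rewrite kE invrK.
  rewrite -kE nk.
  have -> : (t - s) * B = k^-1 * ((t - s) * (k * B)) by field; rewrite gt_eqF.
  rewrite -mulrDr; apply: ler_wpM2l; first by rewrite invr_ge0 ltW.
  apply: (kato_diff hal (regsol_shift k hu) hu hw s0 st) => tau /andP[h1 h2].
  have tau0 : 0 < tau by lra.
  have tauT : 0 < tau < t + 1 by rewrite tau0/=; lra.
  have [iD lD] := translate_le k tau0; have iA := L1_abs iD.
  rewrite gtr0_norm// in lD.
  have Lb x : `|Lopm (fun x => phi r' x - phi r x) (fun x => dphi r' x - dphi r x) x| <= 12 / r * Q.
    rewrite QE; apply: (Lopm_sup_le hal hw) => {}x z.
    have -> : rem (fun x => phi r' x - phi r x) (fun x => dphi r' x - dphi r x) x (- z) =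
      rem (phi r') (dphi r') x (- z) - rem (phi r) (dphi r) x (- z) by rewrite /rem; ring.
    apply: le_trans (ler_normB _ _) _.
    have p1 := rem_phi_sup x (- z) (le_trans r1 rr'); have p2 := rem_phi_sup x (- z) r1.
    rewrite m2N in p1 p2.
    have : 6 / r' * m2 z <= 6 / r * m2 z.
      by apply: ler_wpM2r; [exact: m2_ge0|apply: ler_wpM2l => //; rewrite lef_pV2 ?posrE].
    have -> : 12 / r * m2 z = 6 / r * m2 z + 6 / r * m2 z by ring.
    by move=> h; apply: lerD => //; exact: le_trans h.
  have db x : `|dphi r' x - dphi r x| <= 2 / r.
    have one y : 0 < y -> `|dphi y x| <= y^-1.
      move=> y0; apply: le_trans (dphi_le x y0) _.
      by apply: ler_piMl; [rewrite invr_ge0 ltW|exact: phi_le1].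
    apply: le_trans (ler_normB _ _) _.
    have -> : 2 / r = r^-1 + r^-1 by ring.
    apply: lerD; last exact: one.
    by apply: le_trans (one _ r'0) _; rewrite lef_pV2 ?posrE.
  have bb x : `|2^-1 * (u (x + k) tau + u x tau)| <= M.
    rewrite normrM ger0_norm//; have := ler_normD (u (x + k) tau) (u x tau).
    by have := hM (x + k) tau tauT; have := hM x tau tauT; lra.
  have -> : k * B = Calpha al * (12 / r * Q * (V * k)) + M * (2 / r) * (V * k).
    by rewrite BE; field; rewrite gt_eqF.
  have Q1 : 0 <= 12 / r * Q by apply: mulr_ge0 => //; apply: divr_ge0 => //; exact: ltW.
  have M2 : 0 <= M * (2 / r) by apply: mulr_ge0 => //; apply: divr_ge0 => //; exact: ltW.
  have [K [m1 m1' b1 _ _]] := regsol_C11 tau0.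
  have ms : meas (fun x => u (x + k) tau) := meas_comp_shift k m1.
  have mL : meas (Lopm (fun x => phi r' x - phi r x) (fun x => dphi r' x - dphi r x)).
    exact: L1_meas (Lopm_L1x hal hw).
  apply: lerD.
    apply: ler_wpM2l => //.
    apply: (@le_trans _ _ (I (fun x => 12 / r * Q * `|u (x + k) tau - u x tau|))).
      apply: Rint_le; [|exact: L1Z|by move=> x; rewrite mulrC; apply: ler_wpM2r].
      under eq_fun do rewrite mulrC.
      by apply: (L1_mulb (meas_norm mL) _ iA) => x; rewrite normr_id; exact: Lb.
    by rewrite (RintZ _ iA); apply: ler_wpM2l.
  apply: (@le_trans _ _ (I (fun x => M * (2 / r) * `|u (x + k) tau - u x tau|))); last first.
    by rewrite (RintZ _ iA); apply: ler_wpM2l.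
  apply: Rint_le; [|exact: L1Z|].
    have [[_ md] _ _ _ _] := hw.
    apply: (@L1_eq (fun x => (`|2^-1 * (u (x + k) tau + u x tau)| * `|dphi r' x - dphi r x|) *
        `|u (x + k) tau - u x tau|)); first by move=> x; ring.
    apply: (L1_mulb _ _ iA (K := M * (2 / r))).
      apply: measurable_funM; apply: meas_norm => //.
      by apply: measurable_funM => //; exact: measurable_funD.
    by move=> x; rewrite normrM !normr_id; apply: ler_pM.
  move=> x; rewrite [leRHS]mulrC -mulrA.
  by apply: ler_wpM2l => //; apply: ler_pM.
have C1 := quot_int_cvg ich t0.
have C2 : n.+1%:R * I (fun x => `|u (x + n.+1%:R^-1) s - u x s| * (phi r' x - phi r x)) + (t - s) * B @[n --> \oo]
   --> I (fun x => `|ux x s| * (phi r' x - phi r x)) + (t - s) * B.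
  by apply: cvgD; [exact: quot_int_cvg|exact: cvg_cst].
by apply: (ler_cvg_to C1 C2); apply: nearW => n; exact: step.
Qed.

End SpaceDerivative.

(** * Uniform tails and continuity of the slope in every L^p *)

Section Continuity.

(** One [h] for both the sup and the L^1 bound makes the interpolated bound exactly [h], whatever
    [p] is, infinity included. *)
Lemma Lnorm_le (p : \bar R) (g : R -> R) (h : R) : (1 <= p)%E -> 0 <= h -> L1 g ->
  (forall x, `|g x| <= h) -> I (fun x => `|g x|) <= h -> ('N[mu]_p[EFin \o g] <= h%:E)%E.
Proof.
move=> p1 h0 ig gh Ig; rewrite unlock /Lnorm; case: p p1 => [p| |]//.
  rewrite lee_fin => p1; have p0 : 0 < p by lra.
  have pn0 : p != 0 by rewrite gt_eqF.
  have e x : (`|(EFin \o g) x| `^ p)%E = (`|g x| `^ p)%:E by [].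
  under eq_integral do rewrite e.
  have split_p y : 0 <= y -> y `^ p = y `^ (p - 1) * y.
    by move=> y0; have := @powRD R y (p - 1) 1; rewrite subrK (negbTE pn0) powRr1//; apply.
  have le1 x : `|g x| `^ p <= h `^ (p - 1) * `|g x|.
    rewrite split_p//; apply: ler_wpM2r => //.
    by apply: ge0_ler_powR; rewrite ?nnegrE// subr_ge0.
  have mg := L1_meas ig.
  have ip : L1 (fun x => `|g x| `^ p).
    apply: (L1_dom _ (L1Z (h `^ (p - 1)) (L1_abs ig))).
      by apply: (@measurableT_comp _ _ _ _ _ _ (fun y : R => y `^ p)); [exact: measurable_powR|exact: meas_norm].
    by move=> x; rewrite ger0_norm ?powR_ge0.
  rewrite (RintE ip) poweR_EFin lee_fin.
  have -> : h = (h `^ p) `^ p^-1 by rewrite -powRrM divff// powRr1.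
  apply: ge0_ler_powR; rewrite ?nnegrE ?powR_ge0//.
  - by rewrite invr_ge0 ltW.
  - by apply: Rint_ge0 => x; exact: powR_ge0.
  apply: le_trans (Rint_le ip (L1Z _ (L1_abs ig)) le1) _.
  rewrite (RintZ _ (L1_abs ig)).
  by rewrite [leRHS]split_p//; apply: ler_wpM2l => //; exact: powR_ge0.
move=> _; case: ifPn => [_|_]; last by rewrite lee_fin.
by apply/ess_supP; apply: nearW => x /=; rewrite lee_fin.
Qed.

Lemma phi_n_tail (f : R -> R) : L1 f ->
  I (fun x => `|f x| * (1 - phi n.+1%:R x)) @[n --> \oo] --> (0 : R).
Proof.
move=> iF; have -> : (0 : R) = I (fun x => `|f x| * 0).
  by rewrite -[LHS](mul0r (I f)) -(RintZ 0 iF); apply: Rint_eq => x; rewrite mul0r mulr0.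
apply: (@Rint_cvg _ _ (fun x => `|f x|)).
- move=> n; apply: measurable_funM; first exact: meas_norm (L1_meas iF).
  by apply: measurable_funB => //; exact: phi_meas.
- exact: L1_abs.
- move=> n x; rewrite normrM normr_id; apply: ler_piMr => //.
  by have := phi_gt0 n.+1%:R x; have := phi_le1 n.+1%:R x => a b; rewrite ger0_norm; lra.
move=> x; apply: cvgMl_tmp; have -> : (0 : R) = 1 - 1 by rewrite subrr.
by apply: cvgB; [exact: cvg_cst|exact: phi_cvg1].
Qed.

Variable al : R.
Hypothesis hal : 1 < al < 2.
Variables (u0 : R -> R) (u ux ut : R -> R -> R) (V : R).
Hypotheses (hu : regsol al u0 u ux ut) (V0 : 0 <= V)
  (hV : forall k, L1 (fun x => u0 (x + k) - u0 x) /\ I (fun x => `|u0 (x + k) - u0 x|) <= V * `|k|).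

(** The error in [tail_step] does not depend on [r'], so the outer cut-off can be removed by
    dominated convergence. *)
Lemma tail_le (M r s t : R) : 1 <= M ->
  (forall x tau : R, 0 < tau < t + 1 -> `|u x tau| <= M) -> 1 <= r -> 0 < s -> s <= t ->
  I (fun x => `|ux x t| * (1 - phi r x)) <= I (fun x => `|ux x s| * (1 - phi r x)) +
    (t - s) * ((Calpha al * (12 * I (fun z => m2 z * qk al z)) + 2 * M) * V / r).
Proof.
move=> M1 hM r1 s0 st.
have key tau : 0 < tau -> I (fun x => `|ux x tau| * (phi n.+1%:R x - phi r x)) @[n --> \oo] -->
    I (fun x => `|ux x tau| * (1 - phi r x)).
  move=> tau0; have [iF _] := ux_L1 hal hu hV tau0.
  apply: (@Rint_cvg _ _ (fun x => `|ux x tau|)).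
  - move=> n; apply: measurable_funM; first exact: meas_norm (L1_meas iF).
    by apply: measurable_funB; exact: phi_meas.
  - exact: L1_abs.
  - move=> n x; rewrite normrM normr_id; apply: ler_piMr => //.
    have a := phi_gt0 n.+1%:R x; have b := phi_le1 n.+1%:R x.
    by have c := phi_gt0 r x; have d := phi_le1 r x; rewrite ler_norml; apply/andP; split; lra.
  move=> x; apply: cvgMl_tmp.
  by apply: cvgB; [exact: phi_cvg1|exact: cvg_cst].
have t0 : 0 < t by lra.
have [B BE] : exists B : R, B = (t - s) * ((Calpha al * (12 * I (fun z => m2 z * qk al z)) + 2 * M) * V / r) by eexists.
rewrite -BE.
have C2 : I (fun x => `|ux x s| * (phi n.+1%:R x - phi r x)) + B @[n --> \oo]
   --> I (fun x => `|ux x s| * (1 - phi r x)) + B.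
  by apply: cvgD; [exact: key|exact: cvg_cst].
apply: (ler_cvg_to (key t t0) C2).
near=> n; rewrite BE; apply: (tail_step hal hu hV M1 hM r1 _ s0 st).
apply: (@le_trans _ _ n%:R); last by rewrite ler_nat.
by near: n; exact: nbhs_infty_ger.
Unshelve. all: try end_near.
Qed.

(** Inside, the Lipschitz bound of [ux] in time is integrated against [phi r]; outside, [1 - phi r]
    measures the tails. The radius is chosen at the single time [t0 / 2], and [tail_le] carries the
    smallness to all of [[t0 / 2, t0 + 1]]. *)
Lemma ux_cont (t0 h : R) : 0 < t0 -> 0 < h -> exists2 d, 0 < d & forall t : R, `|t - t0| < d ->
  [/\ 0 < t, forall x, `|ux x t - ux x t0| <= h & I (fun x => `|ux x t - ux x t0|) <= h].
Proof.
move=> t00 h0; have s0 : 0 < t0 / 2 by lra.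
have aT : 0 < t0 / 4 < t0 + 2 by apply/andP; split; lra.
have [K reg] := rs_reg hu aT.
have ht0 : t0 / 4 < t0 < t0 + 2 by apply/andP; split; lra.
have K0 : 0 <= K := C11_ge0 (sr_C11 reg ht0).
have T0 : 0 < t0 + 2 by lra.
have [M M1 hM] := rs_bound hu T0.
have [C CE] : exists C : R, C = (Calpha al * (12 * I (fun z => m2 z * qk al z)) + 2 * M) * V by eexists.
have C0 : 0 <= C.
  have c0 : 0 <= Calpha al := ltW (Calpha_gt0 hal).
  have Q0 : 0 <= I (fun z => m2 z * qk al z) by apply: Rint_ge0 => z; apply: mulr_ge0; [exact: m2_ge0|exact: qk_ge0].
  rewrite CE; apply: mulr_ge0 => //; apply: addr_ge0; last by lra.
  by apply: mulr_ge0 => //; exact: mulr_ge0.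
have [is0 _] := ux_L1 hal hu hV s0.
have G : I (fun x => `|ux x (t0 / 2)| * (1 - phi n.+1%:R x)) + (t0 + 1) * C * n.+1%:R^-1 @[n --> \oo]
    --> (0 : R).
  have -> : (0 : R) = 0 + (t0 + 1) * C * 0 by ring.
  apply: cvgD; first exact: phi_n_tail.
  by apply: cvgMl_tmp; exact: cvg_harmonic.
have h4 : 0 < h / 4 by lra.
move/cvgrPdist_le : G => /(_ _ h4) /filter_ex[n]; rewrite sub0r normrN => /(le_trans (ler_norm _)) Gn.
have [r rE] : exists r : R, r = n.+1%:R by eexists.
have r1 : 1 <= r by rewrite rE ler1n.
have r0 : 0 < r by lra.
rewrite -rE in Gn.
have tail t : t0 / 2 <= t -> t <= t0 + 1 -> I (fun x => `|ux x t| * (1 - phi r x)) <= h / 4.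
  move=> t1 t2.
  have hMt (x tau : R) : 0 < tau < t + 1 -> `|u x tau| <= M.
    by move=> /andP[a b]; apply: hM; rewrite a/=; lra.
  have := tail_le M1 hMt r1 s0 t1; rewrite -CE => a; apply: le_trans a _; apply: le_trans Gn.
  rewrite lerD2l -mulrA; apply: ler_wpM2r; last by lra.
  by apply: divr_ge0 => //; exact: ltW.
have ip := L1_phi r0.
have I0 : 0 <= I (phi r) by apply: Rint_ge0 => x; exact/ltW/phi_gt0.
have [P PE] : exists P : R, P = I (phi r) by eexists.
rewrite -PE in I0.
have KP0 : 0 < (K + 1) * (P + 1) by apply: mulr_gt0; lra.
(* The first two entries keep [t] in that window; [(K + 1) (P + 1)] dominates both [K], for the sup
   bound, and [K P], for the integral. *)
pose d := Num.min (t0 / 2) (Num.min 1 (h / 2 / ((K + 1) * (P + 1)))).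
exists d.
  by rewrite !lt_min s0 ltr01/=; apply: divr_gt0 => //; lra.
move=> t; rewrite !lt_min => /andP[d1 /andP[d2]]; rewrite ltr_pdivlMr// => d3.
have a1 := ler_norm (t - t0); have := ler_norm (- (t - t0)); rewrite normrN => a2.
have t1 : t0 / 2 <= t by lra.
have t2 : t <= t0 + 1 by lra.
have tp : 0 < t by lra.
have ht : t0 / 4 < t < t0 + 2 by apply/andP; split; lra.
have n0 := normr_ge0 (t - t0).
have KP1 : K <= (K + 1) * (P + 1) by have := mulr_ge0 K0 I0; lra.
have KP2 : K * P <= (K + 1) * (P + 1) by lra.
have b1 : K * `|t - t0| <= h / 2.
  by have := ler_wpM2r n0 KP1; lra.
have b2 : K * P * `|t - t0| <= h / 2.
  by have := ler_wpM2r n0 KP2; lra.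
have ptw x : `|ux x t - ux x t0| <= K * `|t - t0| by exact: sr_uxt reg _ _ _ ht0 ht.
split=> //; first by move=> x; apply: le_trans (ptw x) _; lra.
have [i1 _] := ux_L1 hal hu hV tp; have [i2 _] := ux_L1 hal hu hV t00.
have ch0 x : 0 <= 1 - phi r x by have := phi_le1 r x; lra.
have it f : L1 f -> L1 (fun x => `|f x| * (1 - phi r x)).
  move=> iF; apply: (L1_dom _ (L1_abs iF)).
    apply: measurable_funM; first exact: meas_norm (L1_meas iF).
    by apply: measurable_funB => //; exact: phi_meas.
  move=> x; rewrite normrM normr_id ger0_norm//; apply: ler_piMr => //.
  by have := phi_gt0 r x; lra.
have T1 := tail t t1 t2.
have T2 : I (fun x => `|ux x t0| * (1 - phi r x)) <= h / 4 by apply: tail; lra.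
apply: (@le_trans _ _ (I (fun x => K * `|t - t0| * phi r x +
   (`|ux x t| * (1 - phi r x) + `|ux x t0| * (1 - phi r x))))).
  apply: Rint_le.
  - exact/L1_abs/L1B.
  - by apply: L1D; [exact: L1Z|apply: L1D; exact: it].
  move=> x.
  have -> : `|ux x t - ux x t0| = `|ux x t - ux x t0| * phi r x + `|ux x t - ux x t0| * (1 - phi r x) by ring.
  apply: lerD; first by apply: ler_wpM2r; [exact/ltW/phi_gt0|exact: ptw].
  by rewrite -mulrDl; apply: ler_wpM2r => //; exact: ler_normB.
rewrite RintD; [|exact: L1Z|by apply: L1D; exact: it].
rewrite (RintZ _ ip) (RintD (it _ i1) (it _ i2)) -PE.
by move: b2 T1 T2; lra.
Qed.

End Continuity.

End Burgers.

Theorem theorem2p2 (R : realType) (alpha : R) (halpha : 1 < alpha < 2) :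
  (forall (c : R) (m : {charge set R -> \bar R}) (u : R -> R -> R),
     is_solution alpha (init_data c m) u ->
     forall (p : \bar R), (1 <= p)%E -> forall T : R, 0 < T ->
       (forall t : R, 0 < t <= T ->
          ('N[@lebesgue_measure R]_p[EFin \o (fun x => dx u x t)] < +oo)%E) /\
       (forall t0 : R, 0 < t0 <= T ->
          ('N[@lebesgue_measure R]_p[EFin \o (fun x => (dx u x t - dx u x t0)%R)])%E
            @[t --> within (fun t => 0 < t <= T) (nbhs t0)] --> 0%E)) /\
  (forall (c ct : R) (m mt : {charge set R -> \bar R}) (u ut : R -> R -> R),
     is_solution alpha (init_data c m) u ->
     is_solution alpha (init_data ct mt) ut ->
     (forall t, 0 < t -> {ae @lebesgue_measure R, forall x, 0 <= dx ut x t}) ->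
     (@lebesgue_measure R).-integrable setT
        (EFin \o (fun x => init_data c m x - init_data ct mt x)) ->
     forall t : R, 0 < t ->
       (\int[@lebesgue_measure R]_x `|(u x t - ut x t)%:E|
         <= \int[@lebesgue_measure R]_x `|(init_data c m x - init_data ct mt x)%:E|)%E).

Proof.
split.
  move=> c m u hu p p1 T T0.
  have [mu0 bu0 [V V0 hV]] := init_data_props c m.
  have rs := sol_regsol halpha hu mu0 bu0.
  split.
    move=> t /andP[t0 _].
    have [iF lF] := ux_L1 halpha rs hV t0.
    have [K [_ _ _ bK _]] := regsol_C11 rs t0.
    have K0 : 0 <= K := le_trans (normr_ge0 _) (bK 0).
    (* [K] bounds the sup norm and [V] the L^1 norm; the sum is a common bound for [Lnorm_le]. *)
    apply: (@le_lt_trans _ _ (K + V)%:E); last exact: ltry.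
    apply: Lnorm_le => //.
    - exact: addr_ge0.
    - by move=> x; apply: le_trans (bK x) _; rewrite lerDl.
    - by apply: le_trans lF _; rewrite lerDr.
  move=> t0 /andP[t00 _].
  have N e : 0 < e -> \forall t \near within (fun t => 0 < t <= T) (nbhs t0),
      ('N[@lebesgue_measure R]_p[EFin \o (fun x => (dx u x t - dx u x t0)%R)] <= e%:E)%E.
    move=> e0; have [d d0 hd] := ux_cont halpha rs V0 hV t00 e0.
    rewrite near_withinE; near=> t; move=> _.
    have td : `|t - t0| < d.
      by rewrite distrC; near: t; apply/nbhs_ballP; exists d.
    have [tp h1 h2] := hd t td.
    apply: Lnorm_le => //; first exact: ltW.
    by apply: L1B; [have [] := ux_L1 halpha rs hV tp|have [] := ux_L1 halpha rs hV t00].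
  (* Convergence in the extended reals amounts to eventual finiteness and convergence of the real
     values. *)
  apply/fine_cvgP; split.
    apply: filterS (N 1 ltr01) => t ht.
    by rewrite ge0_fin_numE ?Lnorm_ge0//; exact: le_lt_trans ht (ltry _).
  apply/cvgrPdist_le => e e0; apply: filterS (N e e0) => t ht.
  rewrite sub0r normrN ger0_norm ?fine_ge0 ?Lnorm_ge0//=.
  rewrite -lee_fin fineK// ge0_fin_numE ?Lnorm_ge0//.
  exact: le_lt_trans ht (ltry _).
move=> c ct m mt u ut hu hut _ hL t t0.
have [mu0 bu0 _] := init_data_props c m.
have [mut but _] := init_data_props ct mt.
have rs := sol_regsol halpha hu mu0 bu0.
have rst := sol_regsol halpha hut mut but.
have [iw lw] := contraction halpha rs rst (L1_of_integrable hL) t0.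
have e (f : R -> R) : L1f f ->
    (\int[@lebesgue_measure R]_x `|(f x)%:E| = (RI (fun x => `|f x|))%:E)%E.
  by move=> iF; rewrite -RintE//; exact: L1_abs.
rewrite (e (fun x => u x t - ut x t) iw) (e (fun x => init_data c m x - init_data ct mt x) (L1_of_integrable hL)).
by rewrite lee_fin.
Unshelve. all: by end_near.
Qed.
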